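(* Let $r=|z_1|^2+|z_2|^2-|z_3|^2$, let $A,B$ be non-negative integers, and let $J=\mathcal{H}(2;A,B)\cap I(r)$. Then: \begin{itemize} \item $J=\{0\}$ if $(A,B)=(0,0)$. \item $J$ is empty if $(A,B)=(1,1)$, or if $A=0$ or $B=0$ but $A+B\neq 0$. \item If $(A,B)=(2,1)$ or $(1,2)$, then $\mathcal{D}^*(J)=1$ and hence is finite. \item If $(A,B)=(2,2)$, or $(3,1)$, or $(1,3)$, then $\mathcal{D}^*(J)=3$ and hence is finite. \item If $A,B\ge 2$ and $A+B\ge 6$, then $\mathcal{D}^*(J)=\infty$. \item If $A=1$ or $B=1$, but $AB>1$, then $\mathcal{D}^*(J)$ is finite. \end{itemize}
   Context: A Hermitian symmetric polynomial on $\mathbf{C}^{N}$ is a polynomial $p(z,\overline{w})=\sum c_{\alpha\beta}z^\alpha\overline{w}^\beta$ with Hermitian coefficient matrix $(c_{\alpha\beta})$, identified with the real-valued function $p(z,\overline z)$. Its signature pair is $\mathbf{s}(p)=(A,B)$ if the coefficient matrix has $A$ positive and $B$ negative eigenvalues. It is bihomogeneous of degree $(m,m)$ if it is homogeneous of degree $m$ in $z$ and of degree $m$ in $\overline{z}$. All polynomials considered are bihomogeneous, and $\mathcal{H}(2;A,B)\cap I(r)$ denotes the set of Hermitian symmetric bihomogeneous polynomials (of any degree) in $(z_1,z_2,z_3)\in\mathbf{C}^3$ and conjugates that are divisible by $r$ and have signature pair $(A,B)$. Two Hermitian symmetric polynomials $p,q$ are equivalent, $p\sim q$, if $|u(z)|^2p(z,\overline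 z)=|v(z)|^2q(z,\overline z)$ for some nonzero holomorphic polynomials $u,v$. The projective degree $\mathcal{D}(p)$ of a bihomogeneous $p$ is the smallest $m$ such that there is a bihomogeneous polynomial of degree $(m,m)$ equivalent to $p$. For a non-empty set $S$ of such polynomials, $\mathcal{D}^*(S)=\sup_{p\in S}\mathcal{D}(p)$. In particular, an assertion about the value or finiteness of $\mathcal{D}^*(J)$ includes that $J$ is non-empty. *)

(* Defs.v *)
From mathcomp Require Import all_boot all_order all_algebra.
From mathcomp Require Import complex mpoly.
From mathcomp Require Import boolp classical_sets reals constructive_ereal ereal.

Set Implicit Arguments.
Unset Strict Implicit.
Unset Printing Implicit Defensive.

Import Order.TTheory GRing.Theory Num.Theory.
Local Open Scope ring_scope.
Local Open Scope classical_set_scope.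

(* The complex field is R[i] for R a realType.  A polynomial p(z, wbar) on C^n
   is an element of {mpoly R[i][n + n]}: the first n indeterminates are the
   z_i, the last n are the wbar_i, independent of the z_i. *)

Definition zvar (R : realType) (n : nat) (i : 'I_n) : {mpoly R[i][n + n]} :=
  'X_(lshift n i).

Definition wvar (R : realType) (n : nat) (i : 'I_n) : {mpoly R[i][n + n]} :=
  'X_(rshift n i).

(* The exponent of z^alpha wbar^beta. *)
Definition mjoin (n : nat) (alpha beta : 'X_{1..n}) : 'X_{1..(n + n)} :=
  [multinom match split i with inl j => alpha j | inr j => beta j end
     | i < n + n].

Definition hcoef (R : realType) (n : nat) (p : {mpoly R[i][n + n]})
    (alpha beta : 'X_{1..n}) : R[i] := p@_(mjoin alpha beta).

Definition herm_sym (R : realType) (n : nat) (p : {mpoly R[i][n + n]}) : Prop :=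
  forall alpha beta, hcoef p alpha beta = (hcoef p beta alpha)^*.

Definition bihomog (R : realType) (n m : nat) (p : {mpoly R[i][n + n]}) : Prop :=
  forall alpha beta, hcoef p alpha beta != 0 -> mdeg alpha = m /\ mdeg beta = m.

(* The function z |-> p(z, zbar). *)
Definition heval (R : realType) (n : nat) (p : {mpoly R[i][n + n]})
    (z : 'I_n -> R[i]) : R[i] :=
  p.@[fun i => match split i with inl j => z j | inr j => (z j)^* end].

(* Rows and columns range over the exponents of total degree < msize p; all
   nonzero coefficients are among these entries, and the superfluous zero rows
   and columns only contribute zero eigenvalues. *)
Definition coef_mx (R : realType) (n : nat) (p : {mpoly R[i][n + n]}) :
    'M[R[i]]_#|{: 'X_{1..n < msize p}}| :=
  \matrix_(i, j) hcoef p (bmnm (enum_val i)) (bmnm (enum_val j)).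

(* With algebraic multiplicity. *)
Definition eigenvalues (R : realType) (k : nat) (M : 'M[R[i]]_k) : seq R[i] :=
  sval (closed_field_poly_normal (char_poly M)).

(* On R[i], 0 < x means that x is real and positive. *)
Definition signature_pair (R : realType) (n : nat) (p : {mpoly R[i][n + n]}) :
    nat * nat :=
  (count (fun x => 0 < x) (eigenvalues (coef_mx p)),
   count (fun x => x < 0) (eigenvalues (coef_mx p))).

(* H(n; A, B) lives on C^(n+1). *)
Definition Hset (R : realType) (n A B : nat) :
    set {mpoly R[i][n.+1 + n.+1]} :=
  [set p | [/\ herm_sym p, exists m, bihomog m p & signature_pair p = (A, B)]].

Arguments Hset : clear implicits.

Definition Iset (R : realType) (n : nat) (r : {mpoly R[i][n + n]}) :
    set {mpoly R[i][n + n]} :=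
  [set p | exists h, p = r * h].

Definition hequiv (R : realType) (n : nat) (p q : {mpoly R[i][n + n]}) : Prop :=
  exists u v : {mpoly R[i][n]}, [/\ u != 0, v != 0 &
    forall z : 'I_n -> R[i],
      `|u.@[z]| ^+ 2 * heval p z = `|v.@[z]| ^+ 2 * heval q z].

Definition has_bidegree_repr (R : realType) (n : nat)
    (p : {mpoly R[i][n + n]}) : set nat :=
  [set m | exists q, [/\ herm_sym q, bihomog m q & hequiv p q]].

(* The default value 0 is only taken when p is equivalent to no bihomogeneous
   polynomial. *)
Definition proj_degree (R : realType) (n : nat) (p : {mpoly R[i][n + n]}) : nat :=
  xget 0%N [set m | has_bidegree_repr p m /\
                    forall k, has_bidegree_repr p k -> (m <= k)%N].

Definition proj_degree_sup (R : realType) (n : nat)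
    (S : set {mpoly R[i][n + n]}) : \bar R :=
  ereal_sup [set ((proj_degree p)%:R)%:E | p in S].

Definition sphere_form (R : realType) : {mpoly R[i][3 + 3]} :=
  zvar R (0 : 'I_3) * wvar R (0 : 'I_3) + zvar R (1 : 'I_3) * wvar R (1 : 'I_3)
  - zvar R (2 : 'I_3) * wvar R (2 : 'I_3).

(* Main.v *)
(* Diagonalizing the coefficient matrix writes a member of J as p = sum_a e_a |F_a|^2
   with e_a = 1 or -1 and N = A + B independent forms F_a of the same degree.
   Polarizing, sum_a e_a F_a(z) conj(F_a(w)) = 0 whenever z and conj(w) are incident,
   that is, when the polarization of r vanishes at them.

   Upper bound: for a generic z on a pencil of lines, the jets of order at most N - 2
   of the incidence relation along the line of all w incident to z are linear
   equations which determine F(z) up to a factor.  Cramer's rule then gives a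
   proportional vector C of forms of degree at most 0 + 1 + ... + (N - 2) =
   binomial(N - 1, 2), so p is equivalent to sum_a e_a |C_a|^2.  The rank of the
   equations is controlled on the sphere r = 0, where the span of F along the tangent
   line meets its orthogonal in an isotropic space; this is small enough when the
   form has a single sign of one kind or N <= 4.

   Lower bound: |u|^2 p = |v|^2 q with p(z, e_i) = c z_i^m and p(e_j, e_j) <> 0 forces
   the degree of q to be at least m, since z_i^m divides a form coming from q.  This
   applies to x^3 + y^3 + 3xyz - z^3, to a form of signature (2,2) built on
   a^3 + b^3 + c^3 - 3abc, and to r times sums of x^(m-i) z^i and y^(m-j) z^j, with
   x, y, z the squared moduli of the variables; the last ones have bounded signature
   and unbounded degree. *)

From HB Require Import structures.
Require Import Defs.
From mathcomp Require Import all_boot all_order all_algebra.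
From mathcomp Require Import perm ring zify.
From mathcomp Require Import complex mpoly.
From mathcomp Require Import boolp classical_sets reals constructive_ereal ereal.

Set Implicit Arguments.
Unset Strict Implicit.
Unset Printing Implicit Defensive.

Import Order.TTheory GRing.Theory Num.Theory.
Local Open Scope ring_scope.

(** * Functions that are polynomial along every line *)

(** The jets at [z] are taken at [(- b, 1, s)], the point dual to the line of the pencil through
    [z]: it stays fixed while [z] moves along that line, and the jet of order [j] has degree at most
    [j] in the position [t] of [z]. The unknown [F(z)] is sought only in the span of [F] along the
    line, of dimension [k + 1], so that [k] independent equations suffice even when the jets do not
    span a hyperplane. Cramer's rule bounds the degree in [t] alone; the dependence on [s], which
    comes from a basis of that span, is not controlled. It is removed by Gauss's lemma, which gives
    [F = g C] with [C] polynomial in [s] and [t]; the degrees of [F], [g] and [C] on lines through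
    the origin of the [(s, t)] plane then bound the total degree of [C]. The choices of [b], [s],
    [t] are generic, and each open condition is checked at a single point. On the sphere the dual
    line is the conjugate of the line, which is why an orthogonal space enters there. In the lower
    bound, [u] may vanish at [e_i]; its lowest nonzero Taylor coefficient along a line of conjugate
    variables replaces its value. *)

Definition lpoly (K : fieldType) (V : lmodType K) (f : V -> K) :=
  forall X Y, exists P : {poly K}, forall c, f (X + c *: Y) = P.[c].

Section LinePolynomial.
Variables (K : numFieldType) (V : lmodType K).
Implicit Types (f g : V -> K) (p q : V -> {poly K}).

Lemma eq_lpoly f g : f =1 g -> lpoly f -> lpoly g.
Proof. by move=> fg lf X Y; have [P HP] := lf X Y; exists P => c; rewrite -fg. Qed.

Lemma lpolyC (a : K) : lpoly (fun _ : V => a).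
Proof. by move=> X Y; exists a%:P => c; rewrite hornerC. Qed.

Lemma lpolyD f g : lpoly f -> lpoly g -> lpoly (fun X => f X + g X).
Proof.
move=> lf lg X Y; have [P HP] := lf X Y; have [Q HQ] := lg X Y.
by exists (P + Q) => c; rewrite HP HQ hornerD.
Qed.

Lemma lpolyM f g : lpoly f -> lpoly g -> lpoly (fun X => f X * g X).
Proof.
move=> lf lg X Y; have [P HP] := lf X Y; have [Q HQ] := lg X Y.
by exists (P * Q) => c; rewrite HP HQ hornerM.
Qed.

Lemma lpolyN f : lpoly f -> lpoly (fun X => - f X).
Proof.
move=> lf; apply: eq_lpoly (lpolyM (lpolyC (-1)) lf) => X.
by rewrite mulN1r.
Qed.

Lemma lpoly_sum (I : Type) (r : seq I) (P : pred I) (F : I -> V -> K) :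
  (forall i, lpoly (F i)) -> lpoly (fun X => \sum_(i <- r | P i) F i X).
Proof.
move=> lF; elim: r => [|i r IH].
  by apply: eq_lpoly (lpolyC 0) => X; rewrite big_nil.
case Pi: (P i).
  by apply: eq_lpoly (lpolyD (lF i) IH) => X; rewrite big_cons Pi.
by apply: eq_lpoly IH => X; rewrite big_cons Pi.
Qed.

Lemma lpoly_prod (I : Type) (r : seq I) (P : pred I) (F : I -> V -> K) :
  (forall i, lpoly (F i)) -> lpoly (fun X => \prod_(i <- r | P i) F i X).
Proof.
move=> lF; elim: r => [|i r IH].
  by apply: eq_lpoly (lpolyC 1) => X; rewrite big_nil.
case Pi: (P i).
  by apply: eq_lpoly (lpolyM (lF i) IH) => X; rewrite big_cons Pi.
by apply: eq_lpoly IH => X; rewrite big_cons Pi.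
Qed.

Lemma lpoly_det n (M : V -> 'M[K]_n) :
  (forall i j, lpoly (fun X => M X i j)) -> lpoly (fun X => \det (M X)).
Proof.
move=> lM; rewrite /determinant; apply: lpoly_sum => s.
by apply: lpolyM; [apply: lpolyC | apply: lpoly_prod => i; apply: lM].
Qed.

Lemma poly_neq0_horner (P : {poly K}) : P != 0 -> exists c, P.[c] != 0.
Proof.
move=> P0; have: ~~ all (root P) [seq i%:R | i <- iota 0 (size P)].
  apply/negP => r0; suff: uniq ([seq i%:R | i <- iota 0 (size P)] : seq K).
    by move/(max_poly_roots P0 r0); rewrite size_map size_iota ltnn.
  by rewrite map_inj_uniq ?iota_uniq // => i j /eqP; rewrite eqr_nat => /eqP.
by case/allPn => x _; exists x.
Qed.

Lemma poly_horner_eq (P Q : {poly K}) : (forall c, P.[c] = Q.[c]) -> P = Q.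
Proof.
move=> PQ; apply/eqP; rewrite -subr_eq0; apply/negPn/negP.
by case/poly_neq0_horner => c; rewrite hornerD hornerN PQ subrr eqxx.
Qed.

(** On the line joining [X] and [Y] both functions are nonzero polynomials of the parameter, and
    their product has a non-root. Polynomiality along lines is thus all that the genericity
    arguments need, and it passes to determinants without any multivariate polynomial in the
    parameters. *)
Lemma lpoly_neq0_common f g X Y : lpoly f -> lpoly g ->
  f X != 0 -> g Y != 0 -> exists Z, f Z != 0 /\ g Z != 0.
Proof.
move=> lf lg fX gY; have [P HP] := lf X (Y - X); have [Q HQ] := lg X (Y - X).
have P0: P != 0.
  by apply: contraNneq fX => P0; have := HP 0; rewrite scale0r addr0 P0 horner0 => ->.
have Q0: Q != 0.
  apply: contraNneq gY => Q0; have := HQ 1.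
  by rewrite scale1r addrC subrK Q0 horner0 => ->.
have [c] := poly_neq0_horner (mulf_neq0 P0 Q0).
by rewrite hornerM mulf_eq0 -HP -HQ => /norP[]; exists (X + c *: (Y - X)).
Qed.

Definition clpoly p := forall j, lpoly (fun X => (p X)`_j).

Lemma clpolyP (P : {poly K}) : clpoly (fun _ => P).
Proof. by move=> j; apply: lpolyC. Qed.

Lemma clpolyC f : lpoly f -> clpoly (fun X => (f X)%:P).
Proof.
move=> lf [|j]; first by apply: eq_lpoly lf => X; rewrite coefC.
by apply: eq_lpoly (lpolyC 0) => X; rewrite coefC.
Qed.

Lemma clpolyD p q : clpoly p -> clpoly q -> clpoly (fun X => p X + q X).
Proof.
move=> lp lq j.
by apply: eq_lpoly (lpolyD (lp j) (lq j)) => X; rewrite coefD.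
Qed.

Lemma clpolyM p q : clpoly p -> clpoly q -> clpoly (fun X => p X * q X).
Proof.
move=> lp lq j.
have L: lpoly (fun X => \sum_(i < j.+1) (p X)`_i * (q X)`_(j - i)).
  by apply: lpoly_sum => i; apply: lpolyM.
by apply: eq_lpoly L => X; rewrite coefM.
Qed.

Lemma clpoly_sum (I : Type) (r : seq I) (P : pred I) (F : I -> V -> {poly K}) :
  (forall i, clpoly (F i)) -> clpoly (fun X => \sum_(i <- r | P i) F i X).
Proof.
move=> lF j.
apply: eq_lpoly (lpoly_sum r P (fun i => lF i j)) => X.
by rewrite coef_sum.
Qed.

Lemma eq_clpoly p q : p =1 q -> clpoly p -> clpoly q.
Proof. by move=> pq lp j; apply: eq_lpoly (lp j) => X; rewrite pq. Qed.

Lemma clpoly_exp p n : clpoly p -> clpoly (fun X => p X ^+ n).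
Proof.
move=> lp; elim: n => [|n IH]; first exact: clpolyP.
by apply: eq_clpoly (clpolyM lp IH) => X; rewrite exprS.
Qed.

Lemma clpoly_prod (I : Type) (r : seq I) (P : pred I) (F : I -> V -> {poly K}) :
  (forall i, clpoly (F i)) -> clpoly (fun X => \prod_(i <- r | P i) F i X).
Proof.
move=> lF; elim: r => [|i r IH].
  by apply: eq_clpoly (clpolyP 1) => X; rewrite big_nil.
case Pi: (P i).
  by apply: eq_clpoly (clpolyM (lF i) IH) => X; rewrite big_cons Pi.
by apply: eq_clpoly IH => X; rewrite big_cons Pi.
Qed.

Lemma clpoly_mmap n (F : {mpoly K[n]}) (h : V -> 'I_n -> {poly K}) :
  (forall i, clpoly (fun X => h X i)) -> clpoly (fun X => mmap (@polyC K) (h X) F).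
Proof.
move=> lh; rewrite /mmap; apply: clpoly_sum => m; apply: clpolyM.
  exact: clpolyP.
by rewrite /mmap1; apply: clpoly_prod => i; apply: clpoly_exp.
Qed.

Lemma mxrank_mxsub a b a1 b1 (f : 'I_a1 -> 'I_a) (g : 'I_b1 -> 'I_b)
  (A : 'M[K]_(a, b)) : (\rank (mxsub f g A) <= \rank A)%N.
Proof.
have -> : mxsub f g A = (rowsub g (rowsub f A)^T)^T.
  by apply/matrixP=> i j; rewrite !mxE.
rewrite mxrank_tr (leq_trans (mxrankS (rowsub_sub _ _))) // mxrank_tr.
exact: mxrankS (rowsub_sub _ _).
Qed.

Lemma mxrank_minor a b (A : 'M[K]_(a, b)) :
  exists h1 h2, \det (mxsub h1 h2 A : 'M_(\rank A)) != 0.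
Proof.
set B := rowsub (maxrankfun A) A.
have rBT: row_full B^T by rewrite /row_full mxrank_tr (eq_maxrowsub A).
exists (maxrankfun A), (fullrankfun rBT).
rewrite -det_tr -unitfE; have := fullrowsub_unit rBT; rewrite unitmxE.
by congr (\det _ \is a GRing.unit); apply/matrixP => i j; rewrite !mxE.
Qed.

(** A lower bound on the rank at one point is witnessed by a minor, and it persists wherever this
    fixed minor [d] does not vanish. *)
Lemma lpoly_mxrank a b (A : V -> 'M[K]_(a, b)) X r :
  (forall i j, lpoly (fun X => A X i j)) -> (r <= \rank (A X))%N ->
  exists d, [/\ lpoly d, d X != 0 & forall Y, d Y != 0 -> (r <= \rank (A Y))%N].
Proof.
move=> lA lerA; have [f [g D0]] := mxrank_minor (A X).
exists (fun Y => \det (mxsub f g (A Y))); split => // [|Y DY].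
  by apply: lpoly_det => i j; apply: eq_lpoly (lA (f i) (g j)) => Y; rewrite mxE.
apply: leq_trans lerA _; apply: leq_trans (mxrank_mxsub f g (A Y)).
suff /eqP -> : row_full (mxsub f g (A Y)) by [].
by rewrite row_full_unit unitmxE unitfE.
Qed.

End LinePolynomial.

(** * Generic jets of a polynomial curve *)

Section Jets.
Variable K : numFieldType.
Implicit Types u v p : {poly K}.

(** In characteristic 0 derivation lowers a positive order of vanishing by exactly one. After
    subtraction of a multiple of [v], the difference [w] vanishes at a point [x] with [v.[x] != 0],
    and the Wronskian relation would make its derivative vanish there to at least the same order;
    hence [w = 0]. *)
Lemma wronskian_eq0 u v : v != 0 -> u^`() * v = u * v^`() ->
  exists c, u = c *: v.
Proof.
move=> v0 Wuv; have [x vx] := poly_neq0_horner v0.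
exists (u.[x] / v.[x]); apply/eqP; rewrite -subr_eq0; set w := u - _.
have Ww: w^`() * v = w * v^`().
  by rewrite /w derivB derivZ !mulrBl Wuv -!scalerAl [v^`() * v]mulrC.
have wx: root w x by rewrite rootE !hornerE divfK ?subrr.
apply/negPn/negP => w0.
have [m [w1 w1x Ew]] := multiplicity_XsubC w x.
move: w1x; rewrite w0 /= => w1x; case: m Ew => [|m] Ew.
  by move: wx; rewrite Ew expr0 mulr1 (negPf w1x).
have: ('X - x%:P) ^+ m.+1 %| w^`().
  have cop: coprimep (('X - x%:P) ^+ m.+1) v.
    by rewrite coprimep_expl // coprimep_sym coprimep_XsubC rootE.
  by rewrite -(Gauss_dvdpl _ cop) Ww Ew mulrAC dvdp_mull.
rewrite Ew derivM dvdp_addr; last exact: dvdp_mull.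
rewrite deriv_exp derivXsubC mul1r /= -mulr_natr exprSr mulrCA.
rewrite dvdp_mul2l ?expf_neq0 ?polyXsubC_eq0 //.
rewrite dvdp_XsubCl rootE hornerM -polyC_natr hornerC mulf_eq0 pnatr_eq0 orbF.
by rewrite -rootE (negPf w1x).
Qed.

Lemma dvdp_XsubC_exp_deriv (x : K) n p :
  ('X - x%:P) ^+ n.+1 %| p -> ('X - x%:P) ^+ n %| p^`().
Proof.
case/dvdpP => q ->; rewrite derivM deriv_exp derivXsubC mul1r /=.
apply: dvdp_add; first by rewrite exprS mulrA dvdp_mull.
by rewrite -mulr_natl mulrA dvdp_mull.
Qed.

(* The Wronskians with a fixed member of the family have the same generic
   vanishing behaviour one order lower, and (u / v)' = 0 forces u to be a
   multiple of v. *)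
Lemma generic_jets k (u : 'I_k -> {poly K}) :
  (forall c : 'I_k -> K, \sum_i c i *: u i = 0 -> forall i, c i = 0) ->
  exists2 d : {poly K}, d != 0 & forall x, d.[x] != 0 -> forall c : 'I_k -> K,
    ('X - x%:P) ^+ k %| \sum_i c i *: u i -> forall i, c i = 0.
Proof.
elim: k u => [|k IH] u uf; first by exists 1; [exact: oner_neq0 | move=> x _ c _ []].
set v := u ord0; pose W i := (u (lift ord0 i))^`() * v - u (lift ord0 i) * v^`().
pose e0 (a : K) (c : 'I_k -> K) := fun i => oapp c a (unlift ord0 i).
have sumE a c : \sum_i e0 a c i *: u i = a *: v + \sum_i c i *: u (lift ord0 i).
  rewrite big_ord_recl /e0 unlift_none /=; congr (_ + _).
  by apply: eq_bigr => i _; rewrite liftK.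
have v0: v != 0.
  apply/eqP => v0; have := uf (e0 1 (fun _ => 0)).
  rewrite sumE v0 scaler0 add0r big1 => [|i _]; last by rewrite scale0r.
  by move=> /(_ erefl ord0)/eqP; rewrite /e0 unlift_none /= oner_eq0.
have WE c (w := \sum_i c i *: u (lift ord0 i)) :
    \sum_i c i *: W i = w^`() * v - w * v^`().
  rewrite /w (linear_sum (@deriv K)) /= !mulr_suml -sumrB; apply: eq_bigr => i _.
  by rewrite derivZ scalerBr !scalerAl.
have [c W0|d d0 dP] := IH W.
  have [|a wE] := @wronskian_eq0 (\sum_i c i *: u (lift ord0 i)) v v0.
    by apply/eqP; rewrite -subr_eq0 -WE W0.
  move=> i; have := uf (e0 (- a) c); rewrite sumE wE scaleNr addNr.
  by move=> /(_ erefl (lift ord0 i)); rewrite /e0 liftK.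
(* The factor [v] allows the coefficient of [v] itself to be recovered from the value at [x]. *)
exists (d * v); first exact: mulf_neq0.
move=> x; rewrite hornerM mulf_eq0 => /norP[dx vx] c.
set w := \sum_i _ => dw.
have wx: w.[x] = 0.
  by apply/rootP; rewrite -dvdp_XsubCl; apply: dvdp_trans dw; rewrite exprS dvdp_mulr.
have Ew: w = c ord0 *: v + \sum_i c (lift ord0 i) *: u (lift ord0 i).
  by rewrite /w big_ord_recl.
have c0: forall i, c (lift ord0 i) = 0.
  apply: (dP x dx); rewrite WE.
  have -> : \sum_i c (lift ord0 i) *: u (lift ord0 i) = w - c ord0 *: v.
    by rewrite Ew addrC addKr.
  rewrite derivB derivZ !mulrBl opprB -!scalerAl [v * _]mulrC addrA subrK.
  apply: dvdp_sub; apply: dvdp_mulr; first exact: dvdp_XsubC_exp_deriv.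
  by apply: dvdp_trans dw; rewrite exprS dvdp_mull.
move: wx; rewrite Ew big1 => [|i _]; last by rewrite c0 scale0r.
rewrite addr0 hornerZ => /eqP; rewrite mulf_eq0 (negPf vx) orbF => /eqP cz i.
by case: (unliftP ord0 i) => [j|] ->.
Qed.

End Jets.

(** * Clearing denominators in a one-parameter family of lines *)

Section Gauss.
Variables (K : closedFieldType) (n : nat).
Implicit Types (F C : 'I_n -> {poly {poly K}}) (P g : {poly {poly K}}) (c : {poly K}).

Definition proportional (A : ringType) (F C : 'I_n -> A) :=
  forall a b, F a * C b = F b * C a.

(** Euclid's algorithm on vectors: subtracting from [c *: F] the multiple of [C] given by
    pseudo-division in a component [j] of largest size leaves a vector still proportional to [F] and
    smaller in every component. When it vanishes, [C] divides [c *: F]. *)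
Lemma parallel_pseudo_dvd d F C : proportional F C ->
  (exists a, C a != 0) -> (forall a, size (C a) <= d)%N ->
  exists c g C', [/\ c != 0, forall a, c *: F a = g * C' a &
    forall a, (size (C' a) <= d)%N].
Proof.
elim: d C => [|d IH] C FC [a0 Ca0] sC.
  by move: (sC a0); rewrite leqn0 size_poly_eq0 (negPf Ca0).
have [j _ jmax] := @arg_maxnP _ a0 xpredT (fun a => size (C a)) isT.
have Cj: C j != 0.
  by rewrite -size_poly_gt0 (leq_trans _ (jmax a0 isT)) // size_poly_gt0.
pose c := lead_coef (C j) ^+ scalp (F j) (C j); pose q := F j %/ C j.
have c0: c != 0 by rewrite expf_neq0 // lead_coef_eq0.
pose R a := c *: F a - q * C a.
have RjE: R j = F j %% C j.
  by rewrite /R Pdiv.Idomain.divp_eq // addrC addKr.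
have RC a b: R a * C b = R b * C a.
  by rewrite /R !mulrBl -!scalerAl FC; congr (_ - _); ring.
have FR: proportional F R.
  move=> a b; rewrite /R !mulrBr -!scalerAr [F b * F a]mulrC; congr (_ - _).
  by rewrite mulrCA FC mulrCA.
have sR a: (size (R a) <= d)%N.
  have: (size (R j) < size (C j))%N by rewrite RjE ltn_modpN0.
  move=> sRj; rewrite -ltnS; apply: leq_trans (sC j).
  have [->|Ra] := eqVneq (R a) 0; first by rewrite size_poly0 size_poly_gt0.
  have := RC a j; have [->|Rj E] := eqVneq (R j) 0.
    by rewrite mul0r => /eqP; rewrite mulf_eq0 (negPf Ra) (negPf Cj).
  have Ca: C a != 0.
    by apply: contraNneq Ra => Ca; move/eqP: E; rewrite Ca mulr0 mulf_eq0 (negPf Cj) orbF.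
  have := congr1 (fun p : {poly {poly K}} => (size p).+1) E.
  rewrite !size_mul // !prednK ?addn_gt0 ?size_poly_gt0 ?Ra ?Rj // => sE.
  have /= := jmax a isT; rewrite -(leq_add2l (size (R j))) -sE leq_add2r => H.
  exact: leq_ltn_trans H sRj.
have [/existsP Rn0|R0] := boolP [exists a, R a != 0].
  have [c1 [g [C' [H1 H2 H3]]]] := IH R FR Rn0 sR.
  by exists c1, g, C'; split=> // a; rewrite (leq_trans (H3 a)).
exists c, q, C; split=> // a; apply/eqP; rewrite -subr_eq0.
by move: R0; rewrite negb_exists => /forallP/(_ a); rewrite negbK.
Qed.

(** The quotient is returned in [Type], so that it can be selected for all components of a
    vector. *)
Lemma map_horner_eq0 P (x : K) : map_poly (horner_eval x) P = 0 ->
  {P' : {poly {poly K}} | P = ('X - x%:P) *: P' & (size P' <= size P)%N}.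
Proof.
move=> Px; exists (map_poly (fun p : {poly K} => p %/ ('X - x%:P)) P).
  apply/polyP => i; rewrite coefZ coef_map_id0 ?div0p //.
  rewrite mulrC divpK // dvdp_XsubCl; apply/rootP.
  by have := congr1 (fun p : {poly K} => p`_i) Px; rewrite coef_map coef0.
exact: size_poly.
Qed.

(** Gauss's lemma, one root [x] of the denominator [c] at a time: modulo ['X - x%:P] the product
    [g * C' a] vanishes for all [a], so that [g] or every [C' a] is divisible, and a linear factor
    of [c] cancels. *)
Lemma parallel_dvd d F C : proportional F C ->
  (exists a, C a != 0) -> (forall a, size (C a) <= d)%N ->
  exists g C', (forall a, F a = g * C' a) /\ (forall a, (size (C' a) <= d)%N).
Proof.
move=> FC C0 /(parallel_pseudo_dvd FC C0)[c [g [C' [c0 E sC]]]].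
have [k sc] := ubnP (size c); elim: k => // k IH in c g C' c0 E sC sc *.
have [sc1|sc1] := eqVneq (size c) 1%N.
  have /size_poly1P[u u0 cE] : size c == 1%N by rewrite sc1.
  exists (u^-1%:P *: g), C'; split=> // a.
  by rewrite -scalerAl -E cE scalerA -polyCM mulVf // scale1r.
have /closed_rootP[x cx] := sc1.
have /factor_theorem[c1 cE] := cx.
have c10: c1 != 0 by apply: contraNneq c0 => c10; rewrite cE c10 mul0r.
have sc1k: (size c1 < k)%N.
  by move: sc; rewrite cE size_Mmonic ?monicXsubC // size_XsubC addn2.
have gC a: map_poly (horner_eval x) g * map_poly (horner_eval x) (C' a) = 0.
  rewrite -rmorphM /= -E; apply/polyP => i; rewrite coef_map coefZ coef0 /=.
  by rewrite /horner_eval hornerM (rootP cx) mul0r.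
have X0: 'X - x%:P != 0 by rewrite polyXsubC_eq0.
have scI (P Q : {poly {poly K}}) : ('X - x%:P) *: P = ('X - x%:P) *: Q -> P = Q.
  by rewrite -!mul_polyC; apply: mulfI; rewrite polyC_eq0.
have [gx|gx] := eqVneq (map_poly (horner_eval x) g) 0.
  have [g' gE sg] := map_horner_eq0 gx.
  apply: (IH c1 g' C') => // a; apply: scI.
  by rewrite scalerA [_ * c1]mulrC -cE E gE scalerAl.
have Cx a : map_poly (horner_eval x) (C' a) = 0.
  by move/eqP: (gC a); rewrite mulf_eq0 (negPf gx) => /eqP.
pose C2 a := s2val (map_horner_eq0 (Cx a)).
have C2E a : C' a = ('X - x%:P) *: C2 a := s2valP (map_horner_eq0 (Cx a)).
have sC2 a : (size (C2 a) <= size (C' a))%N := s2valP' (map_horner_eq0 (Cx a)).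
apply: (IH c1 g C2) => // a; last exact: leq_trans (sC2 a) (sC a).
by apply: scI; rewrite scalerA [_ * c1]mulrC -cE E C2E scalerAr.
Qed.

End Gauss.

(** * Total degree of a factor, read on lines through the origin *)

Section RadialDegree.
Variable K : numFieldType.
Implicit Types (P g : {poly {poly K}}).

(** The restriction of [P] to the line [s = c t], where [t] is the outer and [s] the inner
    variable. *)
Definition radial (c : K) P : {poly K} := (map_poly (comp_poly (c *: 'X)) P).['X].

(** The homogeneous part of total degree [e], at [t = 1]. Its value at [c] is the coefficient of
    degree [e] on the line [s = c t]. *)
Definition hom_part (e : nat) P : {poly K} :=
  \sum_(i < e.+1) P`_i`_(e - i) *: 'X^(e - i).

Lemma radialM c : {morph radial c : P Q / P * Q}.
Proof. by move=> P Q; rewrite /radial rmorphM hornerM. Qed.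

Lemma coef_radial c P e : (radial c P)`_e = (hom_part e P).[c].
Proof.
have cX (p : {poly K}) : p \Po (c *: 'X) = \poly_(i < size p) (p`_i * c ^+ i).
  rewrite comp_polyE poly_def; apply: eq_bigr => i _.
  by rewrite exprZn scalerA.
have ccX (p : {poly K}) j : (p \Po (c *: 'X))`_j = p`_j * c ^+ j.
  rewrite cX coef_poly; case: ltnP => // sp.
  by rewrite nth_default // mul0r.
have sN : (size (map_poly (comp_poly (c *: 'X)) P) <= maxn (size P) e.+1)%N.
  by rewrite (leq_trans (size_poly _ _)) ?leq_maxl.
rewrite /radial /hom_part (horner_coef_wide _ sN) coef_sum horner_sum.
rewrite (big_ord_widen _ (fun i => (P`_i`_(e - i) *: 'X^(e - i)).[c]) (leq_maxr (size P) e.+1)).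
rewrite [RHS]big_mkcond; apply: eq_bigr => i _ /=.
rewrite coefMXn coef_map /= ccX ltnS ltnNge.
by case: leqP => //= _; rewrite hornerZ hornerXn.
Qed.

Lemma hom_part_coef P i j : (hom_part (i + j) P)`_j = P`_i`_j.
Proof.
rewrite /hom_part coef_sum (bigD1 (Ordinal (leq_addr j i : (i < (i + j).+1)%N))) //=.
rewrite addKn coefZ coefXn eqxx mulr1 big1 ?addr0 // => k ki.
rewrite coefZ coefXn; case: eqP => [E|]; last by rewrite mulr0.
case/eqP: ki; apply: val_inj => /=.
have := ltn_ord k; rewrite ltnS => kle.
by rewrite -(subKn kle) -E addnK.
Qed.

Lemma size_radial0 P : (size (radial 0 P) <= size P)%N.
Proof.
apply/leq_sizeP => e Pe; rewrite coef_radial /hom_part horner_sum big1 // => i _.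
rewrite hornerZ hornerXn expr0n subn_eq0.
have := ltn_ord i; rewrite ltnS leq_eqVlt => /predU1P[ie|ie].
  by rewrite ie (nth_default 0 Pe) coef0 mul0r.
by rewrite leqNgt ie mulr0.
Qed.

(* Comparing degrees along all lines through the origin with the degree along
   one of them, on which [F] has full degree. *)
Lemma factor_total_degree n (F C : 'I_n -> {poly {poly K}}) g m d a1 :
  (forall a, F a = g * C a) ->
  (forall c a, size (radial c (F a)) <= m.+1)%N ->
  (radial 0 (F a1))`_m != 0 ->
  (forall a, size (C a) <= d.+1)%N ->
  forall a i j, (d < i + j)%N -> (C a)`_i`_j = 0.
Proof.
move=> FgC sF Fm sC a i j dij.
have q0: radial 0 g * radial 0 (C a1) != 0.
  by rewrite -radialM -FgC; apply: contraNneq Fm => ->; rewrite coef0.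
have [g0 C0]: radial 0 g != 0 /\ radial 0 (C a1) != 0.
  by move: q0; rewrite mulf_eq0 => /norP[].
set e := (size (radial 0 g)).-1.
have me: (m <= e + d)%N.
  have: (m < size (radial 0 (F a1)))%N.
    by rewrite ltnNge; apply: contra Fm => /leq_sizeP ->.
  rewrite FgC radialM size_mul // -(prednK (_ : 0 < size (radial 0 g))%N) ?size_poly_gt0 //.
  rewrite addSn /= => H; rewrite -ltnS -addnS; apply: leq_trans H _.
  by rewrite leq_add2l (leq_trans (size_radial0 _)).
apply/eqP/negPn/negP => Cij.
have H1: hom_part (i + j) (C a) != 0.
  by apply: contraNneq Cij => H; rewrite -hom_part_coef H coef0.
have H2: hom_part e g != 0.
  apply: contraTneq g0 => H; rewrite negbK -lead_coef_eq0 lead_coefE.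
  by rewrite coef_radial -/e H horner0.
(* On a line [s = c t] where neither part vanishes, [g] has degree at least [e] and [C a] at least
   [i + j], which exceeds [d]; their product would have degree greater than [m]. *)
have [c] := poly_neq0_horner (mulf_neq0 H1 H2).
rewrite hornerM -!coef_radial mulf_eq0 => /norP[h1 h2].
have sz (p : {poly K}) k : p`_k != 0 -> (k < size p)%N.
  by rewrite ltnNge; apply: contra => /leq_sizeP ->.
have g1: radial c g != 0 by apply: contraNneq h2 => ->; rewrite coef0.
have C1: radial c (C a) != 0 by apply: contraNneq h1 => ->; rewrite coef0.
have := sF c a; rewrite FgC radialM (size_mul g1 C1).
have := leq_add (sz _ _ h2) (sz _ _ h1).
move: (size _) (size (radial c (C a))) => x y H1' H2'.
have: (e.+1 + (i + j).+1 <= m.+2)%N.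
  by apply: leq_trans H1' _; move: H2'; case: (x + y)%N.
rewrite addSn addnS !ltnS => H3; have := leq_trans H3 me.
by rewrite leq_add2l leqNgt dij.
Qed.

End RadialDegree.

(** * Substitutions in multivariate polynomials and their degrees *)

Definition vec3 (A : Type) (x y z : A) : 'I_3 -> A :=
  fun i => match val i with 0 => x | 1 => y | _ => z end%N.

Lemma rmorph_mmap (n : nat) (R S T : comNzRingType) (phi : {rmorphism S -> T})
    (f : R -> S) (h : 'I_n -> S) (f' : R -> T) (h' : 'I_n -> T) p :
  (forall c, phi (f c) = f' c) -> (forall i, phi (h i) = h' i) ->
  phi (mmap f h p) = mmap f' h' p.
Proof.
move=> ff hh; rewrite /mmap rmorph_sum; apply: eq_bigr => m _.
rewrite rmorphM ff /mmap1 rmorph_prod; congr (_ * _).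
by apply: eq_bigr => i _; rewrite rmorphXn hh.
Qed.

Lemma size_mmap (n : nat) (R S : comNzRingType) (f : R -> {poly S})
    (h : 'I_n -> {poly S}) d p : p \is d.-homog ->
  (forall c, size (f c) <= 1)%N -> (forall i, size (h i) <= 2)%N ->
  (size (mmap f h p) <= d.+1)%N.
Proof.
move=> /dhomogP ph sf sh; rewrite /mmap big_seq.
have sX (q : {poly S}) k : (size q <= 2)%N -> (size (q ^+ k) <= k.+1)%N.
  move=> sq; apply: leq_trans (size_poly_exp_leq _ _) _; rewrite ltnS.
  by rewrite -{2}[k]mul1n leq_mul2r; case: (size q) sq => [|[|[]]] //= _; rewrite orbT.
apply: leq_trans (size_sum _ _ _) _; apply/bigmax_leqP_seq => m _ mp.
have sm: (size (mmap1 h m) <= d.+1)%N.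
  have /= <- := ph m mp; rewrite mdegE /mmap1.
  elim/big_rec2: _ => [|i k q _ IH]; first by rewrite size_poly1.
  apply: leq_trans (size_polyMleq _ _) _.
  have := leq_add (sX _ (m i) (sh i)) IH.
  by rewrite addSn addnS; case: (_ + _)%N.
apply: leq_trans (size_polyMleq _ _) _.
have := leq_add (sf p@_m) sm.
by rewrite add1n; case: (_ + _)%N.
Qed.

(** * Solving the incidence equations by Cramer's rule *)

(** Expansion along row [ord0] weights the entries [A i a] by the maximal minors of [Q], up to sign:
    this is the vector that Cramer's rule finds in the left kernel of [Q], multiplied by [A]. *)
Definition bordered (R : nzRingType) k n (A : 'M[R]_(k.+1, n)) (Q : 'M[R]_(k.+1, k))
    (a : 'I_n) : 'M[R]_k.+1 :=
  \matrix_(r, i) (if unlift ord0 r is Some j then Q i j else A i a).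

Section Cramer.
Variable K : fieldType.

(** The vector [phi] is orthogonal to every row of [M], whose row [ord0] mixes the columns [a] and
    [b] of [A] so as to cancel on [phi]. Hence [\det M = 0], and linearity of the determinant in
    that row gives the identity. *)
Lemma bordered_parallel k n (A : 'M[K]_(k.+1, n)) (Q : 'M_(k.+1, k)) (phi : 'rV_k.+1) a b :
  phi *m Q = 0 ->
  (phi *m A) 0 a * \det (bordered A Q b) = (phi *m A) 0 b * \det (bordered A Q a).
Proof.
move=> phiQ; have [->|phi0] := eqVneq phi 0; first by rewrite mul0mx !mxE !mul0r.
set fa := (phi *m A) 0 a; set fb := (phi *m A) 0 b.
pose M := \matrix_(r, i) (if unlift ord0 r is Some j then Q i j
                          else fa * A i b - fb * A i a) : 'M[K]_k.+1.
have dM: \det M = fa * \det (bordered A Q b) - fb * \det (bordered A Q a).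
  rewrite -mulNr; apply: (@determinant_multilinear _ _ _ _ _ ord0).
  - by apply/rowP => i; rewrite !mxE unlift_none mulNr.
  - by apply/matrixP => i j; rewrite !mxE liftK.
  - by apply/matrixP => i j; rewrite !mxE liftK.
suff M0: \det M = 0 by apply/eqP; rewrite -subr_eq0 -dM M0.
apply/eqP; rewrite -det_tr; apply/det0P; exists phi => //.
apply/rowP => r; rewrite !mxE; case: (unliftP ord0 r) => [j|] rE.
  have := congr1 (fun u : 'rV_k => u 0 j) phiQ; rewrite !mxE => E.
  by rewrite -[RHS]E; apply: eq_bigr => i _; rewrite !mxE rE liftK.
transitivity (fa * (phi *m A) 0 b - fb * (phi *m A) 0 a).
  2: by rewrite -/fa -/fb mulrC subrr.
rewrite ![(phi *m A) 0 _]mxE !mulr_sumr -sumrB; apply: eq_bigr => i _.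
by rewrite !mxE rE unlift_none; ring.
Qed.

(** If all these determinants vanished, every column of [A] would lie in the column space of [Q], of
    dimension at most [k]. *)
Lemma bordered_neq0 k n (A : 'M[K]_(k.+1, n)) (Q : 'M_(k.+1, k)) :
  (k < \rank A)%N -> (k <= \rank Q)%N -> exists a, \det (bordered A Q a) != 0.
Proof.
move=> rA rQ; have [/existsP //|] := boolP [exists a, \det (bordered A Q a) != 0].
rewrite negb_exists => /forallP D0; exfalso.
suff: (A^T <= Q^T)%MS.
  move/mxrankS; rewrite !mxrank_tr leqNgt => /negP; apply.
  exact: leq_ltn_trans (rank_leq_col _) rA.
apply/row_subP => a; have := D0 a; rewrite negbK => /det0P[v v0 vM].
pose v' := \row_j v 0 (lift ord0 j).
have E: v 0 ord0 *: row a A^T + v' *m Q^T = 0.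
  apply/rowP => i; have := congr1 (fun u : 'rV_k.+1 => u 0 i) vM.
  rewrite !mxE big_ord_recl !mxE unlift_none => E; rewrite -[RHS]E; congr (_ + _).
  by apply: eq_bigr => j _; rewrite !mxE liftK.
have freeQ: row_free Q^T by rewrite /row_free mxrank_tr eqn_leq rank_leq_col.
have [v00|v00] := eqVneq (v 0 ord0) 0.
  move: E; rewrite v00 scale0r add0r => /eqP.
  rewrite mulmx_free_eq0 // => /eqP v'0; case/eqP: v0; apply/rowP => r.
  case: (unliftP ord0 r) => [j|] ->; rewrite ?v00 ?mxE //.
  by have := congr1 (fun u : 'rV_k => u 0 j) v'0; rewrite !mxE.
move/eqP: E; rewrite addr_eq0 => /eqP E.
rewrite -[row a A^T]scale1r -(mulVf v00) -scalerA E scalemx_sub //.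
by rewrite eqmx_opp submxMl.
Qed.

Lemma row_free_rowsub1 p r (f : 'I_r -> 'I_p) : injective f ->
  row_free (rowsub f (1%:M : 'M[K]_p)).
Proof.
move=> fi; apply/row_freeP; exists (rowsub f 1%:M)^T; apply/matrixP => i j.
rewrite !mxE (bigD1 (f i)) //= big1 ?addr0 => [|h hi].
  by rewrite !mxE eqxx mul1r eq_sym (inj_eq fi).
by rewrite !mxE eq_sym (negPf hi) mul0r.
Qed.

Lemma mxrank_rowsub p q (B : 'M[K]_(p, q)) r : (r <= \rank B)%N ->
  exists f : 'I_r -> 'I_p, injective f /\ \rank (rowsub f B) = r.
Proof.
move=> rB; pose f i := maxrankfun B (widen_ord rB i).
have fi: injective f.
  by move=> i j /maxrankfun_inj/(congr1 val)/= E; apply: val_inj.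
exists f; split=> //; set B1 := rowsub (maxrankfun B) B.
have -> : rowsub f B = rowsub (widen_ord rB) 1%:M *m B1.
  by rewrite -rowsubE; apply/matrixP => i j; rewrite !mxE.
rewrite mxrankMfree ?maxrowsub_free //; apply/eqP/row_free_rowsub1.
by move=> i j /(congr1 val) E; apply: val_inj.
Qed.

Lemma poly2_eq0 (L : numFieldType) (P : {poly {poly L}}) (d : {poly L}) : d != 0 ->
  (forall s t, d.[s] != 0 -> P.[t%:P].[s] = 0) -> P = 0.
Proof.
move=> d0 P0; apply/polyP => i; rewrite coef0.
suff: P`_i * d = 0 by move/eqP; rewrite mulf_eq0 (negPf d0) orbF => /eqP.
apply: poly_horner_eq => s; rewrite hornerM horner0.
have [->|ds] := eqVneq d.[s] 0; first by rewrite mulr0.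
suff: map_poly (horner_eval s) P = 0.
  by move/(congr1 (fun p : {poly L} => p`_i)); rewrite coef_map coef0 /= /horner_eval => ->;
    rewrite mul0r.
apply: poly_horner_eq => t; rewrite horner0 -(P0 s t ds).
by rewrite -[t in LHS](hornerC t s) -[_.[s] in LHS]/(horner_eval s t%:P) horner_map.
Qed.

End Cramer.

(** * Incident points and lines *)

Section Incidence.
Variables (K : numFieldType) (n m : nat) (F G : 'I_n -> {mpoly K[3]}).
Hypothesis Fhom : forall a, F a \is m.-homog.
Hypothesis Ghom : forall a, G a \is m.-homog.
Hypothesis FG : forall z w : 'I_3 -> K,
  z 0 * w 0 + z 1 * w 1 = z 2 * w 2 -> \sum_a (F a).@[z] * (G a).@[w] = 0.

(* The point (t, s + b t, 1) runs through the line dual to (- b, 1, s) as t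
   varies, and (x - b, 1, s + t x) through the line dual to (t, s + b t, 1) as x
   varies. *)
Definition Fpol (b s : K) (a : 'I_n) : {poly K} :=
  mmap (@polyC K) (vec3 'X (s%:P + b *: 'X) 1) (F a).
Definition Gpol (b s t : K) (a : 'I_n) : {poly K} :=
  mmap (@polyC K) (vec3 ('X - b%:P) 1 (s%:P + t *: 'X)) (G a).

(** When [N] bounds the sizes, the row space is the span of the curve [x |-> (p a).[x]], and the
    right kernel consists of the linear relations between the polynomials. *)
Definition coef_rows N (p : 'I_n -> {poly K}) : 'M[K]_(N, n) := \matrix_(i, a) (p a)`_i.

Lemma horner_Fpol b s t a : (Fpol b s a).[t] = (F a).@[vec3 t (s + b * t) 1].
Proof.
rewrite -[LHS]/(horner_eval t _) /Fpol /meval.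
apply: (@rmorph_mmap _ K {poly K} K (horner_eval t)) => [c|i];
  first by rewrite /= /horner_eval hornerC.
by rewrite /vec3 /= /horner_eval; case: i => [[|[|[]]]] //= *; rewrite !hornerE.
Qed.

Lemma horner_Gpol b s t x a :
  (Gpol b s t a).[x] = (G a).@[vec3 (x - b) 1 (s + t * x)].
Proof.
rewrite -[LHS]/(horner_eval x _) /Gpol /meval.
apply: (@rmorph_mmap _ K {poly K} K (horner_eval x)) => [c|i];
  first by rewrite /= /horner_eval hornerC.
by rewrite /vec3 /= /horner_eval; case: i => [[|[|[]]]] //= *; rewrite !hornerE.
Qed.

Lemma size_Fpol b s a : (size (Fpol b s a) <= m.+1)%N.
Proof.
apply: size_mmap => [//|c|i]; first exact: size_polyC_leq1.
rewrite /vec3; case: i => [[|[|[]]]] //= *; rewrite ?size_polyX ?size_poly1 //.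
rewrite (leq_trans (size_polyD _ _)) // geq_max (leq_trans (size_polyC_leq1 _)) //.
by rewrite (leq_trans (size_scale_leq _ _)) ?size_polyX.
Qed.

Lemma size_Gpol b s t a : (size (Gpol b s t a) <= m.+1)%N.
Proof.
apply: size_mmap => [//|c|i]; first exact: size_polyC_leq1.
rewrite /vec3; case: i => [[|[|[]]]] //= *; rewrite ?size_XsubC ?size_poly1 //.
rewrite (leq_trans (size_polyD _ _)) // geq_max (leq_trans (size_polyC_leq1 _)) //.
by rewrite (leq_trans (size_scale_leq _ _)) ?size_polyX.
Qed.

Lemma row_horner N (p : 'I_n -> {poly K}) x : (forall a, size (p a) <= N)%N ->
  \row_a (p a).[x] = \row_(i < N) x ^+ i *m coef_rows N p.
Proof.
move=> sp; apply/rowP => a; rewrite !mxE (horner_coef_wide _ (sp a)).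
by apply: eq_bigr => i _; rewrite !mxE mulrC.
Qed.

Lemma coef_rows_mul_eq0 N (p : 'I_n -> {poly K}) (u : 'cV[K]_n) :
  (forall a, size (p a) <= N)%N ->
  coef_rows N p *m u = 0 <-> \sum_a u a 0 *: p a = 0.
Proof.
move=> sp; split=> [E|E].
  apply/polyP => i; rewrite coef0 coef_sum; case: (ltnP i N) => [iN|Ni].
    have := congr1 (fun v : 'cV_N => v (Ordinal iN) 0) E; rewrite !mxE => E'.
    by rewrite -[RHS]E'; apply: eq_bigr => a _; rewrite coefZ !mxE mulrC.
  by rewrite big1 // => a _; rewrite coefZ nth_default ?mulr0 // (leq_trans (sp a)).
apply/colP => i; rewrite !mxE.
have := congr1 (fun p : {poly K} => p`_i) E; rewrite coef0 coef_sum => E'.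
by rewrite -[RHS]E'; apply: eq_bigr => a _; rewrite coefZ !mxE mulrC.
Qed.

Lemma Gpol_perp b s t :
  coef_rows m.+1 (Gpol b s t) *m \col_a (F a).@[vec3 t (s + b * t) 1] = 0.
Proof.
apply/coef_rows_mul_eq0; first by move=> a; apply: size_Gpol.
apply: poly_horner_eq => x; rewrite horner0 horner_sum.
rewrite -[RHS](FG (z := vec3 t (s + b * t) 1) (w := vec3 (x - b) 1 (s + t * x))).
  by apply: eq_bigr => a _; rewrite hornerZ !mxE horner_Gpol.
by rewrite /vec3 /=; ring.
Qed.

(** The parameters of the pencil become indeterminates: the outer one is [t], the inner one [s]. *)
Definition bigF b a : {poly {poly K}} :=
  mmap (fun c => c%:P%:P) (vec3 'X ('X%:P + b%:P *: 'X) 1) (F a).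

(** Nested indeterminates, from the outside in: the position [x] on the dual line, then [t], then
    [s]. *)
Definition bigG b a : {poly {poly {poly K}}} :=
  mmap (fun c => c%:P%:P%:P) (vec3 ('X - b%:P%:P%:P) 1 ('X%:P%:P + 'X *: 'X)) (G a).

Definition ev2 (s t : K) := horner_eval s \o horner_eval t%:P.

HB.instance Definition _ s t :=
  GRing.RMorphism.copy (ev2 s t) (horner_eval s \o horner_eval t%:P).

Lemma ev2E s t P : ev2 s t P = P.[t%:P].[s]. Proof. by []. Qed.

Lemma map_bigF b s a : map_poly (horner_eval s) (bigF b a) = Fpol b s a.
Proof.
apply: (@rmorph_mmap _ K {poly {poly K}} {poly K} (map_poly (horner_eval s))) => [c|i].
  by rewrite /= map_polyC /= /horner_eval hornerC.
rewrite /vec3; case: i => [[|[|[]]]] //= *; rewrite ?map_polyX ?rmorph1 //.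
by rewrite rmorphD /= map_polyC map_polyZ /= map_polyX /horner_eval hornerX hornerC.
Qed.

Lemma map_bigG b s t a : map_poly (ev2 s t) (bigG b a) = Gpol b s t a.
Proof.
apply: (@rmorph_mmap _ K {poly {poly {poly K}}} {poly K} (map_poly (ev2 s t))) => [c|i].
  by rewrite /= map_polyC /= !ev2E !hornerC.
rewrite /vec3; case: i => [[|[|[]]]] //= *; rewrite ?rmorph1 //.
  by rewrite rmorphB /= map_polyX map_polyC /= !ev2E !hornerC.
rewrite rmorphD /= map_polyC map_polyZ /= map_polyX !ev2E.
by rewrite !hornerC !hornerX hornerC.
Qed.

Lemma ev2_bigF b s t a : ev2 s t (bigF b a) = (Fpol b s a).[t].
Proof.
rewrite ev2E -map_bigF -[in RHS](hornerC t s) -[_.[s] in RHS]/(horner_eval s _).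
by rewrite horner_map.
Qed.

(** The variable [t] enters only through [t x], so that no power of [t] exceeds the accompanying
    power of [x]. *)
Lemma size_bigG b a j : (size ((bigG b a)`_j)%R <= j.+1)%N.
Proof.
pose tri (p : {poly {poly {poly K}}}) := forall j, (size (p`_j)%R <= j.+1)%N.
have tri0: tri 0 by move=> i; rewrite coef0 size_poly0.
have triD p q : tri p -> tri q -> tri (p + q).
  move=> tp tq i; rewrite coefD (leq_trans (size_polyD _ _)) // geq_max.
  by rewrite tp tq.
have triM p q : tri p -> tri q -> tri (p * q).
  move=> tp tq i; rewrite coefM (leq_trans (size_sum _ _ _)) //.
  apply/bigmax_leqP => k _; rewrite (leq_trans (size_polyMleq _ _)) //.
  have := leq_add (tp k) (tq (i - k)%N).
  by rewrite addSn addnS subnKC -1?ltnS //; case: (_ + _)%N.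
have triC (c : {poly K}) : tri c%:P%:P.
  by move=> [|i]; rewrite coefC //= ?size_poly0 // size_polyC_leq1.
have tri1: tri 1 by have := triC 1; rewrite !polyC1.
have triX: tri 'X by move=> i; rewrite coefX; case: eqP; rewrite ?size_poly1 ?size_poly0.
suff H: tri (bigG b a) by apply: H.
rewrite /bigG /mmap; elim/big_rec: _ => [|mm p _ tp]; first exact: tri0.
apply: (triD) tp; apply: (triM); first exact: triC.
rewrite /mmap1; elim/big_rec: _ => [|i p' _ tp']; first exact: tri1.
apply: (triM) tp'.
have: tri (vec3 ('X - b%:P%:P%:P) 1 ('X%:P%:P + 'X *: 'X) i).
  rewrite /vec3; case: i => [[|[|[]]]] //= *.
    by apply: (triD); [exact: triX | rewrite -!polyCN; exact: triC].
  apply: (triD); [exact: triC | move=> k; rewrite coefZ coefX; case: eqP => [->|_]].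
    by rewrite mulr1 size_polyX.
  by rewrite mulr0 size_poly0.
by move=> tv; elim: (mm i) => [|k IH]; [exact: tri1 | rewrite exprS; exact: triM].
Qed.

End Incidence.

(** * Cramer's solution along the pencil and its degree in [t] *)

Lemma size_det_rows (R : comNzRingType) k (M : 'M[{poly R}]_k) (e : 'I_k -> nat) :
  (forall r i, size (M r i) <= (e r).+1)%N ->
  (size (\det M) <= (\sum_r e r).+1)%N.
Proof.
move=> sM; rewrite /determinant (leq_trans (size_sum _ _ _)) //.
apply/bigmax_leqP => p _; rewrite -signr_odd.
have sX : (size ((\prod_i M i (p i))%R : {poly R}) <= (\sum_r e r).+1)%N.
  elim/big_rec2: _ => [|i d q _ IH]; first by rewrite size_poly1.
  rewrite (leq_trans (size_polyMleq _ _)) //.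
  have := leq_add (sM i (p i)) IH.
  by rewrite addSn addnS; case: (_ + _)%N.
by case: odd; rewrite ?expr0 ?mul1r // expr1 mulN1r size_polyN.
Qed.

Lemma leq_sum_inj k l (J : 'I_k -> 'I_l) : injective J ->
  (\sum_j J j <= 'C(l, 2))%N.
Proof.
move=> Ji; rewrite -bin2_sum big_mkord.
rewrite -(big_image _ _ J predT (fun i : 'I_l => i : nat)) big_uniq.
  by rewrite [leqRHS](bigID (mem (codom J))) leq_addr.
exact/injectiveP.
Qed.

Section Incidence.
Variables (K : numFieldType) (n m : nat) (F G : 'I_n -> {mpoly K[3]}).
Hypothesis Fhom : forall a, F a \is m.-homog.
Hypothesis Ghom : forall a, G a \is m.-homog.
Hypothesis FG : forall z w : 'I_3 -> K,
  z 0 * w 0 + z 1 * w 1 = z 2 * w 2 -> \sum_a (F a).@[z] * (G a).@[w] = 0.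

(** The vector [F(z)] is a combination of [k.+1] rows [I] spanning the image of the line, subject to
    the [k] incidence equations of the jets [J]. Both selections are made at [(s0, t0)] and kept for
    all [(s, t)]. As the orders in [J] are distinct and less than [l], the degree in [t] is at most
    [0 + 1 + ... + (l - 1)]. *)
Lemma cramer_solution b s0 t0 k l :
  (forall s, \rank (coef_rows m.+1 (Fpol F b s)) <= k.+1)%N ->
  (k < \rank (coef_rows m.+1 (Fpol F b s0)))%N ->
  (k <= \rank (coef_rows m.+1 (Fpol F b s0) *m (coef_rows m.+1 (Gpol G b s0 t0))^T))%N ->
  (coef_rows m.+1 (Gpol G b s0 t0) <= coef_rows l (Gpol G b s0 t0))%MS ->
  exists C : 'I_n -> {poly {poly K}}, [/\ proportional (bigF F b) C,
    exists a, C a != 0 & forall a, (size (C a) <= ('C(l, 2)).+1)%N].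
Proof.
move=> maxF rF rFG GJ.
have [I [_ rI]] := mxrank_rowsub rF.
set PhiX := coef_rows _ _ in rF rFG rI.
have subI: (PhiX <= rowsub I PhiX)%MS.
  rewrite -(geq_leqif (mxrank_leqif_sup (rowsub_sub I PhiX))) rI.
  exact: maxF.
pose P := rowsub I PhiX *m (coef_rows l (Gpol G b s0 t0))^T.
have rP: (k <= \rank P^T)%N.
  rewrite mxrank_tr; apply: leq_trans rFG _.
  have /submxP[U ->] := subI; have /submxP[W ->] := GJ.
  rewrite trmx_mul !mulmxA -(mulmxA U).
  by apply: leq_trans (mxrankM_maxl _ _) (mxrankM_maxr _ _).
have [J [Ji rJ]] := mxrank_rowsub rP.
(* These entries are constant in [t]: they describe the image of the whole line. *)
pose A : 'M[{poly {poly K}}]_(k.+1, n) := \matrix_(i, a) ((bigF F b a)`_(I i))%:P.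
pose Q : 'M[{poly {poly K}}]_(k.+1, k) :=
  \matrix_(i, j) \sum_a A i a * (bigG G b a)`_(J j).
pose As s := rowsub I (coef_rows m.+1 (Fpol F b s)).
pose Qs s t := As s *m (rowsub J (coef_rows l (Gpol G b s t)))^T.
have evA s t i a : ev2 s t (A i a) = As s i a.
  by rewrite !mxE ev2E hornerC -map_bigF coef_map.
have evQ s t i j : ev2 s t (Q i j) = Qs s t i j.
  rewrite !mxE rmorph_sum; apply: eq_bigr => a _.
  by rewrite rmorphM /= evA !mxE -map_bigG coef_map.
pose C a := \det (bordered A Q a).
have evC s t a : ev2 s t (C a) = \det (bordered (As s) (Qs s t) a).
  transitivity (\det (map_mx (ev2 s t) (bordered A Q a))).
    by rewrite det_map_mx.
  congr (\det _); apply/matrixP => r i.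
  rewrite [LHS]mxE [bordered A _ _ _ _]mxE [RHS]mxE.
  by case: unlift => [j|]; [exact: evQ | exact: evA].
exists C; split.
- have lA i j : lpoly (fun s : K^o => As s i j).
    move=> s1 s2; exists ((bigF F b j)`_(I i) \Po (s1%:P + s2 *: 'X)) => c.
    rewrite !mxE -map_bigF coef_map /= horner_comp !hornerE /horner_eval.
    by congr (_.[_ + _]); rewrite mulrC.
  have [|d [ld d0 dP]] := @lpoly_mxrank K K^o _ _ (fun s => As s) s0 k.+1 lA.
    by rewrite rI.
  have [d' d'E] := ld 0 1.
  have d'0: d' != 0.
    apply: contraNneq d0 => d'0; have := d'E s0.
    by rewrite d'0 horner0 add0r [_ *: _]mulr1 => ->.
  move=> a a'; apply/eqP; rewrite -subr_eq0; apply/eqP.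
  (* It is enough to treat the parameters [s] at which the selected rows still span the image of the
     line. *)
  apply: (poly2_eq0 d'0) => s t; rewrite -d'E add0r [_ *: _]mulr1 => ds.
  rewrite !(hornerD, hornerN, hornerM) -!ev2E !evC.
  have subAs: (coef_rows m.+1 (Fpol F b s) <= As s)%MS.
    rewrite -(geq_leqif (mxrank_leqif_sup (rowsub_sub I _))).
    exact: leq_trans (maxF s) (dP s ds).
  have := row_horner t (fun a => size_Fpol Fhom b s a).
  set f := \row_a _ => fE.
  have /submxP[phi fphi] : (f <= As s)%MS.
    by rewrite fE (submx_trans (submxMl _ _)).
  have evF a1 : ev2 s t (bigF F b a1) = (phi *m As s) 0 a1.
    by rewrite -fphi mxE ev2_bigF.
  rewrite !evF; apply/eqP; rewrite subr_eq0; apply/eqP/bordered_parallel.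
  rewrite /Qs mulmxA -fphi; apply: trmx_inj; rewrite trmx_mul trmxK trmx0.
  have := Gpol_perp Ghom FG b s t.
  have -> : \col_a (F a).@[vec3 t (s + b * t) 1] = f^T.
    by apply/colP => a1; rewrite !mxE horner_Fpol.
  move=> perp; apply/colP => j; rewrite !mxE.
  case: (ltnP (J j) m.+1) => [Jm|mJ].
    have := congr1 (fun v : 'cV_m.+1 => v (Ordinal Jm) 0) perp; rewrite !mxE => E.
    by rewrite -[RHS]E; apply: eq_bigr => a1 _; rewrite !mxE.
  rewrite big1 // => a1 _; rewrite !mxE nth_default ?mul0r //.
  by rewrite (leq_trans (size_Gpol Ghom _ _ _ _)).
- have [||a Ca] := @bordered_neq0 K k n (As s0) (Qs s0 t0).
  + by rewrite rI.
  + rewrite -mxrank_tr -[X in (X <= _)%N]rJ.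
    apply: eq_leq; congr (\rank _); apply/matrixP => i j; rewrite !mxE.
    by apply: eq_bigr => a _; rewrite !mxE.
  by exists a; apply: contraNneq Ca => Ca; rewrite -(evC s0 t0) Ca rmorph0.
(* Row [ord0] is free of [t], and the row of the jet [J j] has degree at most [J j]. *)
move=> a; pose e r := if unlift ord0 r is Some j then J j : nat else 0%N.
apply: (@leq_trans (\sum_r e r).+1).
  apply: size_det_rows => r i; rewrite !mxE /e; case: unlift => [j|].
    rewrite mxE (leq_trans (size_sum _ _ _)) //; apply/bigmax_leqP => a1 _.
    rewrite mxE (leq_trans (size_polyMleq _ _)) //.
    have := leq_add (size_polyC_leq1 ((bigF F b a1)`_(I i))) (size_bigG G b a1 (J j)).
    by rewrite add1n; case: (_ + _)%N.
  by rewrite size_polyC_leq1.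
rewrite ltnS big_ord_recl {1}/e unlift_none add0n.
under eq_bigr => j _ do rewrite /e liftK.
exact: leq_sum_inj.
Qed.

End Incidence.

(** * Polynomials as functions *)

Lemma base_expansion_inj n B (f g : 'I_n -> nat) :
  (forall i, f i < B)%N -> (forall i, g i < B)%N ->
  (\sum_i f i * B ^ i = \sum_i g i * B ^ i)%N -> f =1 g.
Proof.
elim: n f g => [|n IH] f g fB gB; first by move=> _ [].
have E (h : 'I_n.+1 -> nat) :
    (\sum_i h i * B ^ i = h ord0 + (\sum_i h (lift ord0 i) * B ^ i) * B)%N.
  rewrite big_ord_recl expn0 muln1 big_distrl /=; congr addn.
  by apply: eq_bigr => i _; rewrite /bump /= add1n expnSr mulnA.
rewrite !E => H.
have B0: (0 < B)%N by apply: leq_ltn_trans (fB ord0).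
have f0: f ord0 = g ord0.
  by have := congr1 (modn^~ B) H; rewrite ![(_ + _ * B)%N]addnC !modnMDl !modn_small.
have fS: (fun i => f (lift ord0 i)) =1 (fun i => g (lift ord0 i)).
  apply: IH => [i|i|]; [exact: fB | exact: gB|].
  by move/eqP: H; rewrite f0 eqn_add2l eqn_pmul2r // => /eqP.
by move=> i; case: (unliftP ord0 i) => [j|] ->; [exact: fS | exact: f0].
Qed.

(* Kronecker's substitution of powers of one variable with exponents in
   geometric progression is injective in bounded degree. *)
Lemma mpoly_neq0_nat (K : numFieldType) n (p : {mpoly K[n]}) : p != 0 ->
  exists x : 'I_n -> nat, p.@[fun i => (x i)%:R] != 0.
Proof.
move=> p0; pose B := msize p; pose h (i : 'I_n) : {poly K} := 'X^(B ^ i).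
pose e (m : 'X_{1..n}) := (\sum_(i < n) m i * B ^ i)%N.
have hE m : mmap1 h m = 'X^(e m).
  rewrite /mmap1 /e /h; elim/big_rec2: _ => [|i k q _ ->]; first by rewrite expr0.
  by rewrite exprD -exprM mulnC.
have m0p : mlead p \in msupp p by rewrite mlead_supp.
have mB m : m \in msupp p -> forall i, (m i < B)%N.
  move=> mp i; apply: leq_ltn_trans (msize_mdeg_lt mp).
  by rewrite mdegE (bigD1 i) //= leq_addr.
have P0: mmap (@polyC K) h p != 0.
  apply/eqP => /(congr1 (fun q : {poly K} => q`_(e (mlead p)))).
  rewrite /mmap coef0 coef_sum (bigD1_seq (mlead p)) ?msupp_uniq //=.
  rewrite hE coefCM coefXn eqxx mulr1 big_seq_cond big1 ?addr0 => [|m].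
    by apply/eqP; rewrite mleadc_eq0.
  case/andP => mp mne; rewrite hE coefCM coefXn; case: eqP => [E|]; last by rewrite mulr0.
  case/eqP: mne; apply/mnmP; apply: (@base_expansion_inj n B); last exact: esym.
    exact: mB.
  exact: mB.
have: ~~ all (root (mmap (@polyC K) h p)) [seq i%:R | i <- iota 0 (size (mmap (@polyC K) h p))].
  apply/negP => r0.
  suff: uniq ([seq i%:R | i <- iota 0 (size (mmap (@polyC K) h p))] : seq K).
    by move/(max_poly_roots P0 r0); rewrite size_map size_iota ltnn.
  by rewrite map_inj_uniq ?iota_uniq // => i j /eqP; rewrite eqr_nat => /eqP.
case/allPn => y /mapP[c _ ->] Pc; exists (fun i => c ^ (B ^ i))%N.
suff <- : (mmap (@polyC K) h p).[c%:R] = p.@[fun i => (c ^ (B ^ i))%:R] by [].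
rewrite -[LHS]/(horner_eval c%:R _) /meval.
apply: (@rmorph_mmap _ K {poly K} K (horner_eval c%:R)) => [a|i].
  by rewrite /= /horner_eval hornerC.
by rewrite /= /horner_eval /h hornerXn natrX.
Qed.

Lemma mpoly_eq_meval (K : numFieldType) n (p q : {mpoly K[n]}) :
  (forall z, p.@[z] = q.@[z]) -> p = q.
Proof.
move=> pq; apply/eqP; rewrite -subr_eq0; apply/negPn/negP.
by case/mpoly_neq0_nat => x; rewrite mevalB pq subrr eqxx.
Qed.

Lemma meval_dhomog (K : numFieldType) n d (p : {mpoly K[n]}) c (z : 'I_n -> K) :
  p \is d.-homog -> p.@[fun i => c * z i] = c ^+ d * p.@[z].
Proof.
move=> /dhomogP ph; rewrite !mevalE mulr_sumr big_seq [RHS]big_seq.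
apply: eq_bigr => m mp; rewrite mulrCA; congr (_ * _).
have /= <- := ph m mp; rewrite mdegE -prodrXr -big_split /=.
by apply: eq_bigr => i _; rewrite exprMn.
Qed.

(** * Row spaces of coefficient matrices: substitution and osculation *)

Section CoefRows.
Variables (K : numFieldType) (n : nat).
Implicit Types p : 'I_n -> {poly K}.

(** Substitution preserves the linear relations between the polynomials, so the span of the curve
    cannot grow. *)
Lemma coef_rows_comp N p q : (forall a, size (p a) <= N)%N ->
  (forall a, size (p a \Po q) <= N)%N ->
  (coef_rows N (fun a => (p a) \Po q) <= coef_rows N p)%MS.
Proof.
move=> sp spq; rewrite submxE; apply/eqP/matrixP => i j; rewrite [RHS]mxE.
have colM (M : 'M[K]_(N, n)) (C : 'M_n) : M *m col j C = col j (M *m C).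
  by rewrite !colE mulmxA.
pose u : 'cV_n := col j (cokermx (coef_rows N p)).
suff: coef_rows N (fun a => p a \Po q) *m u = 0.
  by move=> /(congr1 (fun v : 'cV_N => v i 0)); rewrite colM mxE => ->; rewrite mxE.
apply/coef_rows_mul_eq0 => //.
have /coef_rows_mul_eq0 : coef_rows N p *m u = 0.
  by rewrite colM mulmx_coker; apply/colP => r; rewrite !mxE.
move=> /(_ sp)/(congr1 (comp_poly q)); rewrite comp_poly0 => E.
rewrite -[RHS]E rmorph_sum; apply: eq_bigr => a _.
by rewrite /= linearZ.
Qed.

Lemma coef_rows_widen N l p : (l <= N)%N -> (coef_rows l p <= coef_rows N p)%MS.
Proof.
move=> lN; have -> : coef_rows l p = rowsub (widen_ord lN) (coef_rows N p).
  by apply/matrixP => i j; rewrite !mxE.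
exact: rowsub_sub.
Qed.

(** The independence of generic jets is applied to [r] linearly independent components, where [r] is
    the dimension of the span: at a generic point the first [r] jets already span as much as the
    whole curve. *)
Lemma generic_osculation N p : (forall a, size (p a) <= N)%N ->
  exists x, (\rank (coef_rows N p) <=
    \rank (coef_rows (\rank (coef_rows N p)) (fun a => p a \Po ('X + x%:P))))%N.
Proof.
move=> sp; set r := \rank _.
have [|g [_ rg]] := @mxrank_rowsub K _ _ (coef_rows N p)^T r; first by rewrite mxrank_tr.
have free_g: row_free (rowsub g (coef_rows N p)^T) by rewrite /row_free rg.
have [c c0 i|d d0 dP] := @generic_jets K r (fun i => p (g i)).
  suff: \row_i c i = 0 by move=> /rowP/(_ i); rewrite !mxE.
  apply/eqP; rewrite -(mulmx_free_eq0 _ free_g); apply/eqP/rowP => j.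
  have := congr1 (fun q : {poly K} => q`_j) c0; rewrite coef0 coef_sum => E.
  by rewrite !mxE -[RHS]E; apply: eq_bigr => h _; rewrite coefZ !mxE.
have [x dx] := poly_neq0_horner d0; exists x.
set M := coef_rows r _; rewrite -mxrank_tr.
apply: leq_trans (mxrankS (rowsub_sub g M^T)).
suff: row_free (rowsub g M^T) by rewrite /row_free => /eqP ->.
rewrite -kermx_eq0; apply/rowV0P => v /sub_kermxP vM.
apply/rowP => i; rewrite [RHS]mxE; apply: (dP x dx (fun i => v 0 i)).
set S := \sum_i _.
have: 'X^r %| S \Po ('X + x%:P).
  apply/dvdpP; exists (drop_poly r (S \Po ('X + x%:P))).
  rewrite -{1}(poly_take_drop r (S \Po ('X + x%:P))).
  suff -> : take_poly r (S \Po ('X + x%:P)) = 0 by rewrite add0r.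
  apply/polyP => j; rewrite coef_take_poly coef0; case: ltnP => // jr.
  have := congr1 (fun u : 'rV_r => u 0 (Ordinal jr)) vM; rewrite !mxE => E.
  rewrite -[RHS]E /S rmorph_sum coef_sum; apply: eq_bigr => h _.
  by rewrite /= linearZ coefZ !mxE.
case/dvdpP => q qE; apply/dvdpP; exists (q \Po ('X - x%:P)).
have := congr1 (comp_poly ('X - x%:P)) qE.
rewrite -comp_polyA rmorphM /= comp_polyD comp_polyX comp_polyC subrK comp_polyXr.
by rewrite rmorphXn /= comp_polyX => ->.
Qed.

End CoefRows.

(** * From polynomials on an affine chart to ternary forms *)

Section Homogenize.
Variable K : numFieldType.

(* [b] shears back to the coordinates t = z0 / z2, s = (z1 - b z0) / z2 used
   along the pencil of lines. *)
Definition homogenize (d : nat) (b : K) (P : {poly {poly K}}) : {mpoly K[3]} :=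
  \sum_(i < d.+1) \sum_(j < d.+1 | (i + j <= d)%N)
    P`_i`_j *: (('X_1 - b *: 'X_0) ^+ j * 'X_0 ^+ i * 'X_2 ^+ (d - (i + j))).

Lemma homogenize_homog d b P : homogenize d b P \is d.-homog.
Proof.
apply: rpred_sum => i _; apply: rpred_sum => j ij; apply: dhomogZ.
have X1 (i0 : 'I_3) : ('X_i0 : {mpoly K[3]}) \is 1.-homog by rewrite dhomogX /= mdeg1.
rewrite -[X in X.-homog](subnKC ij) [(i + j)%N]addnC.
apply: dhomogM; first apply: dhomogM.
- rewrite -[X in X.-homog]mul1n; apply: dhomogMn.
  by rewrite rpredB // dhomogZ.
- by rewrite -[X in X.-homog]mul1n; apply: dhomogMn.
by rewrite addnC -[X in X.-homog]mul1n; apply: dhomogMn.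
Qed.

Lemma meval_homogenize d b (P : {poly {poly K}}) (z : 'I_3 -> K) :
  (forall i j, (d < i + j)%N -> (P`_i)`_j = 0) -> z 2 != 0 ->
  (homogenize d b P).@[z] =
    z 2 ^+ d * P.[(z 0 / z 2)%:P].[(z 1 - b * z 0) / z 2].
Proof.
move=> P0 z2.
have sP: (size P <= d.+1)%N.
  apply/leq_sizeP => i di; apply/polyP => j; rewrite coef0.
  by apply: P0; rewrite (leq_trans di) ?leq_addr.
have sPi i: (size (P`_i)%R <= d.+1)%N.
  apply/leq_sizeP => j dj; apply: P0; rewrite (leq_trans dj) ?leq_addl //.
rewrite (horner_coef_wide _ sP) horner_sum mulr_sumr /homogenize raddf_sum.
apply: eq_bigr => i _; rewrite raddf_sum.
rewrite hornerM -polyC_exp hornerC (horner_coef_wide _ (sPi i)).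
rewrite mulr_suml mulr_sumr big_mkcond; apply: eq_bigr => j _ /=.
case: leqP => [ij|ij]; last by rewrite P0 // !mul0r mulr0.
rewrite mevalZ !rmorphM /= !rmorphXn /= mevalB mevalZ !mevalXU.
have -> : z 2 ^+ d = z 2 ^+ (d - (i + j)) * (z 2 ^+ i * z 2 ^+ j).
  by rewrite -!exprD subnK.
rewrite !expr_div_n; set u := _ ^+ j; set v := _ ^+ (d - _); set x := z 0 ^+ i.
field.
by rewrite ?expf_neq0.
Qed.

End Homogenize.

(** * The degree bound from the pairing of incident spans *)

Section DegreeBound.
Variables (K : numClosedFieldType) (n m : nat) (F G : 'I_n -> {mpoly K[3]}).
Hypothesis Fhom : forall a, F a \is m.-homog.
Hypothesis Ghom : forall a, G a \is m.-homog.
Hypothesis FG : forall z w : 'I_3 -> K,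
  z 0 * w 0 + z 1 * w 1 = z 2 * w 2 -> \sum_a (F a).@[z] * (G a).@[w] = 0.

Local Notation V := (K^o * K^o * K^o)%type.

Lemma lpoly_fst1 : lpoly (fun X : V => X.1.1 : K).
Proof.
move=> X Y; exists (X.1.1%:P + Y.1.1 *: 'X) => c.
by rewrite !hornerE /= [c *: _]mulrC.
Qed.

Lemma lpoly_fst2 : lpoly (fun X : V => X.1.2 : K).
Proof.
move=> X Y; exists (X.1.2%:P + Y.1.2 *: 'X) => c.
by rewrite !hornerE /= [c *: _]mulrC.
Qed.

Lemma lpoly_snd : lpoly (fun X : V => X.2 : K).
Proof.
move=> X Y; exists (X.2%:P + Y.2 *: 'X) => c.
by rewrite !hornerE /= [c *: _]mulrC.
Qed.

Lemma clpoly_Fpol (W : lmodType K) (f g : W -> K) a : lpoly f -> lpoly g ->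
  clpoly (fun X => Fpol F (f X) (g X) a).
Proof.
move=> lf lg; apply: clpoly_mmap => i; rewrite /vec3.
case: i => [[|[|i]]] _ //=; try exact: clpolyP.
apply: clpolyD; first exact: clpolyC.
apply: eq_clpoly (clpolyM (clpolyC lf) (clpolyP 'X)) => X.
by rewrite mul_polyC.
Qed.

Lemma clpoly_Gpol (W : lmodType K) (f g h : W -> K) a : lpoly f -> lpoly g -> lpoly h ->
  clpoly (fun X => Gpol G (f X) (g X) (h X) a).
Proof.
move=> lf lg lh; apply: clpoly_mmap => i; rewrite /vec3.
case: i => [[|[|i]]] _ //=; try exact: clpolyP.
  apply: clpolyD; first exact: clpolyP.
  by apply: eq_clpoly (clpolyC (lpolyN lf)) => X; rewrite polyCN.
apply: clpolyD; first exact: clpolyC.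
apply: eq_clpoly (clpolyM (clpolyC lh) (clpolyP 'X)) => X.
by rewrite mul_polyC.
Qed.

Local Notation Phi b s := (coef_rows m.+1 (Fpol F b s)).
Local Notation Hx b s t := (coef_rows m.+1 (Gpol G b s t)).

Lemma lpoly_coef_rows (W : lmodType K) N (p : W -> 'I_n -> {poly K}) :
  (forall a, clpoly (fun X => p X a)) ->
  forall i a, lpoly (fun X => coef_rows N (p X) i a).
Proof. by move=> lp i a; apply: eq_lpoly (lp a i) => X; rewrite mxE. Qed.

Lemma lpoly_Phi i a : lpoly (fun X : V => Phi X.1.1 X.1.2 i a).
Proof.
apply: lpoly_coef_rows => {}a; apply: clpoly_Fpol; [exact: lpoly_fst1 | exact: lpoly_fst2].
Qed.

Lemma lpoly_Hx N i a : lpoly (fun X : V => coef_rows N (Gpol G X.1.1 X.1.2 X.2) i a).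
Proof.
by apply: lpoly_coef_rows => {}a; apply: clpoly_Gpol;
  [exact: lpoly_fst1 | exact: lpoly_fst2 | exact: lpoly_snd].
Qed.

(** The dual line depends only on the point [(t, s + b t, 1)], and [b] only moves the origin of its
    parameter [x]. The choice of [b] therefore places the jets at a generic point of the dual
    line. *)
Lemma Gpol_shift b s t a : Gpol G b s t a = Gpol G 0 (s + b * t) t a \Po ('X - b%:P).
Proof.
apply/esym; rewrite -[LHS]/(comp_poly _ _) /Gpol.
apply: (@rmorph_mmap _ K {poly K} {poly K} (comp_poly ('X - b%:P))) => [c|i].
  by rewrite /= comp_polyC.
rewrite /vec3; case: i => [[|[|i]]] _ /=; rewrite ?rmorph1 //.
  by rewrite subr0 comp_polyX.
rewrite comp_polyD comp_polyC comp_polyZ comp_polyX scalerBr polyCD.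
by rewrite -mul_polyC [b * t]mulrC polyCM mul_polyC -!mul_polyC; ring.
Qed.

Lemma exists_max (P : nat -> Prop) N : (exists i, P i) -> (forall i, P i -> i <= N)%N ->
  exists k, P k /\ forall i, P i -> (i <= k)%N.
Proof.
move=> [i Pi] PN.
have [||k /asboolP Pk kmax] := @ex_maxnP (fun i => `[< P i >]) N.
- by exists i; apply/asboolP.
- by move=> j /asboolP/PN.
by exists k; split=> // j Pj; apply: kmax; apply/asboolP.
Qed.

(** Multiplying by the three variables forces a nonvanishing point with nonzero coordinates, which
    is then rescaled to the chart. *)
Lemma dhomog_chart (f : {mpoly K[3]}) : f \is m.-homog -> f != 0 ->
  exists t y, [/\ t != 0, y != 0 & f.@[vec3 t y 1] != 0].
Proof.
move=> fh f0; have: 'X_0 * 'X_1 * 'X_2 * f != 0.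
  by rewrite !mulf_neq0 // -msize_poly_eq0 msizeX.
case/mpoly_neq0_nat => x; rewrite !mevalM !mevalXU !mulf_eq0.
move=> /norP[/norP[/norP[x0 x1] x2] fx].
exists ((x 0)%:R / (x 2)%:R), ((x 1)%:R / (x 2)%:R); split.
- by rewrite mulf_neq0 // invr_eq0.
- by rewrite mulf_neq0 // invr_eq0.
apply: contraNneq fx => E.
rewrite (@meval_eq _ _ _ (fun i => (x 2)%:R *
  vec3 ((x 0)%:R / (x 2)%:R) ((x 1)%:R / (x 2)%:R) 1 i)).
  by rewrite (meval_dhomog _ _ fh) E mulr0.
move=> i; rewrite /vec3; case: i => [[|[|[]]]] //= *; rewrite ?mulr1.
- by rewrite mulrC divfK //; congr (x _)%:R; apply: val_inj.
- by rewrite mulrC divfK //; congr (x _)%:R; apply: val_inj.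
- by congr (x _)%:R; apply: val_inj.
Qed.

(* If the pairing of the span of the image of a line with the span of the image
   of an incident dual line has the largest rank allowed by incidence, then [F]
   is, on each of these lines, the only solution of the incidence equations. *)
Theorem degree_bound :
  (exists a, F a != 0) ->
  (forall k, (forall b s, \rank (Phi b s) <= k.+1)%N ->
     (exists b s, k < \rank (Phi b s))%N ->
     exists b s t, (k <= \rank (Phi b s *m (Hx b s t)^T))%N) ->
  exists d C, [/\ (d <= 'C(n.-1, 2))%N, forall a, C a \is d.-homog,
    exists a : 'I_n, C a != 0 & proportional F C].
Proof.
move=> [a0 Fa0] Hk; have [t0 [y0 [t00 _ Fty]]] := dhomog_chart (Fhom a0) Fa0.
(* With [b = y0 / t0] and [s = 0] the line passes through [(t0, y0, 1)]. *)
have Fp0: Fpol F (y0 / t0) 0 a0 != 0.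
  apply: contraNneq Fty => Fp; have := horner_Fpol F (y0 / t0) 0 t0 a0.
  by rewrite Fp horner0 add0r divfK // => <-.
have [i0 Fi0] : exists i, (Fpol F (y0 / t0) 0 a0)`_i != 0.
  by exists (size (Fpol F (y0 / t0) 0 a0)).-1; rewrite -lead_coefE lead_coef_eq0.
have im b s a i : (Fpol F b s a)`_i != 0 -> (i <= m)%N.
  apply: contraR; rewrite -ltnNge => mi.
  by rewrite nth_default // (leq_trans (size_Fpol Fhom b s a)).
have [||k1 [[b1 [s1 rk1]] k1max]] :=
   @exists_max (fun r => exists b s, r <= \rank (Phi b s))%N m.+1.
- by exists 0%N, 0, 0.
- by move=> r [b [s]] H; rewrite (leq_trans H) // rank_leq_row.
have [k k1E] : exists k, k1 = k.+1.
  have : (0 < k1)%N.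
    apply: k1max; exists (y0 / t0), 0; rewrite lt0n mxrank_eq0.
    apply: contraNneq (Fi0) => /matrixP/(_ (inord i0) a0).
    by rewrite !mxE inordK ?ltnS; [move=> -> | exact: im Fi0].
  by case: (k1) => // k _; exists k.
subst k1.
have maxPhi b s: (\rank (Phi b s) <= k.+1)%N by apply: k1max; exists b, s.
have [||l [[y2 [t2 rl]] lmax]] :=
   @exists_max (fun r => exists y t, r <= \rank (Hx 0 y t))%N m.+1.
- by exists 0%N, 0, 0.
- by move=> r [b [s]] H; rewrite (leq_trans H) // rank_leq_row.
have maxH b s t: (\rank (Hx b s t) <= l)%N.
  apply: leq_trans (lmax _ _); last by exists (s + b * t), t; apply: leqnn.
  apply: mxrankS; have := @coef_rows_comp K n m.+1 (Gpol G 0 (s + b * t) t) ('X - b%:P).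
  have -> : coef_rows m.+1 (fun a => Gpol G 0 (s + b * t) t a \Po ('X - b%:P)) = Hx b s t.
    by apply/matrixP => i j; rewrite !mxE -Gpol_shift.
  by apply=> a; rewrite -?Gpol_shift size_Gpol.
have lE: \rank (Hx 0 y2 t2) = l by apply/eqP; rewrite eqn_leq rl maxH.
have [x2] := generic_osculation (fun a => size_Gpol Ghom 0 y2 t2 a); rewrite lE.
set M2 := coef_rows l _ => rM2.
(* This value of [b] moves the osculation point [x2] to the origin of the parameter. *)
have M2E: M2 = coef_rows l (Gpol G (- x2) (y2 + x2 * t2) t2).
  apply/matrixP => i j; rewrite !mxE [in RHS]Gpol_shift mulNr addrK.
  by rewrite polyCN opprK.
have [b3 [s3 [t3 rk3]]] := Hk k maxPhi (ex_intro _ b1 (ex_intro _ s1 rk1)).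
(* The largest degree on the lines [s = 0]. It can be smaller than [m], for instance when the third
   variable divides every form. *)
have [||m0 [[b4 [a4 Fm0]] m0max]] :=
   @exists_max (fun i => exists b a, (Fpol F b 0 a)`_i != 0) m.
- by exists i0, (y0 / t0), a0.
- by move=> i [b [a]]; apply: im.
have [d1 [ld1 nz1 P1]] := @lpoly_mxrank K V _ _ (fun X => Phi X.1.1 X.1.2) (b1, s1, 0)
  k.+1 lpoly_Phi rk1.
have [d2 [ld2 nz2 P2]] : exists d : V -> K, [/\ lpoly d, d (- x2, y2 + x2 * t2, t2) != 0 &
    forall X : V, d X != 0 -> (l <= \rank (coef_rows l (Gpol G X.1.1 X.1.2 X.2)))%N].
  apply: (@lpoly_mxrank K V _ _ (fun X => coef_rows l (Gpol G X.1.1 X.1.2 X.2))).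
    exact: lpoly_Hx.
  by rewrite /= -M2E.
have [d3 [ld3 nz3 P3]] : exists d : V -> K, [/\ lpoly d, d (b3, s3, t3) != 0 &
    forall X : V, d X != 0 -> (k <= \rank (Phi X.1.1 X.1.2 *m (Hx X.1.1 X.1.2 X.2)^T))%N].
  apply: (@lpoly_mxrank K V _ _ (fun X => Phi X.1.1 X.1.2 *m (Hx X.1.1 X.1.2 X.2)^T)) => //.
  move=> i j; have L: lpoly (fun X : V =>
      \sum_a Phi X.1.1 X.1.2 i a * Hx X.1.1 X.1.2 X.2 j a).
    by apply: lpoly_sum => a; apply: lpolyM; [exact: lpoly_Phi | exact: lpoly_Hx].
  by apply: eq_lpoly L => X; rewrite [RHS]mxE; apply: eq_bigr => a _; rewrite [_^T _ _]mxE.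
have ld4: lpoly (fun X : V => (Fpol F X.1.1 0 a4)`_m0).
  by apply: clpoly_Fpol; [exact: lpoly_fst1 | exact: lpolyC].
have ld5: lpoly (fun X : V => (F a0).@[vec3 X.2 (X.1.2 + X.1.1 * X.2) 1]).
  rewrite /meval /mmap; apply: lpoly_sum => mm; apply: lpolyM; first exact: lpolyC.
  apply: lpoly_prod => i.
  have lv: lpoly (fun X : V => vec3 X.2 (X.1.2 + X.1.1 * X.2) 1 i).
    rewrite /vec3; case: i => [[|[|i]]] _ /=; [exact: lpoly_snd| |exact: lpolyC].
    apply: lpolyD; [exact: lpoly_fst2|apply: lpolyM].
      exact: lpoly_fst1.
    exact: lpoly_snd.
  elim: (mm i) => [|e IH]; first exact: lpolyC.
  by apply: eq_lpoly (lpolyM lv IH) => X; rewrite exprS.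
(* One parameter [(b, s, t)] is to satisfy five conditions: a span of maximal dimension along the
   line, [l] independent jets, a pairing of rank at least [k], degree [m0] on [s = 0], and a nonzero
   value of [F] at [z]. *)
have [X12 [nz12a nz12b]] := lpoly_neq0_common ld1 ld2 nz1 nz2.
have [X34 [nz34a nz34b]] := @lpoly_neq0_common K V _ _ _ (b4, 0, 0) ld3 ld4 nz3 Fm0.
have [X5 [nz5a nz5b]] := @lpoly_neq0_common K V _ _ _ (0, y0, t0) (lpolyM ld1 ld2) ld5
  (mulf_neq0 nz12a nz12b) ltac:(by rewrite /= mul0r addr0).
have [X] := lpoly_neq0_common (lpolyM (lpolyM ld1 ld2) ld5) (lpolyM ld3 ld4)
  (mulf_neq0 nz5a nz5b) (mulf_neq0 nz34a nz34b).
rewrite !mulf_eq0 !negb_or => -[/andP[/andP[/P1 R1 /P2 R2] R5] /andP[/P3 R3 R4]].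
case: X R1 R2 R3 R4 R5 => [[b s] t] /= R1 R2 R3 R4 R5.
have lm: (l <= m.+1)%N by rewrite -lE rank_leq_row.
have [C [FC C0 sC]] : exists C : 'I_n -> {poly {poly K}}, [/\ proportional (bigF F b) C,
    exists a, C a != 0 & forall a, (size (C a) <= ('C(l, 2)).+1)%N].
  apply: (cramer_solution Fhom Ghom FG (s0 := s) (t0 := t)) => //.
  rewrite -(geq_leqif (mxrank_leqif_sup (coef_rows_widen _ lm))).
  exact: leq_trans (maxH b s t) R2.
(* The span along the dual line annihilates the nonzero vector [F(z)], so it is a proper
   subspace. *)
have ln: (l <= n.-1)%N.
  have := Gpol_perp Ghom FG b s t; set f := \col_a _ => fH.
  have fl: coef_rows l (Gpol G b s t) *m f = 0.
    have /submxP[D ->] := coef_rows_widen (Gpol G b s t) lm.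
    by rewrite -mulmxA fH mulmx0.
  have := mulmx0_rank_max fl; have f0: (0 < \rank f)%N.
    rewrite lt0n mxrank_eq0; apply: contraNneq R5 => /colP/(_ a0).
    by rewrite !mxE => ->.
  move=> /(leq_trans (leq_add R2 f0)); rewrite addn1.
  by case: (n).
have [g [C2 [FgC sC2]]] := parallel_dvd FC C0 sC.
(* On [s = c t] the second coordinate [s + b t] becomes [(b + c) t], so each radial restriction is
   again a curve [Fpol] with [s = 0], of degree at most [m0]. *)
have radF c a : radial c (bigF F b a) = Fpol F (b + c) 0 a.
  rewrite /radial -[LHS]/((horner_eval 'X \o map_poly (comp_poly (c *: 'X))) (bigF F b a)).
  apply: (@rmorph_mmap _ K {poly {poly K}} {poly K}
            (horner_eval 'X \o map_poly (comp_poly (c *: 'X)))) => [x|i].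
    by rewrite /= map_polyC /= comp_polyC /horner_eval hornerC.
  rewrite /vec3; case: i => [[|[|i]]] _ /=; rewrite ?rmorph1 //.
    by rewrite map_polyX /horner_eval hornerX.
  rewrite rmorphD /= map_polyC map_polyZ /= map_polyX comp_polyC comp_polyX.
  by rewrite /horner_eval !hornerE -!mul_polyC polyCD; ring.
have C20 := @factor_total_degree _ _ _ _ g m0 'C(l, 2) a4 FgC _ _ sC2.
have {}C20: forall a i j, ('C(l, 2) < i + j)%N -> (C2 a)`_i`_j = 0.
  apply: C20 => [c a|]; last by rewrite radF addr0.
  rewrite radF; apply/leq_sizeP => i mi; apply/eqP/negPn/negP => Fi.
  by have := m0max i (ex_intro _ _ (ex_intro _ a Fi)); rewrite leqNgt mi.
exists 'C(l, 2), (fun a => homogenize 'C(l, 2) b (C2 a)); split.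
- by apply: leq_bin2l.
- by move=> a; apply: homogenize_homog.
- exists a0; apply: contraNneq R5 => C0'; rewrite -horner_Fpol -ev2_bigF.
  rewrite ev2E FgC !hornerM.
  have := meval_homogenize b (C20 a0) (z := vec3 t (s + b * t) 1) (oner_neq0 _).
  rewrite C0' meval0 /= expr1n mul1r !divr1 addrK => <-.
  by rewrite mulr0.
move=> a1 a2; apply/eqP; rewrite -subr_eq0; apply/eqP.
have X2: 'X_2 != 0 :> {mpoly K[3]} by rewrite -msize_poly_eq0 msizeX.
(* The factorization is available in the chart [z 2 != 0] only; the factor ['X_2] covers the
   remaining points. *)
apply: (mulfI X2); rewrite mulr0; apply: mpoly_eq_meval => z.
rewrite mevalM mevalXU meval0.
have [->|z2] := eqVneq (z 2) 0; first by rewrite mul0r.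
have FE a : (F a).@[z] = z 2 ^+ m *
    (g.[(z 0 / z 2)%:P].[(z 1 - b * z 0) / z 2] *
     (C2 a).[(z 0 / z 2)%:P].[(z 1 - b * z 0) / z 2]).
  rewrite -!hornerM -FgC -ev2E ev2_bigF horner_Fpol -(meval_dhomog _ _ (Fhom a)).
  apply: meval_eq => i; rewrite /vec3; case: i => [[|[|[]]]] //= *.
  - by rewrite mulrC divfK //; congr z; apply: val_inj.
  - rewrite mulrA -mulrDl subrK mulrC divfK //; congr z; exact: val_inj.
  by rewrite mulr1; congr z; apply: val_inj.
rewrite mevalB !mevalM !FE !(meval_homogenize _ (C20 _)) //.
by ring.
Qed.

End DegreeBound.

(** * Points of a circle outside a finite set *)

Section Circle.
Variable K : numClosedFieldType.

(** The Cayley transforms [(1 + i k) / (1 - i k)] of the natural numbers [k], scaled by [sqrtC r],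
    are infinitely many points of the circle. *)
Lemma circle_nonroot (r : K) (P : {poly K}) : 0 < r -> P != 0 ->
  exists s, s * s^* = r /\ P.[s] != 0.
Proof.
move=> r0 P0; pose c (k : nat) : K := 'i * k%:R.
have cJ k : (c k)^* = - c k by rewrite rmorphM /= conjCi conjC_nat mulNr.
have n1 k : (1 + c k) * (1 - c k) != 0.
  have -> : (1 + c k) * (1 - c k) = 1 - 'i ^+ 2 * k%:R ^+ 2 by rewrite /c; ring.
  rewrite sqrCi mulN1r opprK.
  by rewrite lt0r_neq0 // ltr_pwDl ?ltr01 // exprn_ge0.
have nc k : 1 - c k != 0 by have := n1 k; rewrite mulf_eq0 => /norP[].
pose u k := sqrtC r * ((1 + c k) / (1 - c k)).
have r1: sqrtC r != 0 by rewrite sqrtC_eq0 lt0r_neq0.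
have uj: injective u.
  move=> i j /(mulfI r1)/eqP; rewrite eqr_div // => /eqP E.
  have: 2%:R * (c i - c j) = 0.
    have -> : 2%:R * (c i - c j) = (1 + c i) * (1 - c j) - (1 + c j) * (1 - c i) by ring.
    by rewrite E subrr.
  move/eqP; rewrite mulf_eq0 pnatr_eq0 /= subr_eq0 => /eqP/(mulfI (neq0Ci _))/eqP.
  by rewrite eqr_nat => /eqP.
have: ~~ all (root P) [seq u i | i <- iota 0 (size P)].
  apply/negP => ro; suff: uniq [seq u i | i <- iota 0 (size P)].
    by move/(max_poly_roots P0 ro); rewrite size_map size_iota ltnn.
  by rewrite map_inj_uniq ?iota_uniq.
case/allPn => x /mapP[k _ ->] Px; exists (u k); split=> //.
have sr: (sqrtC r)^* = sqrtC r by apply/CrealP; rewrite ger0_real // sqrtC_ge0 ltW.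
rewrite /u !rmorphM fmorphV rmorphD rmorphB /= rmorph1 sr !cJ opprK.
have [nc1 nc2] : 1 + c k != 0 /\ 1 - c k != 0.
  by have := n1 k; rewrite mulf_eq0 => /norP[].
rewrite -[RHS]sqrtCK; field.
by rewrite nc1 nc2.
Qed.

End Circle.

(** * Rank of the pairing on the sphere *)

Section Hermitian.
Variables (K : numClosedFieldType) (n m : nat) (F : 'I_n -> {mpoly K[3]}).
Variable sg : 'I_n -> bool.
Hypothesis Fhom : forall a, F a \is m.-homog.
Hypothesis Ffree : forall c : 'I_n -> K, \sum_a c a *: F a = 0 -> forall a, c a = 0.

(** With this choice the sum of the [F a] at [z] times the [dualF a] at [w] is the polarized
    Hermitian form. *)
Definition dualF a : {mpoly K[3]} := (-1) ^+ sg a *: map_mpoly Num.conj (F a).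

Hypothesis FG : forall z w : 'I_3 -> K,
  z 0 * w 0 + z 1 * w 1 = z 2 * w 2 -> \sum_a (F a).@[z] * (dualF a).@[w] = 0.

Local Notation Phi b s := (coef_rows m.+1 (Fpol F b s)).
Local Notation Hx b s t := (coef_rows m.+1 (Gpol dualF b s t)).

Lemma meval_dualF a w : (dualF a).@[w] = (-1) ^+ sg a * ((F a).@[fun i => (w i)^*])^*.
Proof.
rewrite mevalZ; congr (_ * _).
have -> : (map_mpoly Num.conj (F a)).@[w] = mmap Num.conj w (F a).
  apply: (@rmorph_mmap _ K {mpoly K[3]} K (meval w)) => [c|i] /=.
    by rewrite mevalC.
  by rewrite mevalXU.
apply/esym; apply: (@rmorph_mmap _ K K K Num.conj) => //= i.
by rewrite conjCK.
Qed.

Lemma dualF_homog a : dualF a \is m.-homog.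
Proof.
apply: dhomogZ; apply/dhomogP => mm; rewrite mcoeff_msupp mcoeff_map_mpoly conjC_eq0.
by rewrite -mcoeff_msupp; apply/dhomogP.
Qed.

(* (t, s + b t, 1) is proportional to the conjugate of (- b, 1, s). *)
Lemma sphere_radical b s t (X : 'rV[K]_n) : s * s^* = 1 + b * b^* -> t = - (b^* / s^*) ->
  X *m (Hx b s t)^T = 0 -> Phi b s *m \col_a ((-1) ^+ sg a * (X 0 a)^*) = 0.
Proof.
move=> ss tE XH; apply/coef_rows_mul_eq0; first by move=> a; apply: size_Fpol.
set q := \sum_a _.
have ss0: s * s^* != 0.
  by rewrite ss lt0r_neq0 // ltr_pwDl ?ltr01 // mul_conjC_ge0.
have [s0 sJ0] : s != 0 /\ s^* != 0 by move: ss0; rewrite mulf_eq0 => /norP[].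
have XG x : \sum_a X 0 a * (Gpol dualF b s t a).[x] = 0.
  have /coef_rows_mul_eq0 : Hx b s t *m X^T = 0.
    by apply: trmx_inj; rewrite trmx_mul trmxK trmx0.
  move=> /(_ (fun a => size_Gpol dualF_homog b s t a))/(congr1 (horner^~ x)).
  rewrite horner_sum horner0 => E; rewrite -[RHS]E.
  by apply: eq_bigr => a _; rewrite hornerZ mxE.
have lin0: s%:P + b *: 'X != 0.
  apply: contraNneq s0 => /(congr1 (horner^~ 0)).
  by rewrite !(hornerE, mulr0, addr0) => ->.
(* The extra factor disposes of a parameter with [y = 0], where the conjugate point used below is
   undefined. *)
apply/eqP; suff: q * (s%:P + b *: 'X) == 0 by rewrite mulf_eq0 (negPf lin0) orbF.
apply/eqP/poly_horner_eq => t'; rewrite horner0 hornerM.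
have -> : (s%:P + b *: 'X).[t'] = s + b * t' by rewrite !hornerE.
set y := s + b * t'; have [->|y0] := eqVneq y 0; first by rewrite mulr0.
suff -> : q.[t'] = 0 by rewrite mul0r.
have yJ0: y^* != 0 by rewrite conjC_eq0.
apply/eqP; rewrite -conjC_eq0; apply/eqP.
(* Divided by its second coordinate, the conjugate of [(t', y, 1)] is the point of the dual line
   with parameter [b + t'^* / y^*]. *)
rewrite -[RHS](mulr0 (y^* ^+ m)) -(XG (b + t'^* / y^*)) mulr_sumr /q horner_sum rmorph_sum;
  apply: eq_bigr => a _.
rewrite hornerZ mxE /= !rmorphM /= rmorphXn rmorphN rmorph1 conjCK.
rewrite horner_Fpol horner_Gpol meval_dualF -/y.
suff -> : (F a).@[vec3 t' y 1] = y ^+ m *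
    (F a).@[fun i => (vec3 (b + t'^* / y^* - b) 1 (s + t * (b + t'^* / y^*)) i)^*].
  by rewrite rmorphM rmorphXn /=; ring.
have E2: s + t * (b + t'^* / y^*) = (y^*)^-1.
  apply: (mulIf (mulf_neq0 sJ0 yJ0)).
  have -> : (s + t * (b + t'^* / y^*)) * (s^* * y^*) =
      s * s^* * y^* - b^* * (b * y^* + t'^*) by rewrite tE; field; rewrite sJ0 yJ0.
  rewrite ss [y^*^-1 * _]mulrCA mulVf // mulr1 /y rmorphD rmorphM /=; ring.
rewrite -(meval_dhomog _ _ (Fhom a)); apply: meval_eq => i.
rewrite /vec3 E2; case: i => [[|[|i]]] _ /=.
- by rewrite [b + _]addrC addrK rmorphM /= fmorphV /= !conjCK mulrC divfK.
- by rewrite rmorph1 mulr1.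
by rewrite fmorphV /= conjCK mulfV.
Qed.

(** For fixed [b] the rank condition fails for finitely many [s] only, and the circle
    [|s|^2 = 1 + |b|^2] is infinite. *)
Lemma exists_sphere_point r : (exists b s, r <= \rank (Phi b s))%N ->
  exists b s, s * s^* = 1 + b * b^* /\ (r <= \rank (Phi b s))%N.
Proof.
move=> [b [s rs]].
have lPhi i a : lpoly (fun s : K^o => Phi b s i a).
  have l1 : lpoly (fun s : K^o => s : K).
    by move=> x y; exists (x%:P + y *: 'X) => c; rewrite !hornerE /= [c *: _]mulrC.
  by apply: lpoly_coef_rows => {}a; apply: clpoly_Fpol; [exact: lpolyC | exact: l1].
have [d [ld ds dP]] := @lpoly_mxrank K K^o _ _ (fun s => Phi b s) s r lPhi rs.
have [P PE] := ld 0 1.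
have P0: P != 0.
  by apply: contraNneq ds => P0; have := PE s; rewrite P0 horner0 add0r [_ *: _]mulr1 => ->.
have r0: 0 < 1 + b * b^* by rewrite ltr_pwDl ?ltr01 // mul_conjC_ge0.
have [s1 [s1E Ps1]] := circle_nonroot r0 P0.
exists b, s1; split=> //; apply: dP.
by move: Ps1; rewrite -PE add0r [_ *: _]mulr1.
Qed.

(** At these parameters a vector of the span killed by the pairing is orthogonal to the whole span
    for the Hermitian form with signs [sg]. Such vectors therefore form an isotropic space. *)
Lemma sphere_cap_isotropic b s t (X Y : 'rV[K]_n) :
  s * s^* = 1 + b * b^* -> t = - (b^* / s^*) ->
  (X <= Phi b s :&: kermx (Hx b s t)^T)%MS -> (Y <= Phi b s)%MS ->
  \sum_a Y 0 a * ((-1) ^+ sg a * (X 0 a)^*) = 0.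
Proof.
move=> ss tE; rewrite sub_capmx => /andP[_ /sub_kermxP XH] /submxP[D ->].
have := sphere_radical ss tE XH => /(congr1 (mulmx D)).
rewrite mulmxA mulmx0 => /matrixP/(_ 0 0); rewrite [LHS]mxE [RHS]mxE => E.
by rewrite -[RHS]E; apply: eq_bigr => a _; congr (_ * _); rewrite [RHS]mxE.
Qed.

(** At a point of the sphere the rank of the pairing is that of the span minus that of the isotropic
    space [U]. With a single sign of one kind, [U] has dimension at most 1. For [n <= 4] a larger
    [U] leaves only [k = 1] to be treated, and there a nonzero pairing is found elsewhere by
    independence of the forms. *)
Lemma rank_pairing k : (0 < n)%N ->
  (n <= 4)%N \/ (exists j0, forall a, a != j0 -> sg a = ~~ sg j0) ->
  (exists b s, k < \rank (Phi b s))%N ->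
  exists b s t, (k <= \rank (Phi b s *m (Hx b s t)^T))%N.
Proof.
move=> n0 sgn rk.
have [b [s [ss rs]]] := exists_sphere_point rk.
pose t := - (b^* / s^*).
have [cap1|] := leqP (\rank (Phi b s :&: kermx (Hx b s t)^T)%MS) 1.
  exists b, s, t; rewrite -ltnS -[X in (_ < X)%N]addn1; apply: leq_trans rs _.
  by rewrite -(mxrank_mul_ker (Phi b s) (Hx b s t)^T) leq_add2l.
set U := (_ :&: _)%MS => rU.
case: sgn => [n4|[j0 sgj]]; last first.
  suff: (\rank U <= 1)%N by rewrite leqNgt rU.
  (* On the hyperplane where coordinate [j0] vanishes the form is definite, so that [U] meets it
     only in 0. *)
  pose B : 'cV[K]_n := delta_mx j0 0.
  rewrite -(mxrank_mul_ker _ B); apply: (@leq_trans (1 + 0)); last by [].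
  apply: leq_add; first exact: rank_leq_col.
  rewrite leqn0 mxrank_eq0; apply/eqP/row_matrixP => i; rewrite row0.
  have := row_sub i (U :&: kermx B)%MS; set v := row i _.
  rewrite sub_capmx => /andP[vU /sub_kermxP vB].
  have vj : v 0 j0 = 0.
    by have := congr1 (fun M : 'M_1 => M 0 0) vB; rewrite -colE !mxE.
  have := sphere_cap_isotropic ss erefl vU (submx_trans vU (capmxSl _ _)).
  have -> : \sum_a v 0 a * ((-1) ^+ sg a * (v 0 a)^*) =
      (-1) ^+ (~~ sg j0) * \sum_a v 0 a * (v 0 a)^*.
    rewrite mulr_sumr; apply: eq_bigr => a _.
    have [->|aj] := eqVneq a j0; first by rewrite vj !mul0r mulr0.
    by rewrite sgj // mulrCA.
  move/eqP; rewrite mulf_eq0 signr_eq0 /= psumr_eq0 => [/allP v0|a _]; last exact: mul_conjC_ge0.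
  apply/rowP => a; rewrite [RHS]mxE.
  by have := v0 a (mem_index_enum _); rewrite mul_conjC_eq0 => /eqP.
case: k rk rs => [|k] rk rs; first by exists 0, 0, 0.
(* For [k >= 2] dimensions exclude this: a span of dimension at least 3 and a space of dimension at
   least 2 orthogonal to it do not fit in [n <= 4]. *)
case: k rk rs => [|k] rk rs; last first.
  exfalso; pose UE := \matrix_(i, a) ((-1) ^+ sg a * (U i a)^*).
  have UU: Phi b s *m UE^T = 0.
    apply/matrixP => i j; rewrite [LHS]mxE [RHS]mxE.
    have := sphere_cap_isotropic ss erefl (row_sub j U) (row_sub i (Phi b s)).
    move=> E; rewrite -[RHS]E; apply: eq_bigr => a _.
    by rewrite [row i _ _ _]mxE [row j _ _ _]mxE [UE^T _ _]mxE [UE _ _]mxE.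
  have UEE: UE = map_mx Num.conj U *m diag_mx (\row_a (-1) ^+ sg a).
    by apply/matrixP => i a; rewrite mul_mx_diag !mxE mulrC.
  have rUE: \rank UE = \rank U.
    rewrite UEE mxrankMfree ?mxrank_map // row_free_unit unitmxE det_diag.
    by rewrite unitfE prodf_seq_neq0; apply/allP => a _; rewrite mxE signr_eq0.
  have := mulmx0_rank_max UU; rewrite mxrank_tr rUE => H.
  have := leq_trans (leq_trans (leq_add rs rU) H) n4.
  by rewrite addn2.
(* There remains [k = 1]. If all pairings vanished, [F] at any [z] would be orthogonal to [dualF] at
   any [w], incident or not. *)
apply: contrapT => H0.
have FGE z1 z2 w1 w3 : \sum_a (F a).@[vec3 z1 z2 1] * (dualF a).@[vec3 w1 1 w3] = 0.
  (* With these parameters [z] lies on the line, and [w] is the point [x = 1] of the dual line. *)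
  pose b' := 1 - w1; pose s' := z2 - b' * z1; pose t' := w3 - s'.
  have M0: Phi b' s' *m (Hx b' s' t')^T = 0.
    apply/eqP; rewrite -mxrank_eq0 -leqn0 leqNgt; apply/negP => H1.
    by apply: H0; exists b', s', t'.
  have := row_horner z1 (size_Fpol Fhom b' s').
  have := row_horner 1 (size_Gpol dualF_homog b' s' t').
  set u := \row_a _ => uE; set v := \row_a _ => vE.
  have : v *m u^T = 0.
    by rewrite uE vE trmx_mul mulmxA -(mulmxA _ (Phi _ _)) M0 mulmx0 mul0mx.
  move=> /matrixP/(_ 0 0); rewrite !mxE => E; rewrite -[RHS]E.
  have [e1 [e2 e3]] : s' + b' * z1 = z2 /\ 1 - b' = w1 /\ s' + t' * 1 = w3.
    by rewrite /t' /s' /b'; split; [|split]; ring.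
  by apply: eq_bigr => a _; rewrite !mxE horner_Fpol horner_Gpol e1 e2 e3.
pose a0 := Ordinal n0.
have Fa0: F a0 != 0.
  apply/eqP => F0; have := Ffree (c := fun a => (a == a0)%:R).
  rewrite (bigD1 a0) //= F0 scaler0 add0r big1 => [|a /negPf ->]; last by rewrite scale0r.
  by move=> /(_ erefl a0)/eqP; rewrite eqxx oner_eq0.
have [x [y [x0 y0]]] := dhomog_chart (Fhom a0) Fa0; apply/negP; rewrite negbK.
(* Independence of the [F a] turns orthogonality to all values of [F] into the vanishing of every
   [dualF a]. *)
have dF0 w1 w3 : forall a, (dualF a).@[vec3 w1 1 w3] = 0.
  apply: Ffree; apply/eqP/negPn/negP => S0.
  have Sh: \sum_a (dualF a).@[vec3 w1 1 w3] *: F a \is m.-homog.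
    by apply: rpred_sum => a _; apply: dhomogZ.
  have [z1 [z2 [_ _]]] := dhomog_chart Sh S0; rewrite raddf_sum /=.
  have := FGE z1 z2 w1 w3 => E; rewrite -[X in _ != X]E => /eqP; apply.
  by apply: eq_bigr => a _; rewrite mevalZ mulrC.
have := dF0 (x / y)^* (y^-1)^* a0; rewrite meval_dualF => /eqP.
rewrite mulf_eq0 signr_eq0 conjC_eq0 /= => /eqP E.
have -> : (F a0).@[vec3 x y 1] = y ^+ m * (F a0).@[fun i => (vec3 (x / y)^* 1 (y^-1)^* i)^*].
  rewrite -(meval_dhomog _ _ (Fhom a0)); apply: meval_eq => i.
  rewrite /vec3; case: i => [[|[|i]]] _ /=; rewrite ?rmorph1 ?conjCK.
  - by rewrite mulrC divfK.
  - by rewrite mulr1.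
  by rewrite mulfV.
by rewrite E mulr0.
Qed.

Theorem hermitian_degree_bound : (0 < n)%N ->
  (n <= 4)%N \/ (exists j0, forall a, a != j0 -> sg a = ~~ sg j0) ->
  exists d C, [/\ (d <= 'C(n.-1, 2))%N, forall a, C a \is d.-homog,
    exists a : 'I_n, C a != 0 & proportional F C].
Proof.
move=> n0 sgn; apply: (degree_bound Fhom dualF_homog FG).
  exists (Ordinal n0); apply/eqP => F0.
  have := Ffree (c := fun a => (a == Ordinal n0)%:R).
  rewrite (bigD1 (Ordinal n0)) //= F0 scaler0 add0r big1 => [|a /negPf ->]; last by rewrite scale0r.
  by move=> /(_ erefl (Ordinal n0))/eqP; rewrite eqxx oner_eq0.
by move=> k _; apply: rank_pairing.
Qed.

End Hermitian.

(** * Signature and Sylvester's law of inertia *)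

Section Inertia.
Variable K : numClosedFieldType.

Lemma char_poly_diag_similar k (P M : 'M[K]_k) (D : 'rV_k) : P \in unitmx ->
  M = invmx P *m diag_mx D *m P -> char_poly M = \prod_(i < k) ('X - (D 0 i)%:P).
Proof.
move=> Pu ->; transitivity (char_poly (diag_mx D)); last first.
  rewrite char_poly_trig ?diag_mx_is_trig //.
  by apply: eq_bigr => i _; rewrite mxE eqxx.
rewrite /char_poly.
have -> : char_poly_mx (invmx P *m diag_mx D *m P) =
    map_mx polyC (invmx P) *m char_poly_mx (diag_mx D) *m map_mx polyC P.
  rewrite /char_poly_mx !map_mxM mulmxBr mulmxBl; congr (_ - _).
  by rewrite scalar_mxC -mulmxA -map_mxM mulVmx // map_mx1 mulmx1.
rewrite !det_mulmx mulrAC -det_mulmx -map_mxM mulVmx // map_mx1.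
by rewrite det1 mul1r.
Qed.

(** With more positive [D] than positive [E], some nonzero [x] has [Y] coordinates supported on the
    positive [D] and [Z] coordinates vanishing on the positive [E]; one expression of the form is
    then positive and the other is not. Fullness of [Y] lets the first coordinates be prescribed. *)
Lemma inertia_le k m1 m2 (Y : 'M[K]_(k, m1)) (Z : 'M[K]_(k, m2))
    (D : 'I_m1 -> K) (E : 'I_m2 -> K) : row_full Y ->
  (forall a, E a \is Num.real) ->
  (forall x : 'rV_k, \sum_i D i * `|(x *m Y) 0 i| ^+ 2 = \sum_a E a * `|(x *m Z) 0 a| ^+ 2) ->
  (#|[pred i | (0 < D i)%R]| <= #|[pred a | (0 < E a)%R]|)%N.
Proof.
move=> /row_fullP[Y' Y'Y] Er DE; rewrite leqNgt; apply/negP => lt.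
set T := [pred a | (0 < E a)%R] in lt; set S := [pred i | (0 < D i)%R] in lt.
pose f (j : 'I_#|S|) : 'I_m1 := enum_val j; pose g (j : 'I_#|T|) : 'I_m2 := enum_val j.
have fS j : 0 < D (f j) by have := enum_valP j.
pose N := colsub g (rowsub f Y' *m Z).
have : kermx N != 0.
  rewrite kermx_eq0 /row_free; apply: contraTneq lt => <-.
  by rewrite -leqNgt rank_leq_col.
case/rowV0Pn => c /sub_kermxP cN c0.
pose x := c *m rowsub f Y'.
have xY : x *m Y = c *m rowsub f 1%:M by rewrite /x -mulmxA mul_rowsub_mx Y'Y.
have xYf j : (x *m Y) 0 (f j) = c 0 j.
  rewrite xY mxE (bigD1 j) //= !mxE eqxx mulr1 big1 ?addr0 // => h hj.
  rewrite !mxE; case: eqP => [/enum_val_inj E'|]; last by rewrite mulr0.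
  by rewrite E' eqxx in hj.
have xYn i : i \notin S -> (x *m Y) 0 i = 0.
  move=> iS; rewrite xY mxE big1 // => h _; rewrite !mxE.
  case: eqP => [E'|]; last by rewrite mulr0.
  by move: iS; rewrite -E' inE fS.
have xZ a : a \in T -> (x *m Z) 0 a = 0.
  move=> aT; have := congr1 (fun M : 'rV_#|T| => M 0 (enum_rank_in aT a)) cN.
  by rewrite /N mulmx_colsub mulmxA -/x [LHS]mxE [RHS]mxE /g enum_rankK_in.
have sum0 : \sum_i D i * `|(x *m Y) 0 i| ^+ 2 = 0.
  apply/eqP; rewrite eq_le; apply/andP; split; last first.
    apply: sumr_ge0 => i _; have [iS|iS] := boolP (i \in S).
      by rewrite mulr_ge0 ?exprn_ge0 // ltW.
    by rewrite xYn // normr0 expr0n mulr0.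
  rewrite DE; apply: sumr_le0 => a _; have [aT|aT] := boolP (a \in T).
    by rewrite xZ // normr0 expr0n mulr0.
  rewrite mulr_le0_ge0 ?exprn_ge0 //.
  by have := Er a; rewrite realE => /orP[|//]; rewrite le_eqVlt eq_sym => /orP[/eqP ->|] //;
    move: aT; rewrite inE => /negPf ->.
case/eqP: c0; apply/rowP => j; rewrite [RHS]mxE -xYf.
move/eqP: sum0; rewrite psumr_eq0 => [/allP/(_ (f j))|i _]; last first.
  have [iS|iS] := boolP (i \in S); first by rewrite mulr_ge0 ?exprn_ge0 // ltW.
  by rewrite xYn // normr0 expr0n mulr0.
rewrite mem_index_enum => /(_ isT); rewrite mulf_eq0 (gt_eqF (fS j)) /=.
by rewrite expf_eq0 /= normr_eq0 => /eqP.
Qed.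

Lemma inertia_eq k m1 m2 (Y : 'M[K]_(k, m1)) (Z : 'M[K]_(k, m2))
    (D : 'I_m1 -> K) (E : 'I_m2 -> K) : row_full Y -> row_full Z ->
  (forall i, D i \is Num.real) -> (forall a, E a \is Num.real) ->
  (forall x : 'rV_k, \sum_i D i * `|(x *m Y) 0 i| ^+ 2 = \sum_a E a * `|(x *m Z) 0 a| ^+ 2) ->
  #|[pred i | (0 < D i)%R]| = #|[pred a | (0 < E a)%R]| /\
  #|[pred i | (D i < 0)%R]| = #|[pred a | (E a < 0)%R]|.
Proof.
move=> fY fZ rD rE DE.
have cN m (B : 'I_m -> K) : #|[pred i | (B i < 0)%R]| = #|[pred i | (0 < - B i)%R]|.
  by apply: eq_card => i; rewrite !inE oppr_gt0.
have DEN (x : 'rV_k) :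
    \sum_i - D i * `|(x *m Y) 0 i| ^+ 2 = \sum_a - E a * `|(x *m Z) 0 a| ^+ 2.
  under eq_bigr => i _ do rewrite mulNr.
  under [RHS]eq_bigr => i _ do rewrite mulNr.
  by rewrite !sumrN DE.
split; apply/eqP; rewrite eqn_leq; apply/andP; split.
- exact: (inertia_le fY rE DE).
- by apply: (inertia_le fZ rD) => x; apply/esym/DE.
- by rewrite !cN; apply: (inertia_le fY _ DEN) => a; rewrite rpredN.
by rewrite !cN; apply: (inertia_le fZ) => [a|x]; [rewrite rpredN | apply/esym/DEN].
Qed.

End Inertia.

(** * Hermitian sums of squares *)

Section HermitianSum.
Variables (R : realType) (n : nat).
Local Notation K := R[i].
Implicit Types (f g : {mpoly K[n]}) (p : {mpoly K[n + n]}) (al be : 'X_{1..n}).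

Definition zlift f : {mpoly K[n + n]} := mmap (@mpolyC (n + n) K) (@zvar R n) f.
(** The coefficients are conjugated, so that at the conjugate of [z] the value is the conjugate of
    [f.@[z]], and [zlift f * wlift f] polarizes the squared modulus of [f]. *)
Definition wlift f : {mpoly K[n + n]} :=
  mmap (@mpolyC (n + n) K \o Num.conj) (@wvar R n) f.

HB.instance Definition _ :=
  GRing.RMorphism.copy zlift (mmap (@mpolyC (n + n) K) (@zvar R n)).
HB.instance Definition _ :=
  GRing.RMorphism.copy wlift (mmap (@mpolyC (n + n) K \o Num.conj) (@wvar R n)).

Lemma mjoinl al be i : mjoin al be (lshift n i) = al i.
Proof. by rewrite mnmE (unsplitK (inl i)). Qed.

Lemma mjoinr al be i : mjoin al be (rshift n i) = be i.
Proof. by rewrite mnmE (unsplitK (inr i)). Qed.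

Lemma mjoin_inj al be al' be' : mjoin al be = mjoin al' be' -> al = al' /\ be = be'.
Proof.
move=> E; split; apply/mnmP => i; first by rewrite -(mjoinl al be) E mjoinl.
by rewrite -(mjoinr al be) E mjoinr.
Qed.

Lemma mjoin_surj (m : 'X_{1..n + n}) : exists al be, m = mjoin al be.
Proof.
exists [multinom m (lshift n i) | i < n], [multinom m (rshift n i) | i < n].
apply/mnmP => i; rewrite mnmE.
by case: (split_ordP i) => j ->; rewrite ?(unsplitK (inl j)) ?(unsplitK (inr j)) mnmE.
Qed.

Lemma mdeg_mjoin al be : mdeg (mjoin al be) = (mdeg al + mdeg be)%N.
Proof.
rewrite !mdegE big_split_ord; congr (_ + _)%N; apply: eq_bigr => i _.
  by rewrite mjoinl.
by rewrite mjoinr.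
Qed.

Lemma hcoefP p q : (forall al be, hcoef p al be = hcoef q al be) -> p = q.
Proof.
by move=> pq; apply/mpolyP => m; have [al [be ->]] := mjoin_surj m; apply: pq.
Qed.

Lemma mpolyX_mjoin al be :
  'X_[mjoin al be] = mmap1 (@zvar R n) al * mmap1 (@wvar R n) be.
Proof.
rewrite mpolyXE_id big_split_ord /mmap1; congr (_ * _); apply: eq_bigr => i _.
  by rewrite mjoinl.
by rewrite mjoinr.
Qed.

Lemma hcoef_lift f g al be : hcoef (zlift f * wlift g) al be = f@_al * (g@_be)^*.
Proof.
rewrite /hcoef /zlift /wlift /mmap mulr_suml raddf_sum /=.
have E m : ((f@_m)%:MP * mmap1 (@zvar R n) m *
    \sum_(m' <- msupp g) ((g@_m')^*)%:MP * mmap1 (@wvar R n) m')@_(mjoin al be) =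
    f@_m * (m == al)%:R * (g@_be)^*.
  rewrite mulr_sumr raddf_sum /=.
  have E' m' : ((f@_m)%:MP * mmap1 (@zvar R n) m *
      (((g@_m')^*)%:MP * mmap1 (@wvar R n) m'))@_(mjoin al be)
      = f@_m * (m == al)%:R * ((g@_m')^* * (m' == be)%:R).
    rewrite mulrACA -mpolyCM -mpolyX_mjoin mcoeffCM mcoeffX.
    rewrite mulrACA -natrM mulnb; congr (_ * (nat_of_bool _)%:R).
    apply/eqP/andP => [/mjoin_inj[-> ->]|[/eqP -> /eqP ->]] //.
  under eq_bigr => m' _ do rewrite E'.
  rewrite -mulr_sumr; congr (_ * _).
  have [bg|bg] := boolP (be \in msupp g).
    rewrite (bigD1_seq be) ?msupp_uniq //= eqxx mulr1 big1 ?addr0 // => m' /negPf ->.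
    by rewrite mulr0.
  rewrite memN_msupp_eq0 // conjC0 big1_seq // => m' /andP[_ m'g].
  by case: eqP => [E''|]; [rewrite -E'' m'g in bg | rewrite mulr0].
under eq_bigr => m _ do rewrite E.
rewrite -mulr_suml; congr (_ * _).
have [af|af] := boolP (al \in msupp f).
  rewrite (bigD1_seq al) ?msupp_uniq //= eqxx mulr1 big1 ?addr0 // => m' /negPf ->.
  by rewrite mulr0.
rewrite [RHS]memN_msupp_eq0 // big1_seq // => m' /andP[_ m'g].
by case: eqP => [E''|]; [rewrite -E'' m'g in af | rewrite mulr0].
Qed.

Definition herm_sum N (sg : 'I_N -> bool) (F : 'I_N -> {mpoly K[n]}) :
    {mpoly K[n + n]} :=
  \sum_a (-1) ^+ sg a *: (zlift (F a) * wlift (F a)).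

Lemma hcoef_herm_sum N sg (F : 'I_N -> {mpoly K[n]}) al be :
  hcoef (herm_sum sg F) al be = \sum_a (-1) ^+ sg a * ((F a)@_al * ((F a)@_be)^*).
Proof.
rewrite /hcoef /herm_sum raddf_sum; apply: eq_bigr => a _.
by rewrite /= mcoeffZ; congr (_ * _); apply: hcoef_lift.
Qed.

Lemma herm_sum_sym N sg (F : 'I_N -> {mpoly K[n]}) : herm_sym (herm_sum sg F).
Proof.
move=> al be; rewrite !hcoef_herm_sum rmorph_sum; apply: eq_bigr => a _.
by rewrite !rmorphM /= rmorphXn rmorphN rmorph1 conjCK; congr (_ * _); rewrite mulrC.
Qed.

Lemma herm_sum_bihomog N sg (F : 'I_N -> {mpoly K[n]}) d :
  (forall a, F a \is d.-homog) -> bihomog d (herm_sum sg F).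
Proof.
move=> Fh al be; rewrite hcoef_herm_sum => H.
have H1 al' : (exists a, (F a)@_al' != 0) -> mdeg al' = d.
  by case=> a; rewrite -mcoeff_msupp ; move: al'; apply/dhomogP.
split; apply: H1; apply: contrapT => /forallNP H0; case/eqP: H; rewrite big1 // => a _.
  by have /negP := H0 a; rewrite negbK => /eqP ->; rewrite mul0r mulr0.
by have /negP := H0 a; rewrite negbK => /eqP ->; rewrite conjC0 !mulr0.
Qed.

Definition zw (z w : 'I_n -> K) (i : 'I_(n + n)) : K :=
  match split i with inl j => z j | inr j => w j end.

Lemma meval_zlift f z w : (zlift f).@[zw z w] = f.@[z].
Proof.
apply: (@rmorph_mmap _ K {mpoly K[n + n]} K (meval (zw z w))) => [c|i] /=.
  by rewrite mevalC.
by rewrite mevalXU /zw (unsplitK (inl i)).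
Qed.

Lemma meval_wlift f z w : (wlift f).@[zw z w] = (f.@[fun i => (w i)^*])^*.
Proof.
transitivity (mmap Num.conj w f).
  apply: (@rmorph_mmap _ K {mpoly K[n + n]} K (meval (zw z w))) => [c|i] /=.
    by rewrite mevalC.
  by rewrite mevalXU /zw (unsplitK (inr i)).
apply/esym; apply: (@rmorph_mmap _ K K K Num.conj) => //= i.
by rewrite conjCK.
Qed.

Lemma meval_herm_sum N sg (F : 'I_N -> {mpoly K[n]}) z w :
  (herm_sum sg F).@[zw z w] =
  \sum_a (-1) ^+ sg a * ((F a).@[z] * ((F a).@[fun i => (w i)^*])^*).
Proof.
rewrite (raddf_sum (meval (zw z w))); apply: eq_bigr => a _.
rewrite [LHS](mevalZ (zw z w)); congr (_ * _).
transitivity ((zlift (F a)).@[zw z w] * (wlift (F a)).@[zw z w]); first exact: mevalM.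
by congr (_ * _); [exact: meval_zlift | exact: meval_wlift].
Qed.

Lemma hevalE p z : heval p z = p.@[zw z (fun i => (z i)^*)].
Proof. by []. Qed.

Definition free_fam N (F : 'I_N -> {mpoly K[n]}) :=
  forall c : 'I_N -> K, \sum_a c a *: F a = 0 -> forall a, c a = 0.

(** Up to conjugation and signs, row [al] of the coefficient matrix is the combination of the forms
    weighted by their coefficients at [al]; independence makes these weights vanish. *)
Lemma herm_sum_coef0 N sg (F : 'I_N -> {mpoly K[n]}) al : free_fam F ->
  (forall be, hcoef (herm_sum sg F) al be = 0) -> forall a, (F a)@_al = 0.
Proof.
move=> Ff H a; apply/eqP; rewrite -conjC_eq0.
have := Ff (fun a => (-1) ^+ sg a * ((F a)@_al)^*) _ a => E.
have /eqP : (-1) ^+ sg a * ((F a)@_al)^* = 0; last by rewrite mulf_eq0 signr_eq0.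
apply: E; apply/mpolyP => be; rewrite mcoeff0 raddf_sum /=.
have := H be => /(congr1 Num.conj); rewrite conjC0 => E; rewrite -[RHS]E.
rewrite hcoef_herm_sum rmorph_sum; apply: eq_bigr => b _.
by rewrite mcoeffZ !rmorphM /= rmorphXn rmorphN rmorph1 conjCK mulrA.
Qed.

Lemma herm_sum_homog N sg (F : 'I_N -> {mpoly K[n]}) d : free_fam F ->
  bihomog d (herm_sum sg F) -> forall a, F a \is d.-homog.
Proof.
move=> Ff H a; apply/dhomogP => m; rewrite mcoeff_msupp => Fm /=.
apply: contrapT => md; case/eqP: Fm; apply: (herm_sum_coef0 (sg := sg)) => // be.
by apply/eqP/negPn/negP => /H[].
Qed.

End HermitianSum.

(** * Signature of a Hermitian sum, and diagonalization *)

Section Signature.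
Variables (R : realType) (n : nat).
Local Notation K := R[i].
Local Open Scope sesquilinear_scope.

Lemma form_diag k m (Y : 'M[K]_(k, m)) (D : 'I_m -> K) (x : 'rV_k) :
  (x *m (Y *m diag_mx (\row_i D i) *m Y^t*) *m x^t*) 0 0 =
  \sum_i D i * `|(x *m Y) 0 i| ^+ 2.
Proof.
have -> : x *m (Y *m diag_mx (\row_i D i) *m Y^t*) *m x^t* =
    (x *m Y) *m diag_mx (\row_i D i) *m (x *m Y)^t*.
  by rewrite trmx_mul map_mxM !mulmxA.
rewrite mxE; apply: eq_bigr => i _; rewrite mul_mx_diag !mxE normCK.
by rewrite mulrAC [RHS]mulrC mulrAC.
Qed.

Definition exponent (p : {mpoly K[n + n]}) (i : 'I_#|{: 'X_{1..n < msize p}}|) : 'X_{1..n} :=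
  bmnm (enum_val i).

Lemma exponent_surj (p : {mpoly K[n + n]}) al : (mdeg al < msize p)%N ->
  exists i, al = exponent (p := p) i.
Proof.
by move=> h; exists (enum_rank (BMultinom h)); rewrite /exponent enum_rankK.
Qed.

Lemma hcoef_large (p : {mpoly K[n + n]}) (al be : 'X_{1..n}) :
  (msize p <= mdeg al)%N \/ (msize p <= mdeg be)%N ->
  hcoef p al be = 0 :> K.
Proof.
move=> H; apply: memN_msupp_eq0; apply: msize_mdeg_ge; rewrite mdeg_mjoin.
by case: H => H; rewrite (leq_trans H) ?leq_addr ?leq_addl.
Qed.

Lemma coef_mx_hermsym (p : {mpoly K[n + n]}) : herm_sym p -> coef_mx p \is hermsymmx.
Proof.
move=> ph; apply/is_hermitianmxP; rewrite expr0 scale1r.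
by apply/matrixP => i j; rewrite !mxE ph.
Qed.

Lemma eigenvalues_spectral k (M : 'M[K]_k) (Q : pred K) : M \is normalmx ->
  count Q (eigenvalues M) = #|[pred i | Q (spectral_diag M 0 i)]|.
Proof.
move=> /orthomx_spectralP ME; rewrite /eigenvalues.
case: closed_field_poly_normal => /= s; rewrite (monicP (char_poly_monic M)) scale1r.
rewrite (char_poly_diag_similar (spectral_unit M) ME).
rewrite -(big_enum _ _ predT) /= -(big_map (fun i => spectral_diag M 0 i)
  predT (fun x => 'X - x%:P)).
move/prod_XsubC_eq/seq.permP => <-; rewrite count_map -size_filter cardE.
by rewrite [in RHS]/enum_mem -enumT.
Qed.

Lemma spectral_form k (M : 'M[K]_k) : M \is normalmx ->
  M = (spectralmx M)^t* *m diag_mx (\row_i spectral_diag M 0 i) *m (spectralmx M)^t*^t*.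
Proof.
move=> /orthomx_spectralP {1}->; rewrite invmx_unitary ?spectral_unitarymx // trmxCK.
by congr (_ *m diag_mx _ *m _); apply/rowP => i; rewrite mxE.
Qed.

(** The coefficient matrix is congruent to a diagonal of signs through the full-rank matrix of
    coefficients of the [F a], and to its eigenvalues through a unitary matrix; Sylvester's law
    compares the two. *)
Lemma signature_herm_sum N sg (F : 'I_N -> {mpoly K[n]}) : free_fam F ->
  signature_pair (herm_sum sg F) = (#|[pred a | ~~ sg a]|, #|[pred a | sg a]|).
Proof.
move=> Ff; rewrite /signature_pair; set p := herm_sum sg F; set M := coef_mx p.
have Mh : M \is hermsymmx by apply/coef_mx_hermsym/herm_sum_sym.
have Mn := hermitian_normalmx Mh.
pose V : 'M[K]_(N, _) := \matrix_(a, i) (F a)@_(exponent (p := p) i).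
have ME : M = V^T *m diag_mx (\row_a (-1) ^+ sg a) *m V^T^t*.
  apply/matrixP => i j; rewrite [LHS]mxE hcoef_herm_sum [RHS]mxE.
  apply: eq_bigr => a _; rewrite mul_mx_diag !mxE mulrCA mulrA.
  by congr (_ * _); rewrite mulrC.
have fV : row_full V^T.
  rewrite /row_full mxrank_tr; apply/row_freeP; apply/row_freeP.
  rewrite -kermx_eq0; apply/rowV0P => c /sub_kermxP cV.
  apply/rowP => a; rewrite [RHS]mxE; move: a; apply: (Ff).
  apply/mpolyP => m; rewrite mcoeff0 raddf_sum /=.
  have [h|h] := ltnP (mdeg m) (msize p).
    have [i ->] := exponent_surj h.
    have := congr1 (fun u : 'rV_ _ => u 0 i) cV; rewrite [LHS]mxE [RHS]mxE => E.
    by rewrite -[RHS]E; apply: eq_bigr => a _; rewrite mcoeffZ [V _ _]mxE.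
  (* Exponents beyond the range of the matrix have zero coefficient in every [F a], so that
     independence is visible on the range alone. *)
  rewrite big1 // => a _; rewrite mcoeffZ (herm_sum_coef0 (sg := sg) Ff) ?mulr0 // => be.
  by rewrite -/p; apply: hcoef_large; left.
have fY : row_full ((spectralmx M)^t*).
  by rewrite row_full_unit -invmx_unitary ?spectral_unitarymx // unitmx_inv spectral_unit.
have rD i : spectral_diag M 0 i \is Num.real.
  by have /mxOverP := hermitian_spectral_diag_real Mh.
have rE a : (-1) ^+ sg a \is @Num.real K by rewrite rpredX // rpredN rpred1.
have := @inertia_eq K _ _ _ _ _ _ _ fY fV rD rE.
case=> [x|E1 E2]; first by rewrite -!form_diag -ME -spectral_form.
rewrite !eigenvalues_spectral // E1 E2; congr pair; apply: eq_card => a; rewrite !inE.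
  by case: (sg a); rewrite ?expr0 ?ltr01 // expr1 ltr0N1.
by case: (sg a); rewrite ?expr0 ?expr1 ?ltrN10 // ltr10.
Qed.

(** Spectral theorem: zero eigenvalues are dropped, and each remaining eigenvector is scaled by the
    square root of the modulus of its eigenvalue, which leaves only a sign. *)
Lemma herm_sumP (p : {mpoly K[n + n]}) : herm_sym p ->
  exists N sg F, @free_fam R n N F /\ p = herm_sum sg F.
Proof.
move=> ph; pose M := coef_mx p.
have Mh : M \is hermsymmx by apply/coef_mx_hermsym.
have Mn := hermitian_normalmx Mh.
pose D i := spectral_diag M 0 i; pose P := spectralmx M.
have /mxOverP rD0 := hermitian_spectral_diag_real Mh.
have rD i : D i \is Num.real := rD0 0 i.
pose S := [pred i | D i != 0].
pose f (a : 'I_#|S|) := enum_val a.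
have fD a : D (f a) != 0 by have := enum_valP a; rewrite inE.
pose r a : K := sqrtC `|D (f a)|.
have rr a : r a * (r a)^* = `|D (f a)|.
  have /CrealP -> : r a \is Num.real by rewrite ger0_real // sqrtC_ge0.
  by rewrite -expr2 sqrtCK.
have r0 a : r a != 0 by rewrite sqrtC_eq0 normr_eq0.
pose F a : {mpoly K[n]} := \sum_i (r a * (P (f a) i)^*) *: 'X_[exponent i].
have Fi a i : (F a)@_(exponent i) = r a * (P (f a) i)^*.
  rewrite raddf_sum (bigD1 i) //= mcoeffZ mcoeffX eqxx mulr1 big1 ?addr0 // => j ji.
  rewrite mcoeffZ mcoeffX; case: eqP => [/val_inj/enum_val_inj E|]; last by rewrite mulr0.
  by rewrite E eqxx in ji.
have Fn a m : (msize p <= mdeg m)%N -> (F a)@_m = 0.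
  move=> h; rewrite raddf_sum /= big1 // => i _; rewrite mcoeffZ mcoeffX.
  case: eqP => [E|]; last by rewrite mulr0.
  by move: h; rewrite -E leqNgt /exponent bmdeg.
exists #|S|, (fun a => D (f a) < 0), F; split.
  move=> c cF a.
  pose c' := \row_a (c a * r a).
  have c'P : c' *m rowsub f (map_mx Num.conj P) = 0.
    apply/rowP => i; rewrite [LHS]mxE [RHS]mxE.
    have := congr1 (fun q => q@_(exponent i)) cF; rewrite mcoeff0 raddf_sum /= => E.
    by rewrite -[RHS]E; apply: eq_bigr => b _; rewrite mcoeffZ Fi !mxE mulrA.
  have free : row_free (rowsub f (map_mx Num.conj P)).
    rewrite rowsubE /row_free mxrankMfree ?row_free_unit ?map_unitmx ?spectral_unit //.
    by apply: row_free_rowsub1; apply: enum_val_inj.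
  move/eqP: c'P; rewrite mulmx_free_eq0 // => /eqP/rowP/(_ a).
  by rewrite !mxE => /eqP; rewrite mulf_eq0 (negPf (r0 a)) orbF => /eqP.
apply: hcoefP => al be; rewrite hcoef_herm_sum.
have [hal|hal] := ltnP (mdeg al) (msize p); last first.
  by rewrite hcoef_large; [rewrite big1 // => a _; rewrite Fn // mul0r mulr0 | left].
have [hbe|hbe] := ltnP (mdeg be) (msize p); last first.
  rewrite hcoef_large; [|by right].
  by rewrite big1 // => a _; rewrite (Fn a be) // conjC0 !mulr0.
have [i ->] := exponent_surj hal; have [j ->] := exponent_surj hbe.
have -> : hcoef p (exponent i) (exponent j) = M i j by rewrite mxE.
rewrite {1}(spectral_form Mn) mxE trmxCK.
under eq_bigr => l _ do rewrite mul_mx_diag !mxE.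
rewrite (bigID S) /= [X in _ + X]big1 ?addr0; last first.
  by move=> l; rewrite negbK /D => /eqP ->; rewrite mulr0 mul0r.
rewrite big_enum_val /=; apply: eq_bigr => a _.
rewrite !Fi -/(f a) -/(D (f a)) -/P [in LHS](realEsign (rD (f a))) -rr rmorphM /= conjCK.
have aux (A : comNzRingType) (x e u v y : A) :
  x * (e * (u * v)) * y = e * ((u * x) * (v * y)) by ring.
exact: aux.
Qed.

End Signature.

(** * Polarization and lower bounds for the projective degree *)

(** The constant coefficient of [B] being nonzero, all the factors ['X] of the product divide
    [C]. *)
Lemma coef_valuation (A : idomainType) (B C D : {poly A}) m :
  'X^m * D = B * C -> B`_0 != 0 -> C != 0 -> (m < size C)%N.
Proof.
move=> E B0 C0; rewrite ltnNge; apply: contra C0 => sC.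
have Cj : forall j, (j < m)%N -> C`_j = 0.
  move=> j; elim/ltn_ind: j => j IH jm.
  have := congr1 (fun P : {poly A} => P`_j) E.
  rewrite coefXnM jm coefM big_ord_recl subn0 big1 => [|h _].
    by rewrite addr0 => /esym/eqP; rewrite mulf_eq0 (negPf B0) => /eqP.
  rewrite lift0 IH ?mulr0 //; first by rewrite ltn_subrL (leq_ltn_trans _ (ltn_ord h)).
  by rewrite (leq_ltn_trans _ jm) // leq_subr.
apply/eqP/polyP => j; rewrite coef0; case: (ltnP j m) => [/Cj //|mj].
by rewrite nth_default // (leq_trans sC).
Qed.

Lemma half_sum (L : numFieldType) (a b : L) : (a + b) / 2 + (a - b) / 2 = a.
Proof. by field. Qed.

Lemma half_diff (L : numFieldType) (a b : L) : (a + b) / 2 - (a - b) / 2 = b.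
Proof. by field. Qed.

Section Polarization.
Variables (R : realType) (n : nat).
Local Notation K := R[i].
Implicit Types (p q : {mpoly K[n + n]}) (u v : {mpoly K[n]}).

Lemma zwE (y : 'I_(n + n) -> K) : y =1 zw (fun j => y (lshift n j)) (fun j => y (rshift n j)).
Proof. by move=> i; rewrite /zw; case: (split_ordP i) => j ->;
  rewrite ?(unsplitK (inl j)) ?(unsplitK (inr j)). Qed.

(** Replacing [z] by [x + i y] and its conjugate by [x - i y] is an invertible change of variables,
    and at natural [x], [y] the result is a value of [heval]. A nonzero polynomial does not vanish
    at all natural points. *)
Lemma heval_eq0 p : (forall z, heval p z = 0) -> p = 0.
Proof.
move=> p0; apply/eqP/negPn/negP => /mpoly_neq0_nat[y0].
rewrite (meval_eq _ (zwE _)); set z := (fun j : 'I_n => _); set w := (fun j : 'I_n => _) => pzw.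
pose L (i : 'I_(n + n)) : {mpoly K[n + n]} :=
  match split i with
  | inl j => 'X_(lshift n j) + 'i *: 'X_(rshift n j)
  | inr j => 'X_(lshift n j) - 'i *: 'X_(rshift n j)
  end.
pose q := p \mPo [tuple L i | i < n + n].
have qE x : q.@[x] = p.@[zw (fun j => x (lshift n j) + 'i * x (rshift n j))
                            (fun j => x (lshift n j) - 'i * x (rshift n j))].
  rewrite comp_mpoly_meval; apply: meval_eq => i; rewrite tnth_mktuple /L /zw.
  case: split => j; first by rewrite mevalD mevalZ !mevalXU.
  by rewrite mevalB mevalZ !mevalXU.
have q0: q != 0.
  apply: contraNneq pzw => q0.
  (* The inverse change of variables: [x = (z + w) / 2] and [y = (z - w) / (2 i)]. *)
  have := qE (zw (fun j => (z j + w j) / 2) (fun j => (w j - z j) * 'i / 2)).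
  rewrite q0 meval0 => E; rewrite [X in _ == X]E; apply/eqP; apply: meval_eq => i.
  have i2 (a b : K) : 'i * ((b - a) * 'i / 2) = (a - b) / 2.
    by rewrite mulrA [_ * 'i]mulrC mulrA -expr2 sqrCi mulN1r opprB.
  rewrite /zw; case: split => j; rewrite !(unsplitK (inl j)) !(unsplitK (inr j)) i2.
    by rewrite half_sum.
  by rewrite half_diff.
have [x] := mpoly_neq0_nat q0; rewrite qE => /eqP; apply.
rewrite -[RHS](p0 (fun j => (x (lshift n j))%:R + 'i * (x (rshift n j))%:R)).
apply: meval_eq => i; rewrite /zw; case: split => j //.
by rewrite rmorphD rmorphM /= conjCi !conjC_nat mulNr.
Qed.

Lemma hequiv_polarized p q : hequiv p q ->
  exists u v, [/\ u != 0, v != 0 & zlift u * wlift u * p = zlift v * wlift v * q].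
Proof.
case=> u [v [u0 v0 E]]; exists u, v; split=> //.
apply/eqP; rewrite -subr_eq0; apply/eqP/heval_eq0 => z.
have lift f : (zlift f * wlift f).@[zw z (fun i => (z i)^*)] = `|f.@[z]| ^+ 2.
  transitivity ((zlift f).@[zw z (fun i => (z i)^*)] * (wlift f).@[zw z (fun i => (z i)^*)]).
    exact: mevalM.
  rewrite normCK; congr (_ * _); first exact: meval_zlift.
  transitivity ((f.@[fun i => (z i)^*^*])^*); first exact: meval_wlift.
  by congr (_^*); apply: meval_eq => i; rewrite conjCK.
rewrite hevalE mevalB; apply/eqP; rewrite subr_eq0; apply/eqP.
transitivity ((zlift u * wlift u).@[zw z (fun i => (z i)^*)] * p.@[zw z (fun i => (z i)^*)]).
  exact: mevalM.
transitivity ((zlift v * wlift v).@[zw z (fun i => (z i)^*)] * q.@[zw z (fun i => (z i)^*)]).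
  by have := E z; rewrite -(lift u) -(lift v); apply.
by apply/esym; apply: mevalM.
Qed.

End Polarization.

(** * Restriction of the conjugate variables to a line *)

Section LowerBound.
Variables (R : realType) (n : nat).
Local Notation K := R[i].
Variables (e eta : 'I_n -> K).

(* Substitution of the line w = e + x eta in the conjugate variables. *)
Definition line_coord (i : 'I_(n + n)) : {poly {mpoly K[n]}} :=
  match split i with
  | inl j => ('X_j)%:P
  | inr j => ((e j)%:MP)%:P + ((eta j)%:MP)%:P * 'X
  end.

Definition restr (p : {mpoly K[n + n]}) : {poly {mpoly K[n]}} :=
  mmap ((@polyC {mpoly K[n]}) \o (@mpolyC n K)) line_coord p.

Definition conj_line (f : {mpoly K[n]}) : {poly K} :=
  mmap (fun c => (c^*)%:P) (fun j => (e j)%:P + (eta j)%:P * 'X) f.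

Local Notation cst := (map_poly (@mpolyC n K)).

HB.instance Definition _ := GRing.RMorphism.copy restr
  (mmap ((@polyC {mpoly K[n]}) \o (@mpolyC n K)) line_coord).

Lemma restr_zlift f : restr (zlift f) = f%:P.
Proof.
transitivity (mmap (fun c => (c%:MP)%:P) (fun j : 'I_n => ('X_j : {mpoly K[n]})%:P) f).
  apply: (@rmorph_mmap _ K {mpoly K[n + n]} {poly {mpoly K[n]}} restr) => [c|i] /=.
    by rewrite /restr mmapC.
  by rewrite /restr mmapX mmap1U /line_coord (unsplitK (inl i)).
transitivity ((mmap (@mpolyC n K) (fun j : 'I_n => 'X_j) f)%:P).
  by apply/esym/(@rmorph_mmap _ K {mpoly K[n]} {poly {mpoly K[n]}} polyC).
congr (_%:P); apply: mpoly_eq_meval => z.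
transitivity (mmap idfun z f); last by [].
apply: (@rmorph_mmap _ K {mpoly K[n]} K (meval z)) => [c|i] /=.
  by rewrite mevalC.
by rewrite mevalXU.
Qed.

Lemma restr_wlift f : restr (wlift f) = cst (conj_line f).
Proof.
transitivity (mmap (fun c => ((c^*)%:MP)%:P)
   (fun j => ((e j)%:MP)%:P + ((eta j)%:MP)%:P * 'X : {poly {mpoly K[n]}}) f).
  apply: (@rmorph_mmap _ K {mpoly K[n + n]} {poly {mpoly K[n]}} restr) => [c|i] /=.
    by rewrite /restr mmapC.
  by rewrite /restr mmapX mmap1U /line_coord (unsplitK (inr i)).
apply/esym/(@rmorph_mmap _ K {poly K} {poly {mpoly K[n]}} cst) => [c|i] /=.
  by rewrite map_polyC.
by rewrite rmorphD rmorphM /= !map_polyC map_polyX.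
Qed.

Lemma horner_conj_line f : (conj_line f).[1] = (f.@[fun i => (e i + eta i)^*])^*.
Proof.
transitivity (mmap Num.conj (fun i => e i + eta i) f).
  apply: (@rmorph_mmap _ K {poly K} K (horner_eval 1)) => [c|i] /=.
    by rewrite /horner_eval hornerC.
  by rewrite /horner_eval !hornerE.
apply/esym; apply: (@rmorph_mmap _ K K K Num.conj) => //= i.
by rewrite conjCK.
Qed.

Lemma meval_restr0 p z : ((restr p)`_0).@[z] = p.@[zw z e].
Proof.
rewrite -horner_coef0 -[LHS]/((meval z \o horner_eval 0) (restr p)).
apply: (@rmorph_mmap _ K {poly {mpoly K[n]}} K (meval z \o horner_eval 0)) => [c|i] /=.
  by rewrite /horner_eval hornerC mevalC.
rewrite /line_coord /zw /horner_eval; case: split => j.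
  by rewrite hornerC mevalXU.
by rewrite !(hornerE, mulr0, addr0) mevalC.
Qed.

Lemma restr_homog d q : bihomog d q -> forall i, (restr q)`_i \is d.-homog.
Proof.
move=> qd; pose H (P : {poly {mpoly K[n]}}) := forall i, P`_i \is d.-homog.
have HD P Q : H P -> H Q -> H (P + Q) by move=> hP hQ i; rewrite coefD rpredD.
have HM (c : {poly K}) P : H P -> H (P * cst c).
  move=> hP i; rewrite coefM; apply: rpred_sum => j _.
  by rewrite coef_map mulrC mul_mpolyC dhomogZ.
suff: H (restr q) by [].
rewrite /restr /mmap big_seq; elim/big_rec: _ => [|m P mq hP].
  by move=> i; rewrite coef0 dhomog0.
apply: HD hP; have [al [be mE]] := mjoin_surj m.
have al_d : mdeg al = d.
  by have [|] := qd al be; rewrite // /hcoef -mE -mcoeff_msupp.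
pose wl (j : 'I_n) : {poly K} := (e j)%:P + (eta j)%:P * 'X.
have E1 : \prod_(i < n) line_coord (lshift n i) ^+ mjoin al be (lshift n i) = ('X_[al])%:P.
  rewrite mpolyXE_id rmorph_prod; apply: eq_bigr => i _.
  by rewrite rmorphXn mjoinl /line_coord (unsplitK (inl i)).
have E2 : \prod_(i < n) line_coord (rshift n i) ^+ mjoin al be (rshift n i) = cst (mmap1 wl be).
  rewrite /mmap1 rmorph_prod; apply: eq_bigr => i _.
  rewrite rmorphXn mjoinr /line_coord (unsplitK (inr i)).
  by rewrite rmorphD rmorphM /= !map_polyC map_polyX.
have -> : ((@polyC {mpoly K[n]}) \o (@mpolyC n K)) q@_m * mmap1 line_coord m =
    ('X_[al])%:P * cst (q@_m *: mmap1 wl be).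
  rewrite mE [mmap1 line_coord _]big_split_ord.
  rewrite [X in _ * (X * _)]E1 [X in _ * (_ * X)]E2 map_polyZ -mul_polyC.
  by rewrite mulrCA.
apply: HM => -[|i]; rewrite coefC /= ?dhomog0 // dhomogX.
by apply/eqP.
Qed.

Lemma restr_square u p :
  restr (zlift u * wlift u * p) = u%:P * cst (conj_line u) * restr p.
Proof.
transitivity (restr (zlift u * wlift u) * restr p); first exact: rmorphM.
congr (_ * _); transitivity (restr (zlift u) * restr (wlift u)); first exact: rmorphM.
by congr (_ * _); [exact: restr_zlift | exact: restr_wlift].
Qed.

Lemma restr_squares u v p q : zlift u * wlift u * p = zlift v * wlift v * q ->
  u%:P * cst (conj_line u) * restr p = v%:P * cst (conj_line v) * restr q.
Proof. by move=> E; rewrite -restr_square E restr_square. Qed.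

(** Evaluation at [e] alone could give [0 = 0], since the conjugate of [u] may vanish there. The
    coefficients of order [a] are compared instead, where [a] is the order of that conjugate along
    the line: on the left only order 0 of [p] survives, and on the right [v] multiplies a form of
    degree [d]. *)
Lemma restr_quotient d u v p q : bihomog d q -> conj_line u != 0 ->
  zlift u * wlift u * p = zlift v * wlift v * q ->
  exists2 Q, Q \is d.-homog & u * (restr p)`_0 = v * Q.
Proof.
move=> qd du E.
have ex: exists a, (conj_line u)`_a != 0.
  by exists (size (conj_line u)).-1; rewrite -lead_coefE lead_coef_eq0.
case: (ex_minnP ex) => a ca amin.
exists (((conj_line u)`_a)^-1 *: (cst (conj_line v) * restr q)`_a).
  apply: dhomogZ; rewrite coefM; apply: rpred_sum => j _.
  by rewrite coef_map mul_mpolyC dhomogZ // restr_homog.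
have E' : u * (cst (conj_line u) * restr p)`_a = v * (cst (conj_line v) * restr q)`_a.
  by rewrite -(coefCM u) -(coefCM v) (mulrA u%:P) (mulrA v%:P) (restr_squares E).
have E0 : (cst (conj_line u) * restr p)`_a = (conj_line u)`_a *: (restr p)`_0.
  rewrite coefM big_ord_recr /= subnn big1 ?add0r => [|j _].
    by rewrite coef_map mul_mpolyC.
  have [/eqP cj|/amin] := boolP ((conj_line u)`_j == 0).
    by rewrite coef_map cj raddf0 mul0r.
  by rewrite leqNgt ltn_ord.
set k := (conj_line u)`_a in ca E0 *.
transitivity (k^-1 *: (v * (cst (conj_line v) * restr q)`_a)); last exact: scalerAr.
transitivity (k^-1 *: (k *: (u * (restr p)`_0))).
  exact: esym (scalerK ca _).
congr (_ *: _); apply: etrans E'; rewrite E0; exact: scalerAr.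
Qed.

End LowerBound.

(** * Lower bound for the bidegree of an equivalent form *)

Section LowerBoundMain.
Variables (R : realType) (n : nat).
Local Notation K := R[i].

Definition unit_pt (i : 'I_n) : 'I_n -> K := fun l => (l == i)%:R.

Lemma hequiv_quotient (e : 'I_n -> K) d u v (p q : {mpoly K[n + n]}) :
  bihomog d q -> u != 0 -> zlift u * wlift u * p = zlift v * wlift v * q ->
  exists Q P, [/\ Q \is d.-homog, u * P = v * Q & forall z, P.@[z] = p.@[zw z e]].
Proof.
move=> qd u0 E; have [x ux] := mpoly_neq0_nat u0.
(* At parameter 1 the line reaches a point with natural coordinates, hence fixed by conjugation,
   where [u] does not vanish. *)
pose eta i : K := (x i)%:R - e i.
have du: conj_line e eta u != 0.
  apply: contraNneq ux => du.
  have := horner_conj_line e eta u; rewrite du horner0 => /esym/eqP.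
  rewrite conjC_eq0 => /eqP E0; rewrite -[X in _ == X]E0; apply/eqP; apply: meval_eq => i.
  by rewrite addrC subrK conjC_nat.
have [Q Qd QE] := restr_quotient (eta := eta) qd du E.
by exists Q, (restr e eta p)`_0; split=> // z; rewrite meval_restr0.
Qed.

(* If p(z, e_i) = c z_i^m while p(e_j, e_j) <> 0, then the holomorphic forms in p
   have no common factor. *)
Lemma hequiv_degree_ge (p q : {mpoly K[n + n]}) (i j : 'I_n) c m d :
  i != j -> c != 0 -> (forall z, p.@[zw z (unit_pt i)] = c * z i ^+ m) ->
  p.@[zw (unit_pt j) (unit_pt j)] != 0 ->
  bihomog d q -> hequiv p q -> (m <= d)%N.
Proof.
move=> ij c0 pi pj qd /hequiv_polarized[u [v [u0 v0 E]]].
have [Q1 [P1 [Q1d E1 P1E]]] := hequiv_quotient (unit_pt i) qd u0 E.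
have [Q2 [P2 [Q2d E2 P2E]]] := hequiv_quotient (unit_pt j) qd u0 E.
have P1X : P1 = c *: 'X_i ^+ m.
  by apply: mpoly_eq_meval => z; rewrite P1E pi mevalZ rmorphXn /= mevalXU.
have PQ : P1 * Q2 = P2 * Q1.
  apply: (mulfI u0); rewrite !mulrA E1 E2 -!mulrA; congr (_ * _).
  by rewrite mulrC.
(* The morphism [chi] singles out the variable [z_i]. As [P2] is nonzero at the point [e_j], whose
   coordinate [i] is 0, its constant coefficient is nonzero, and in [P1 * Q2 = P2 * Q1] the power
   [z_i^m] must divide [Q1]. *)
pose chi := mmap (@polyC {mpoly K[n]} \o @mpolyC n K)
  (fun l => if l == i then 'X else ('X_l)%:P).
have chiK f : (chi f).['X_i] = f.
  transitivity (mmap (@mpolyC n K) (fun l : 'I_n => 'X_l) f).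
    apply: (@rmorph_mmap _ K {poly {mpoly K[n]}} {mpoly K[n]} (horner_eval 'X_i)) => [x|l] /=.
      by rewrite /horner_eval hornerC.
    by rewrite /horner_eval; case: eqP => [->|_]; rewrite ?hornerX ?hornerC.
  apply: mpoly_eq_meval => z; transitivity (mmap idfun z f); last by [].
  apply: (@rmorph_mmap _ K {mpoly K[n]} K (meval z)) => [x|l] /=.
    by rewrite mevalC.
  by rewrite mevalXU.
have chi0 f : ((chi f)`_0).@[unit_pt j] = f.@[unit_pt j].
  rewrite -horner_coef0 -[LHS]/((meval (unit_pt j) \o horner_eval 0) (chi f)).
  apply: (@rmorph_mmap _ K {poly {mpoly K[n]}} K (meval (unit_pt j) \o horner_eval 0)) => [x|l] /=.
    by rewrite /horner_eval hornerC mevalC.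
  rewrite /horner_eval; case: eqP => [->|_]; rewrite ?hornerX ?hornerC ?meval0 ?mevalXU //.
  by rewrite /unit_pt (negPf ij).
have Q10 : chi Q1 != 0.
  apply: contraTneq c0 => Q0; rewrite negbK.
  have Q10 : Q1 = 0 by rewrite -(chiK Q1) Q0 horner0.
  move/eqP: E1; rewrite Q10 mulr0 mulf_eq0 (negPf u0) P1X /= => /eqP/(congr1 (meval (unit_pt i))).
  by rewrite mevalZ rmorphXn /= mevalXU /unit_pt eqxx expr1n mulr1 meval0 => ->.
have chiP1 : chi P1 = (c%:MP)%:P * 'X^m.
  rewrite P1X [LHS]mmapZ; congr (_ * _); rewrite rmorphXn /=; congr (_ ^+ m).
  by rewrite mmapX mmap1U eqxx.
have chiE : 'X^m * ((c%:MP)%:P * chi Q2) = chi P2 * chi Q1.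
  have chiM x y : chi (x * y) = chi x * chi y by apply: rmorphM.
  by rewrite -chiM -PQ chiM chiP1 mulrA ['X^m * _]mulrC.
have P20 : (chi P2)`_0 != 0.
  by apply: contraNneq pj => E0; rewrite -P2E -chi0 E0 meval0.
rewrite -ltnS; apply: leq_trans (coef_valuation chiE P20 Q10) _.
apply: size_mmap Q1d _ _ => [x|l]; first exact: size_polyC_leq1.
by case: eqP => _; rewrite ?size_polyX // (leq_trans (size_polyC_leq1 _)).
Qed.

End LowerBoundMain.

(** * Projective degrees of the members of J *)

Lemma sum_squares_parallel (L : numClosedFieldType) N (e f c : 'I_N -> L) b :
  (forall a, f a * c b = f b * c a) ->
  `|c b| ^+ 2 * \sum_a e a * `|f a| ^+ 2 = `|f b| ^+ 2 * \sum_a e a * `|c a| ^+ 2.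
Proof.
move=> fc; rewrite !mulr_sumr; apply: eq_bigr => a _.
rewrite mulrCA [RHS]mulrCA; congr (_ * _).
by rewrite -!exprMn -!normrM mulrC fc.
Qed.

Section ProjectiveDegree.
Variables (R : realType) (n : nat).
Local Notation K := R[i].
Implicit Types p q : {mpoly K[n + n]}.

Lemma hequiv_refl p : hequiv p p.
Proof. by exists 1, 1; split; rewrite ?oner_neq0. Qed.

Lemma has_bidegree_repr_self p m : herm_sym p -> bihomog m p -> has_bidegree_repr p m.
Proof. by move=> hp pm; exists p; split=> //; apply: hequiv_refl. Qed.

Lemma proj_degreeP p d : has_bidegree_repr p d ->
  has_bidegree_repr p (proj_degree p) /\
  forall k, has_bidegree_repr p k -> (proj_degree p <= k)%N.
Proof.
move=> pd; have ex : exists k, `[< has_bidegree_repr p k >] by exists d; apply/asboolP.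
case: (ex_minnP ex) => m /asboolP pm mmin.
have : exists k, [set m | has_bidegree_repr p m /\
                    forall k, has_bidegree_repr p k -> (m <= k)%N]%classic k.
  by exists m; split=> // k pk; apply: mmin; apply/asboolP.
by move/(@xgetPex _ 0%N).
Qed.

Lemma proj_degree_le p d : has_bidegree_repr p d -> (proj_degree p <= d)%N.
Proof. by move=> pd; apply: (proj_degreeP pd).2. Qed.

Lemma proj_degree_eq p m : has_bidegree_repr p m ->
  (forall k, has_bidegree_repr p k -> (m <= k)%N) -> proj_degree p = m.
Proof.
move=> pm mmin; apply/eqP; rewrite eqn_leq proj_degree_le //=.
by apply: mmin; apply: (proj_degreeP pm).1.
Qed.

Lemma heval_herm_sum N sg (F : 'I_N -> {mpoly K[n]}) z :
  heval (herm_sum sg F) z = \sum_a (-1) ^+ sg a * `|(F a).@[z]| ^+ 2.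
Proof.
pose w := fun i => (z i)^*.
have H := @meval_herm_sum R n N sg F z w.
etransitivity; first exact H.
apply: eq_bigr => a _; rewrite normCK.
by congr (_ * (_ * _^*)); apply: meval_eq => i; rewrite /w conjCK.
Qed.

Lemma parallel_hequiv N sg (F C : 'I_N -> {mpoly K[n]}) b : proportional F C ->
  F b != 0 -> C b != 0 -> hequiv (herm_sum sg F) (herm_sum sg C).
Proof.
move=> FC Fb Cb; exists (C b), (F b); split; [exact Cb | exact Fb | move=> z].
have HF := heval_herm_sum sg F z; have HC := heval_herm_sum sg C z.
apply: etrans (etrans _ (esym (congr1 _ HC))); first exact: (congr1 _ HF).
apply: sum_squares_parallel => a.
have := congr1 (meval z) (FC a b) => E; apply: etrans (etrans E _).
  by apply/esym; apply: mevalM.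
exact: mevalM.
Qed.

Lemma free_fam_neq0 N (F : 'I_N -> {mpoly K[n]}) a : free_fam F -> F a != 0.
Proof.
move=> Ff; apply/eqP => F0; have := Ff (fun b => (b == a)%:R).
rewrite (bigD1 a) //= F0 scaler0 add0r big1 => [|b /negPf ->]; last by rewrite scale0r.
by move=> /(_ erefl a)/eqP; rewrite eqxx oner_eq0.
Qed.

End ProjectiveDegree.

(** * Members of [J] as Hermitian sums vanishing on incident pairs *)

Section Sphere.
Variable R : realType.
Local Notation K := R[i].

Lemma meval_sphere_form (z w : 'I_3 -> K) :
  (sphere_form R).@[zw z w] = z 0 * w 0 + z 1 * w 1 - z 2 * w 2.
Proof.
rewrite /sphere_form /zvar /wvar mevalB mevalD.
have E i : ('X_(lshift 3 i) * 'X_(rshift 3 i) : {mpoly K[3 + 3]}).@[zw z w] = z i * w i.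
  transitivity (('X_(lshift 3 i) : {mpoly K[3 + 3]}).@[zw z w] *
                ('X_(rshift 3 i) : {mpoly K[3 + 3]}).@[zw z w]).
    exact: mevalM.
  by congr (_ * _); rewrite mevalXU /zw ?(unsplitK (inl i)) ?(unsplitK (inr i)).
by rewrite (E 0) (E 1) (E 2).
Qed.

Lemma sphere_incidence (p : {mpoly K[3 + 3]}) (z w : 'I_3 -> K) :
  Iset (sphere_form R) p -> z 0 * w 0 + z 1 * w 1 = z 2 * w 2 -> p.@[zw z w] = 0.
Proof.
case=> h -> E; transitivity ((sphere_form R).@[zw z w] * h.@[zw z w]).
  exact: mevalM.
by rewrite meval_sphere_form E subrr mul0r.
Qed.

Lemma Hset_herm_sum A B p : Hset R 2 A B p -> exists N sg F,
  [/\ @free_fam R 3 N F, p = herm_sum sg F, #|[pred a | ~~ sg a]| = A,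
      #|[pred a | sg a]| = B & exists m, forall a, F a \is m.-homog].
Proof.
case=> ph [m pm] ps; have [N [sg [F [Ff pE]]]] := herm_sumP ph.
exists N, sg, F; move: ps; rewrite pE signature_herm_sum // => -[-> ->].
by split=> //; exists m; apply: (herm_sum_homog (sg := sg)) => //; rewrite -pE.
Qed.

Section Member.
Variables (N : nat) (sg : 'I_N -> bool) (F : 'I_N -> {mpoly K[3]}) (m : nat).
Hypothesis Ff : free_fam F.
Hypothesis Fh : forall a, F a \is m.-homog.
Hypothesis pI : Iset (sphere_form R) (herm_sum sg F).

Lemma member_incidence (z w : 'I_3 -> K) :
  z 0 * w 0 + z 1 * w 1 = z 2 * w 2 -> \sum_a (F a).@[z] * (dualF F sg a).@[w] = 0.
Proof.
move=> E; rewrite -[RHS](sphere_incidence pI E) meval_herm_sum.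
by apply: eq_bigr => a _; rewrite meval_dualF mulrCA.
Qed.

Lemma member_degree_bound : (0 < N)%N ->
  (N <= 4)%N \/ (exists j0, forall a, a != j0 -> sg a = ~~ sg j0) ->
  exists d C, [/\ (d <= 'C(N.-1, 2))%N, forall a, C a \is d.-homog,
    exists a : 'I_N, C a != 0 & proportional F C].
Proof. exact: hermitian_degree_bound Fh Ff member_incidence. Qed.

Lemma member_proj_degree : (0 < N)%N ->
  (N <= 4)%N \/ (exists j0, forall a, a != j0 -> sg a = ~~ sg j0) ->
  (proj_degree (herm_sum sg F) <= 'C(N.-1, 2))%N.
Proof.
move=> N0 sgc; have [d [C [dN Ch [b Cb] FC]]] := member_degree_bound N0 sgc.
apply: leq_trans dN; apply: proj_degree_le; exists (herm_sum sg C); split.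
- exact: herm_sum_sym.
- exact: herm_sum_bihomog.
- by apply: parallel_hequiv FC _ Cb; apply: free_fam_neq0.
Qed.

(* On a constant-sign member all the squares vanish on the sphere. *)
Lemma member_definite s : (0 < N)%N -> (forall a, sg a = s) -> False.
Proof.
move=> N0 sgs; pose a := Ordinal N0.
have [t [y [t0 _ Fty]]] := dhomog_chart (Fh a) (free_fam_neq0 a Ff).
pose P := mmap (@polyC K) (vec3 t%:P y%:P 'X) (F a).
have PE x : P.[x] = (F a).@[vec3 t y x].
  rewrite -[LHS]/(horner_eval x _) /P.
  apply: (@rmorph_mmap _ K {poly K} K (horner_eval x)) => [c|i] /=.
    by rewrite /horner_eval hornerC.
  by rewrite /vec3 /horner_eval; case: i => [[|[|i]]] _ /=; rewrite ?hornerC ?hornerX.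
have P0 : P != 0 by apply: contraNneq Fty => P0; rewrite -PE P0 horner0.
have r0 : 0 < t * t^* + y * y^*.
  by rewrite ltr_pwDl ?mul_conjC_ge0 ?mul_conjC_gt0.
have [x [xx]] := circle_nonroot r0 P0; rewrite PE => /eqP; apply.
have := member_incidence (z := vec3 t y x) (w := fun i => (vec3 t y x i)^*) (esym xx).
under eq_bigr => b _ do rewrite meval_dualF sgs.
move=> E; have : (-1) ^+ s * \sum_b `|(F b).@[vec3 t y x]| ^+ 2 == 0.
  apply/eqP; rewrite -[RHS]E mulr_sumr; apply: eq_bigr => b _.
  rewrite normCK mulrCA; congr (_ * (_ * _^*)).
  by apply: meval_eq => i; rewrite conjCK.
rewrite mulf_eq0 signr_eq0 /=.
rewrite psumr_eq0 => [/allP/(_ a (mem_index_enum _))|b _]; last exact: exprn_ge0.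
by rewrite expf_eq0 /= normr_eq0 => /eqP.
Qed.

(** For two forms the degree bound is ['C(1, 2) = 0]: they are proportional to constants, hence
    linearly dependent. *)
Lemma member_rank2 : N = 2%N -> False.
Proof.
move=> N2; have [||d [C [dN Ch [b Cb] FC]]] := member_degree_bound.
- by rewrite N2.
- by left; rewrite N2.
have d0 : d = 0%N by move: dN; rewrite N2 leqn0 => /eqP.
have CE a : C a = ((C a)@_0)%:MP.
  apply/mpolyP => mm; rewrite mcoeffC; case: eqP => [->|m0]; first by rewrite mulr1.
  rewrite mulr0; apply/eqP/negPn/negP; rewrite -mcoeff_msupp => mC.
  have /dhomogP/(_ _ mC) /= := Ch a; rewrite d0 => /eqP.
  by rewrite mdeg_eq0 => /eqP.
have [a ab] : exists a : 'I_N, a != b.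
  have /card_gt1P[x [y [_ _ xy]]] : (1 < #|'I_N|)%N by rewrite card_ord N2.
  by have [xb|] := eqVneq x b; [exists y; rewrite -xb eq_sym | exists x].
have cb0 : (C b)@_0 != 0 by apply: contraNneq Cb => Cb0; rewrite CE Cb0.
have := @Ff (fun x => (x == a)%:R * (C b)@_0 - (x == b)%:R * (C a)@_0).
have ba : (b == a) = false by rewrite eq_sym (negPf ab).
rewrite (bigD1 a) //= (bigD1 b) ?ba //= !eqxx (negPf ab).
rewrite big1 => [|x /andP[/negPf -> /negPf ->]]; last by rewrite !mul0r subrr scale0r.
rewrite !mul0r !mul1r subr0 sub0r addr0 scaleNr -!mul_mpolyC -!CE.
have := FC a b; rewrite mulrC => ->; rewrite mulrC subrr => /(_ erefl a).
by rewrite eqxx (negPf ab) mul0r subr0 mul1r => /eqP; rewrite (negPf cb0).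
Qed.

End Member.

End Sphere.

(** * Examples *)

Section Identities.
Variable A : comNzRingType.
Implicit Types x y z : A.

Definition block x z m k := \sum_(i < k.+1) x ^+ (m - i) * z ^+ i.

(** The factor [x - z] telescopes and [y] adds a shifted copy of the sum, so that [k + 2] monomials
    carry one sign and a single monomial the other. *)
Lemma block_mul x y z m k : (k <= m)%N ->
  (x + y - z) * block x z m k =
  x ^+ m.+1 - x ^+ (m - k) * z ^+ k.+1 + \sum_(i < k.+1) x ^+ (m - i) * y * z ^+ i.
Proof.
move=> km; have -> : x + y - z = (x - z) + y by ring.
rewrite mulrDl; congr (_ + _); last first.
  by rewrite /block mulr_sumr; apply: eq_bigr => i _; ring.
have -> : block x z m k = x ^+ (m - k) * \sum_(i < k.+1) x ^+ (k - i) * z ^+ i.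
  rewrite /block mulr_sumr; apply: eq_bigr => i _; rewrite mulrA -exprD; congr (_ ^+ _ * _).
  by have := ltn_ord i; lia.
rewrite mulrCA -(subrXX x z k.+1) mulrBr -exprD; congr (_ ^+ _ - _).
by rewrite addnS subnK.
Qed.

Lemma block0r x m k : block x 0 m k = x ^+ m.
Proof.
rewrite /block big_ord_recl subn0 expr0 mulr1 big1 ?addr0 // => i _.
by rewrite lift0 expr0n mulr0.
Qed.

Lemma block0l z m k : (k < m)%N -> block 0 z m k = 0.
Proof.
move=> km; rewrite /block big1 // => i _; rewrite expr0n.
have -> : (m - i == 0)%N = false by have := ltn_ord i; lia.
by rewrite mul0r.
Qed.

Definition two_blocks b1 b2 m k l x y z :=
  (x + y - z) * ((-1) ^+ (b1 : bool) * block x z m k + (-1) ^+ (b2 : bool) * block y z m l).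

(** This is [a^3 + b^3 + c^3 - 3 a b c] at [(x, y, - z)]. With squared moduli and [z = 1] it belongs
    to Faran's cubic map of balls, with components [z0^3], [sqrt 3 z0 z1] and [z1^3]. *)
Definition faran x y z :=
  (x + y - z) * (x ^+ 2 + y ^+ 2 + z ^+ 2 - x * y + y * z + x * z).

Lemma faranE x y z : faran x y z = x ^+ 3 + y ^+ 3 + 3 * (x * y * z) - z ^+ 3.
Proof. by rewrite /faran; ring. Qed.

(* With a = (x + z)(x' - z'), b = (x - z)(x' + z') and c = 2 y y', so that
   a + b + c = 2 (x x' + y y' - z z'), this is half of a^3 + b^3 + c^3 - 3 a b c. *)
Definition mixed x y z x' y' z' :=
  let a := (x + z) * (x' - z') in let b := (x - z) * (x' + z') in let c := 2 * (y * y') in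
  (x * x' + y * y' - z * z') * (a ^+ 2 + b ^+ 2 + c ^+ 2 - a * b - b * c - c * a).

(** With [(x + z)^3 = p + q] and [(x - z)^3 = p - q], the sum [a^3 + b^3] is [2 (p p' - q q')], of
    signature [(1, 1)]. The term [c^3] adds one positive square, and [- 3 a b c] one negative square
    because [a b] is [x^2 - z^2] times its primed copy. *)
Lemma mixedE x y z x' y' z' : mixed x y z x' y' z' =
  (x ^+ 3 + 3 * (x * z ^+ 2)) * (x' ^+ 3 + 3 * (x' * z' ^+ 2))
  - (3 * (x ^+ 2 * z) + z ^+ 3) * (3 * (x' ^+ 2 * z') + z' ^+ 3)
  + 4 * (y ^+ 3 * y' ^+ 3)
  - 3 * ((x ^+ 2 * y - z ^+ 2 * y) * (x' ^+ 2 * y' - z' ^+ 2 * y')).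
Proof. by rewrite /mixed; ring. Qed.

End Identities.

Section IdentityMorphism.
Variables (A B : comNzRingType) (phi : {rmorphism A -> B}).

Lemma rmorph_block x z m k : phi (block x z m k) = block (phi x) (phi z) m k.
Proof.
by rewrite rmorph_sum; apply: eq_bigr => i _; rewrite rmorphM !rmorphXn.
Qed.

Lemma rmorph_two_blocks b1 b2 m k l x y z :
  phi (two_blocks b1 b2 m k l x y z) = two_blocks b1 b2 m k l (phi x) (phi y) (phi z).
Proof.
by rewrite rmorphM rmorphB rmorphD rmorphD !rmorphM !rmorph_block !rmorph_sign.
Qed.

Lemma rmorph_faran x y z : phi (faran x y z) = faran (phi x) (phi y) (phi z).
Proof. by rewrite /faran !(rmorphM, rmorphB, rmorphD, rmorphXn). Qed.

Lemma rmorph_mixed x y z x' y' z' :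
  phi (mixed x y z x' y' z') = mixed (phi x) (phi y) (phi z) (phi x') (phi y') (phi z').
Proof. by rewrite /mixed /= !(rmorphM, rmorphB, rmorphD, rmorphXn, rmorph1). Qed.

End IdentityMorphism.

(** * Hermitian sums of monomials *)

Definition mon (t : nat * nat * nat) : 'X_{1..3} :=
  [multinom vec3 t.1.1 t.1.2 t.2 i | i < 3].

Lemma mon_inj : injective mon.
Proof.
move=> [[a b] c] [[a' b'] c'] E.
have := congr1 (fun mm : 'X_{1..3} => mm 0) E.
have := congr1 (fun mm : 'X_{1..3} => mm 1) E.
have := congr1 (fun mm : 'X_{1..3} => mm 2) E.
by rewrite !mnmE /vec3 /= => -> -> ->.
Qed.

Lemma mdeg_mon t : mdeg (mon t) = (t.1.1 + t.1.2 + t.2)%N.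
Proof. by rewrite mdegE !big_ord_recl big_ord0 !mnmE /vec3 /= addn0 addnA. Qed.

Section Families.
Variable R : realType.
Local Notation K := R[i].

Lemma free_fam_pivot N (F : 'I_N -> {mpoly K[3]}) (mu : 'I_N -> 'X_{1..3}) :
  (forall a, (F a)@_(mu a) != 0) -> (forall a b, a != b -> (F b)@_(mu a) = 0) ->
  free_fam F.
Proof.
move=> F1 F0 c E a; apply/eqP; have := congr1 (mcoeff (mu a)) E.
rewrite mcoeff0 raddf_sum (bigD1 a) //= big1 ?addr0 => [|b ba].
  by rewrite mcoeffZ => /eqP; rewrite mulf_eq0 (negPf (F1 a)) orbF.
by rewrite mcoeffZ F0 ?mulr0 // eq_sym.
Qed.

Definition T (i : 'I_3) : {mpoly K[3 + 3]} := zvar R i * wvar R i.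

Lemma lift_mon t : zlift 'X_[mon t] * wlift 'X_[mon t] =
  T 0 ^+ t.1.1 * T 1 ^+ t.1.2 * T 2 ^+ t.2.
Proof.
have E3 (A : comNzRingType) (h g : 'I_3 -> A) :
    mmap1 h (mon t) * mmap1 g (mon t) =
    (h 0 * g 0) ^+ t.1.1 * (h 1 * g 1) ^+ t.1.2 * (h 2 * g 2) ^+ t.2.
  rewrite /mmap1 -big_split /= !big_ord_recl big_ord0 mulr1 mulrA.
  rewrite -!exprMn !mnmE /vec3 /=.
  by congr (_ ^+ _ * _ ^+ _ * _ ^+ _); congr (h _ * g _); apply: val_inj.
etransitivity; last exact: (E3 _ (@zvar R 3) (@wvar R 3)).
by congr (_ * _); [apply: mmapX | apply: mmapX].
Qed.

Section MonomialFamily.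
Variable s : seq (bool * (nat * nat * nat)).
Local Notation dflt := (false, (0, 0, 0)%N).

Definition mfam (a : 'I_(size s)) : {mpoly K[3]} := 'X_[mon (nth dflt s a).2].
Definition msg (a : 'I_(size s)) : bool := (nth dflt s a).1.

Lemma mfam_free : uniq (unzip2 s) -> free_fam mfam.
Proof.
move=> us; apply: (@free_fam_pivot _ _ (fun a => mon (nth dflt s a).2)) => [a|a b ab].
  by rewrite mcoeffX eqxx oner_neq0.
rewrite mcoeffX; case: eqP => [/mon_inj E|//]; case/eqP: ab; apply: val_inj => /=.
have sz : size (unzip2 s) = size s by rewrite size_map.
apply/eqP; rewrite -(nth_uniq (0, 0, 0)%N _ _ us) ?sz //.
by rewrite !(nth_map dflt) ?E.
Qed.

Lemma card_ord_nth (P : pred (bool * (nat * nat * nat))) :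
  #|[pred a : 'I_(size s) | P (nth dflt s a)]| = count P s.
Proof.
rewrite -sum1_card -sum1_count (big_nth dflt) big_mkord.
by apply: eq_bigl => a; rewrite inE.
Qed.

Lemma mfam_homog d : all (fun t => t.2.1.1 + t.2.1.2 + t.2.2 == d)%N s ->
  forall a, mfam a \is d.-homog.
Proof.
move=> /allP sd a; rewrite dhomogX /= mdeg_mon.
by apply: (sd (nth dflt s a)); rewrite mem_nth.
Qed.

Lemma mfam_sum : herm_sum msg mfam =
  \sum_(t <- s) (-1) ^+ t.1 * (T 0 ^+ t.2.1.1 * T 1 ^+ t.2.1.2 * T 2 ^+ t.2.2).
Proof.
rewrite (big_nth dflt) big_mkord; apply: eq_bigr => a _.
rewrite scaler_sign mulr_sign.
by have -> := lift_mon (nth dflt s a).2.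
Qed.

End MonomialFamily.

End Families.

(** * Signed exponents of the block forms, with [true] for a minus sign *)

Definition block0 (b : bool) m k : seq (bool * (nat * nat * nat)) :=
  [:: (b, (m.+1, 0, 0)); (~~ b, (m - k, 0, k.+1))]%N ++
  [seq (b, (m - i, 1, i))%N | i <- iota 0 k.+1].

Definition block1 (b : bool) m k : seq (bool * (nat * nat * nat)) :=
  [:: (b, (0, m.+1, 0)); (~~ b, (0, m - k, k.+1))]%N ++
  [seq (b, (1, m - i, i))%N | i <- iota 0 k.+1].

Lemma notin_map (T U : eqType) (f : T -> U) s y :
  (forall i, i \in s -> y <> f i) -> y \notin [seq f i | i <- s].
Proof. by move=> yf; apply/mapP => -[i si E]; apply: (yf i si). Qed.

Lemma block0_uniq b m k : uniq (unzip2 (block0 b m k)).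
Proof.
rewrite /unzip2 /block0 map_cat -map_comp.
move: (iota 0 k.+1) (iota_uniq 0 k.+1) => it uit; apply/and3P; split.
- rewrite inE negb_or; apply/andP; split; first by apply/eqP => -[] //.
  by apply: notin_map => i _ [].
- by apply: notin_map => i _ [].
have f_inj : injective (fun i => (m - i, 1, i)%N) by move=> i j [].
by have := map_inj_uniq f_inj it; rewrite uit.
Qed.

Lemma block1_uniq b m k : uniq (unzip2 (block1 b m k)).
Proof.
rewrite /unzip2 /block1 map_cat -map_comp.
move: (iota 0 k.+1) (iota_uniq 0 k.+1) => it uit; apply/and3P; split.
- rewrite inE negb_or; apply/andP; split; first by apply/eqP => -[] //.
  by apply: notin_map => i _ [].
- by apply: notin_map => i _ [].
have f_inj : injective (fun i => (1, m - i, i)%N) by move=> i j [].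
by have := map_inj_uniq f_inj it; rewrite uit.
Qed.

(** The exponent of [x] is at least [m - k], hence at least 2, in the first block, and at most 1 in
    the second, so that no monomials merge. *)
Lemma blocks_uniq b b' m k l : (k + 2 <= m)%N -> (l + 2 <= m)%N ->
  uniq (unzip2 (block0 b m k ++ block1 b' m l)).
Proof.
move=> km lm.
have -> : unzip2 (block0 b m k ++ block1 b' m l) =
  unzip2 (block0 b m k) ++ unzip2 (block1 b' m l) by apply: map_cat.
rewrite cat_uniq block0_uniq block1_uniq andbT.
have t0 t : t \in unzip2 (block0 b m k) -> (1 < t.1.1)%N.
  have itE i : i \in iota 0 k.+1 -> (i <= k)%N by rewrite mem_iota.
  rewrite /unzip2 /block0 map_cat -map_comp; move: (iota 0 k.+1) itE => it itE.
  rewrite mem_cat !inE => /orP[/orP[/eqP ->|/eqP ->] /=|/mapP[i /itE ik ->] /=]; lia.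
have t1 t : t \in unzip2 (block1 b' m l) -> (t.1.1 <= 1)%N.
  rewrite /unzip2 /block1 map_cat -map_comp; move: (iota 0 l.+1) => it.
  by rewrite mem_cat !inE; case/orP => [/orP[/eqP ->|/eqP ->] //|/mapP[i _ ->]].
by apply/hasPn => t /t1 ht; apply/negP => /t0; rewrite ltnNge ht.
Qed.

Lemma block0_count (b : bool) m k (P : pred bool) :
  count (fun t => P t.1) (block0 b m k) = (if P b then k.+2 else 0) + P (~~ b) :> nat.
Proof.
rewrite /block0 count_cat count_map.
have -> : count (preim (fun i => (b, (m - i, 1, i)%N)) (fun t => P t.1)) (iota 0 k.+1) =
   (if P b then k.+1 else 0)%N.
  rewrite (eq_count (a2 := fun=> P b)) //; case: (P b).
    by rewrite count_predT size_iota.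
  exact: count_pred0.
by rewrite /=; case: (P b); case: (P (~~ b)) => /=; lia.
Qed.

Lemma block1_count (b : bool) m k (P : pred bool) :
  count (fun t => P t.1) (block1 b m k) = ((if P b then k.+2 else 0) + P (~~ b))%N.
Proof.
rewrite /block1 count_cat count_map.
have -> : count (preim (fun i => (b, (1, m - i, i)%N)) (fun t => P t.1)) (iota 0 k.+1) =
   (if P b then k.+1 else 0)%N.
  rewrite (eq_count (a2 := fun=> P b)) //; case: (P b).
    by rewrite count_predT size_iota.
  exact: count_pred0.
by rewrite /=; case: (P b); case: (P (~~ b)) => /=; lia.
Qed.

Lemma block0_deg b m k : (k <= m)%N ->
  all (fun t => t.2.1.1 + t.2.1.2 + t.2.2 == m.+1)%N (block0 b m k).
Proof.
move=> km; apply/allP => t.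
have itE i : i \in iota 0 k.+1 -> (i <= k)%N by rewrite mem_iota.
rewrite /block0; move: (iota 0 k.+1) itE => it itE.
rewrite mem_cat !inE => /orP[/orP[/eqP ->|/eqP ->] /=|/mapP[i /itE ik ->] /=]; lia.
Qed.

Lemma block1_deg b m k : (k <= m)%N ->
  all (fun t => t.2.1.1 + t.2.1.2 + t.2.2 == m.+1)%N (block1 b m k).
Proof.
move=> km; apply/allP => t.
have itE i : i \in iota 0 k.+1 -> (i <= k)%N by rewrite mem_iota.
rewrite /block1; move: (iota 0 k.+1) itE => it itE.
rewrite mem_cat !inE => /orP[/orP[/eqP ->|/eqP ->] /=|/mapP[i /itE ik ->] /=]; lia.
Qed.

Section BlockSums.
Variables (A : comNzRingType) (x y z : A).

Definition weight (t : bool * (nat * nat * nat)) : A :=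
  (-1) ^+ t.1 * (x ^+ t.2.1.1 * y ^+ t.2.1.2 * z ^+ t.2.2).

Lemma block0_sum b m k : (k <= m)%N ->
  \sum_(t <- block0 b m k) weight t = (-1) ^+ b * ((x + y - z) * block x z m k).
Proof.
move=> km; rewrite block_mul // /block0 big_cat big_map -[iota _ _]/(index_iota 0 k.+1).
rewrite big_mkord !big_cons big_nil /weight /= mulrDr mulr_sumr; congr (_ + _).
  by case: b; rewrite /= ?expr0 ?expr1; ring.
Qed.

Lemma block1_sum b m k : (k <= m)%N ->
  \sum_(t <- block1 b m k) weight t = (-1) ^+ b * ((x + y - z) * block y z m k).
Proof.
move=> km; rewrite [x + y]addrC block_mul // /block1 big_cat big_map
  -[iota _ _]/(index_iota 0 k.+1).
rewrite big_mkord !big_cons big_nil /weight /= mulrDr mulr_sumr; congr (_ + _).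
  by case: b; rewrite /= ?expr0 ?expr1; ring.
by apply: eq_bigr => i _; rewrite expr1 [x * _]mulrC.
Qed.

Lemma blocks_sum b1 b2 m k l : (k <= m)%N -> (l <= m)%N ->
  \sum_(t <- block0 b1 m k ++ block1 b2 m l) weight t = two_blocks b1 b2 m k l x y z.
Proof.
move=> km lm; rewrite big_cat /= block0_sum // block1_sum // /two_blocks mulrDr.
by congr (_ + _); rewrite mulrCA.
Qed.

End BlockSums.

Section SpecialValues.
Variable A : comNzRingType.

Lemma two_blocks_e0 (x : A) b1 b2 m k l : (l < m)%N ->
  two_blocks b1 b2 m k l x 0 0 = (-1) ^+ b1 * x ^+ m.+1.
Proof.
move=> lm; rewrite /two_blocks block0r block0l // mulr0 !addr0 subr0.
by rewrite mulrCA -exprS.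
Qed.

Lemma two_blocks_e1 b1 b2 m k l : (k < m)%N ->
  two_blocks b1 b2 m k l 0 1 0 = (-1) ^+ b2 :> A.
Proof.
move=> km; rewrite /two_blocks block0l // block0r expr1n mulr0 !add0r subr0.
by rewrite mul1r mulr1.
Qed.

Lemma faran_e0 (x : A) : faran x 0 0 = x ^+ 3.
Proof. by rewrite /faran; ring. Qed.

Lemma faran_e1 : faran 0 1 0 = 1 :> A.
Proof. by rewrite /faran; ring. Qed.

Lemma mixed_e1 (x y z : A) : mixed x y z 0 1 0 = 4 * y ^+ 3.
Proof. by rewrite /mixed; ring. Qed.

Lemma mixed_e0 : mixed 1 0 0 1 0 0 = 1 :> A.
Proof. by rewrite /mixed; ring. Qed.

End SpecialValues.

(** * Members of [J] built from blocks *)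

Section Members.
Variable R : realType.
Local Notation K := R[i].
Local Notation J A B := (Hset R 2 A B `&` Iset (sphere_form R))%classic.

Lemma meval_T (z w : 'I_3 -> K) i : (T R i).@[zw z w] = z i * w i.
Proof.
transitivity ((zvar R i).@[zw z w] * (wvar R i).@[zw z w]); first exact: mevalM.
by congr (_ * _); rewrite mevalXU /zw ?(unsplitK (inl i)) ?(unsplitK (inr i)).
Qed.

Lemma herm_sum_member N sg (F : 'I_N -> {mpoly K[3]}) m h : free_fam F ->
  (forall a, F a \is m.-homog) -> herm_sum sg F = sphere_form R * h ->
  J #|[pred a | ~~ sg a]| #|[pred a | sg a]| (herm_sum sg F).
Proof.
move=> Ff Fh E; split; last by exists h.
split; [exact: herm_sum_sym | by exists m; apply: herm_sum_bihomog |].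
exact: signature_herm_sum.
Qed.

Lemma herm_sum_proj_degree N sg (F : 'I_N -> {mpoly K[3]}) m (i j : 'I_3) c :
  (forall a, F a \is m.-homog) -> i != j -> c != 0 ->
  (forall z, (herm_sum sg F).@[zw z (unit_pt R i)] = c * z i ^+ m) ->
  (herm_sum sg F).@[zw (unit_pt R j) (unit_pt R j)] != 0 ->
  proj_degree (herm_sum sg F) = m.
Proof.
move=> Fh ij c0 Ei Ej; apply: proj_degree_eq.
  by apply: has_bidegree_repr_self; [exact: herm_sum_sym | exact: herm_sum_bihomog].
by move=> k [q [_ qk pq]]; apply: (hequiv_degree_ge ij c0 Ei Ej qk pq).
Qed.

Lemma unit_ptE (i j : 'I_3) : unit_pt R i j = (val j == val i)%:R.
Proof. by []. Qed.

Section Blocks.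
Variables (b b' : bool) (m k l : nat).

Definition single_block := herm_sum (@msg (block0 b k k)) (mfam R (s := block0 b k k)).

Definition double_block :=
  herm_sum (@msg (block0 b m k ++ block1 b' m l)) (mfam R (s := block0 b m k ++ block1 b' m l)).

Lemma single_blockE : single_block = (-1) ^+ b * (sphere_form R * block (T R 0) (T R 2) k k).
Proof.
apply: etrans (mfam_sum R _) _.
exact: (block0_sum (T R 0) (T R 1) (T R 2) b (leqnn k)).
Qed.

Lemma double_blockE : (k <= m)%N -> (l <= m)%N ->
  double_block = two_blocks b b' m k l (T R 0) (T R 1) (T R 2).
Proof. by move=> km lm; apply: etrans (mfam_sum R _) _; apply: blocks_sum. Qed.

Lemma single_block_member :
  J (if b then 1 else k.+2)%N (if b then k.+2 else 1)%N single_block.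
Proof.
have -> : (if b then 1 else k.+2)%N = count (fun t => ~~ t.1) (block0 b k k).
  by rewrite (block0_count b k k negb); case: b => /=; lia.
have -> : (if b then k.+2 else 1)%N = count (fun t => t.1) (block0 b k k).
  by rewrite (block0_count b k k id); case: b => /=; lia.
rewrite -!card_ord_nth.
apply: (@herm_sum_member _ _ _ k.+1 ((-1) ^+ b * block (T R 0) (T R 2) k k)).
- exact/mfam_free/block0_uniq.
- exact/mfam_homog/block0_deg.
by rewrite -[LHS]/single_block single_blockE; apply: mulrCA.
Qed.

Hypotheses (km : (k + 2 <= m)%N) (lm : (l + 2 <= m)%N).

Lemma double_block_member :
  J ((if b then 1 else k.+2) + (if b' then 1 else l.+2))%N
    ((if b then k.+2 else 1) + (if b' then l.+2 else 1))%N double_block.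
Proof.
have k_m : (k <= m)%N by lia.
have l_m : (l <= m)%N by lia.
have -> : ((if b then 1 else k.+2) + (if b' then 1 else l.+2))%N =
    count (fun t => ~~ t.1) (block0 b m k ++ block1 b' m l).
  by rewrite count_cat (block0_count b m k negb) (block1_count b' m l negb); case: b;
    case: b' => /=; lia.
have -> : ((if b then k.+2 else 1) + (if b' then l.+2 else 1))%N =
    count (fun t => t.1) (block0 b m k ++ block1 b' m l).
  by rewrite count_cat (block0_count b m k id) (block1_count b' m l id); case: b; case: b' => /=;
    lia.
rewrite -!card_ord_nth.
apply: (@herm_sum_member _ _ _ m.+1 ((-1) ^+ b * block (T R 0) (T R 2) m k
                                     + (-1) ^+ b' * block (T R 1) (T R 2) m l)).
- exact/mfam_free/blocks_uniq.
- by apply: mfam_homog; rewrite all_cat block0_deg // block1_deg.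
by rewrite -[LHS]/double_block double_blockE.
Qed.

(** With the conjugate variables at [e_0] only a pure power of degree [m + 1] survives, and the
    value at [e_1] is a sign, as the lower bound requires. *)
Lemma double_block_degree : proj_degree double_block = m.+1.
Proof.
have k_m : (k <= m)%N by lia.
have l_m : (l <= m)%N by lia.
have ev z w : double_block.@[zw z w] =
    two_blocks b b' m k l (z 0 * w 0) (z 1 * w 1) (z 2 * w 2).
  rewrite double_blockE // (rmorph_two_blocks (meval (zw z w))).
  by congr (two_blocks _ _ _ _ _ _ _); apply: meval_T.
apply: (@herm_sum_proj_degree _ _ _ _ 0 1 ((-1) ^+ b)) => //.
- by apply: mfam_homog; rewrite all_cat block0_deg // block1_deg.
- by rewrite signr_eq0.
- move=> z; rewrite [LHS]ev !unit_ptE /= !mulr0 mulr1.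
  by apply: two_blocks_e0; lia.
rewrite [X in X != 0]ev !unit_ptE /= !mulr0 mulr1 two_blocks_e1 ?signr_eq0 //.
by lia.
Qed.

End Blocks.
End Members.

(** * Cubic members of projective degree 3 *)

Section Cubics.
Variable R : realType.
Local Notation K := R[i].
Local Notation J A B := (Hset R 2 A B `&` Iset (sphere_form R))%classic.

Local Notation Xm a b c := ('X_[mon (a, b, c)%N] : {mpoly K[3]}).

Let s3 : K := sqrtC 3.

Lemma s3_neq0 : s3 != 0.
Proof. by rewrite sqrtC_eq0 pnatr_eq0. Qed.

Lemma s3_conj : s3 * s3^* = 3.
Proof.
have /CrealP -> : s3 \is Num.real by rewrite ger0_real // sqrtC_ge0 ler0n.
by rewrite -expr2 sqrtCK.
Qed.

Lemma zliftZ c f : zlift (c *: f) = c%:MP * zlift f :> {mpoly K[3 + 3]}.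
Proof. exact: mmapZ. Qed.

Lemma wliftZ c f : wlift (c *: f) = (c^*)%:MP * wlift f :> {mpoly K[3 + 3]}.
Proof. exact: mmapZ. Qed.

Lemma s3_lift : (s3%:MP * (s3^*)%:MP : {mpoly K[3 + 3]}) = 3.
Proof.
transitivity ((s3 * s3^*)%:MP : {mpoly K[3 + 3]}); first by apply/esym; apply: mpolyCM.
by rewrite s3_conj; apply: (rmorph_nat (@mpolyC (3 + 3) K)).
Qed.

Lemma mmap1_mon (A : comNzRingType) (h : 'I_3 -> A) a b c :
  mmap1 h (mon (a, b, c)) = h 0 ^+ a * h 1 ^+ b * h 2 ^+ c.
Proof.
rewrite /mmap1 !big_ord_recl big_ord0 mulr1 mulrA !mnmE /vec3 /=.
by congr (_ ^+ _ * _ ^+ _ * _ ^+ _); congr (h _); apply: val_inj.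
Qed.

Lemma zlift_mon a b c :
  zlift (Xm a b c) = zvar R 0 ^+ a * zvar R 1 ^+ b * zvar R 2 ^+ c.
Proof. by etransitivity; [apply: mmapX | apply: mmap1_mon]. Qed.

Lemma wlift_mon a b c :
  wlift (Xm a b c) = wvar R 0 ^+ a * wvar R 1 ^+ b * wvar R 2 ^+ c.
Proof. by etransitivity; [apply: mmapX | apply: mmap1_mon]. Qed.

Lemma Xm_homog a b c : (a + b + c = 3)%N -> Xm a b c \is 3.-homog.
Proof. by move=> E; rewrite dhomogX /= mdeg_mon /= E. Qed.

Lemma mcoeff_mon t u : ('X_[mon t] : {mpoly K[3]})@_(mon u) = (t == u)%:R.
Proof. by rewrite mcoeffX (inj_eq mon_inj). Qed.

Lemma sum_signs3 (A : comNzRingType) (q : nat -> A) :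
  \sum_(a < 4) (-1) ^+ (val a == 3)%N * q a = q 0%N + (q 1%N + (q 2%N + - q 3%N)).
Proof. by rewrite !big_ord_recl big_ord0 /=; ring. Qed.

Lemma sum_signs13 (A : comNzRingType) (q : nat -> A) :
  \sum_(a < 4) (-1) ^+ odd a * q a = q 0%N + (- q 1%N + (q 2%N + - q 3%N)).
Proof. by rewrite !big_ord_recl big_ord0 /=; ring. Qed.

Section Faran.
Variable b : bool.

Definition faran_fam (a : nat) : {mpoly K[3]} :=
  match a with
  | 0 => Xm 3 0 0 | 1 => Xm 0 3 0 | 2 => s3 *: Xm 1 1 1 | _ => Xm 0 0 3
  end%N.

Definition faran_sg (a : 'I_4) : bool := b (+) (val a == 3)%N.

Definition faran_form := herm_sum faran_sg (fun a : 'I_4 => faran_fam a).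

Lemma faran_free : free_fam (fun a : 'I_4 => faran_fam a).
Proof.
pose mu (a : 'I_4) := mon (match val a with
  | 0 => (3, 0, 0) | 1 => (0, 3, 0) | 2 => (1, 1, 1) | _ => (0, 0, 3) end)%N.
apply: (@free_fam_pivot _ _ _ mu) => [a|a b'].
  by case: a => [[|[|[|[|a]]]] ha] //=; rewrite /faran_fam /mu /= ?mcoeffZ mcoeff_mon
    ?mulr1 ?oner_neq0 ?s3_neq0.
by case: a => [[|[|[|[|a]]]] ha] //; case: b' => [[|[|[|[|c]]]] hc] //= _;
  rewrite /faran_fam /mu /= ?mcoeffZ mcoeff_mon ?mulr0.
Qed.

Lemma faran_homog (a : 'I_4) : faran_fam a \is 3.-homog.
Proof.
case: a => [[|[|[|[|]]]]] //= *; rewrite /faran_fam /=; try exact: Xm_homog.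
by apply: dhomogZ; apply: Xm_homog.
Qed.

Lemma faran_sum_aux (A : comNzRingType) (x y z u v w s s' : A) : s * s' = 3 ->
  x ^+ 3 * y ^+ 0 * z ^+ 0 * (u ^+ 3 * v ^+ 0 * w ^+ 0) +
  (x ^+ 0 * y ^+ 3 * z ^+ 0 * (u ^+ 0 * v ^+ 3 * w ^+ 0) +
   (s * (x ^+ 1 * y ^+ 1 * z ^+ 1) * (s' * (u ^+ 1 * v ^+ 1 * w ^+ 1)) +
   - (x ^+ 0 * y ^+ 0 * z ^+ 3 * (u ^+ 0 * v ^+ 0 * w ^+ 3)))) =
  faran (x * u) (y * v) (z * w).
Proof.
move=> ss; rewrite faranE -ss; ring.
Qed.

Lemma faran_formE : faran_form = (-1) ^+ b * faran (T R 0) (T R 1) (T R 2).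
Proof.
pose q k := zlift (faran_fam k) * wlift (faran_fam k).
have E : faran_form = (-1) ^+ b * \sum_(a < 4) (-1) ^+ (val a == 3)%N * q a.
  rewrite mulr_sumr; apply: eq_bigr => a _.
  by rewrite mulrA -signr_addb scaler_sign mulr_sign.
apply: etrans E _; congr (_ * _).
apply: etrans (sum_signs3 q) _.
apply: etrans (faran_sum_aux _ _ _ _ _ _ s3_lift).
congr (_ + (_ + (_ + - _))); rewrite /q /=.
- by congr (_ * _); [exact: zlift_mon | exact: wlift_mon].
- by congr (_ * _); [exact: zlift_mon | exact: wlift_mon].
- congr (_ * _).
    by apply: etrans (zliftZ _ _) _; congr (_ * _); exact: zlift_mon.
  by apply: etrans (wliftZ _ _) _; congr (_ * _); exact: wlift_mon.
by congr (_ * _); [exact: zlift_mon | exact: wlift_mon].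
Qed.

Lemma faran_member : J (if b then 1 else 3)%N (if b then 3 else 1)%N faran_form.
Proof.
have -> : (if b then 1 else 3)%N = #|[pred a | ~~ faran_sg a]|.
  rewrite -sum1_card big_mkcond !big_ord_recl big_ord0 !inE /faran_sg /=.
  by case: b.
have -> : (if b then 3 else 1)%N = #|[pred a | faran_sg a]|.
  rewrite -sum1_card big_mkcond !big_ord_recl big_ord0 !inE /faran_sg /=.
  by case: b.
pose q (A : comNzRingType) (x y z : A) := x ^+ 2 + y ^+ 2 + z ^+ 2 - x * y + y * z + x * z.
apply: (@herm_sum_member _ _ _ _ 3 ((-1) ^+ b * q _ (T R 0) (T R 1) (T R 2))).
- exact: faran_free.
- exact: faran_homog.
by rewrite -[LHS]/faran_form faran_formE; apply: mulrCA.
Qed.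

Lemma faran_degree : proj_degree faran_form = 3.
Proof.
have ev z w : faran_form.@[zw z w] = (-1) ^+ b * faran (z 0 * w 0) (z 1 * w 1) (z 2 * w 2).
  rewrite faran_formE; etransitivity; first exact: mevalM.
  congr (_ * _); first exact: (rmorph_sign (meval (zw z w))).
  etransitivity; first exact: (rmorph_faran (meval (zw z w))).
  by congr (faran _ _ _); apply: meval_T.
apply: (@herm_sum_proj_degree _ _ _ _ _ 0 1 ((-1) ^+ b)).
- exact: faran_homog.
- by [].
- by rewrite signr_eq0.
- by move=> z; rewrite [LHS]ev !unit_ptE /= !mulr0 mulr1 faran_e0.
by rewrite [X in X != 0]ev !unit_ptE /= !mulr0 mulr1 faran_e1 mulr1 signr_eq0.
Qed.

End Faran.

Definition mixed_fam (a : nat) : {mpoly K[3]} :=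
  match a with
  | 0%N => Xm 3 0 0 + Xm 1 0 2 *+ 3
  | 1%N => Xm 2 0 1 *+ 3 + Xm 0 0 3
  | 2%N => Xm 0 3 0 *+ 2
  | _ => s3 *: (Xm 2 1 0 - Xm 0 1 2)
  end.

Definition mixed_sg (a : 'I_4) : bool := odd a.

Definition mixed_form := herm_sum mixed_sg (fun a : 'I_4 => mixed_fam a).

Lemma mixed_free : free_fam (fun a : 'I_4 => mixed_fam a).
Proof.
pose mu (a : 'I_4) := mon (match val a with
  | 0 => (3, 0, 0) | 1 => (0, 0, 3) | 2 => (0, 3, 0) | _ => (2, 1, 0) end)%N.
apply: (@free_fam_pivot _ _ _ mu) => [a|a b'].
  case: a => [[|[|[|[|a]]]] ha] //=; rewrite /mixed_fam /mu /= ?mcoeffZ ?mcoeffB ?mcoeffD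
    ?mcoeffMn !mcoeff_mon /= ?mul0rn ?subr0 ?addr0 ?add0r ?mulr1 ?oner_neq0 ?s3_neq0
    ?(pnatr_eq0 _ 2) //.
by case: a => [[|[|[|[|a]]]] ha] //; case: b' => [[|[|[|[|c]]]] hc] //= _;
  rewrite /mixed_fam /mu /= ?mcoeffZ ?mcoeffB ?mcoeffD ?mcoeffMn !mcoeff_mon /=
    ?mul0rn ?subr0 ?addr0 ?mulr0.
Qed.

Lemma mixed_homog (a : 'I_4) : mixed_fam a \is 3.-homog.
Proof.
have X a' b c : (a' + b + c = 3)%N -> Xm a' b c \is 3.-homog by apply: Xm_homog.
case: a => [[|[|[|[|]]]]] //= *; rewrite /mixed_fam /=.
- by apply: rpredD; [exact: X | apply: rpredMn; exact: X].
- by apply: rpredD; [apply: rpredMn; exact: X | exact: X].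
- by apply: rpredMn; exact: X.
by apply: dhomogZ; apply: rpredB; exact: X.
Qed.

Lemma mixed_sum_aux (A : comNzRingType) (x y z u v w s s' : A) : s * s' = 3 ->
  (x ^+ 3 * y ^+ 0 * z ^+ 0 + (x ^+ 1 * y ^+ 0 * z ^+ 2) *+ 3) *
  (u ^+ 3 * v ^+ 0 * w ^+ 0 + (u ^+ 1 * v ^+ 0 * w ^+ 2) *+ 3) +
  (- (((x ^+ 2 * y ^+ 0 * z ^+ 1) *+ 3 + x ^+ 0 * y ^+ 0 * z ^+ 3) *
      ((u ^+ 2 * v ^+ 0 * w ^+ 1) *+ 3 + u ^+ 0 * v ^+ 0 * w ^+ 3)) +
   ((x ^+ 0 * y ^+ 3 * z ^+ 0) *+ 2 * ((u ^+ 0 * v ^+ 3 * w ^+ 0) *+ 2) +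
   - (s * (x ^+ 2 * y ^+ 1 * z ^+ 0 - x ^+ 0 * y ^+ 1 * z ^+ 2) *
      (s' * (u ^+ 2 * v ^+ 1 * w ^+ 0 - u ^+ 0 * v ^+ 1 * w ^+ 2))))) =
  mixed x y z u v w.
Proof.
move=> ss; have E X Y : s * X * (s' * Y) = 3 * (X * Y) by rewrite -ss; ring.
by rewrite E mixedE; ring.
Qed.

Lemma zliftDMn f g k : zlift (f + g *+ k) = zlift f + zlift g *+ k :> {mpoly K[3 + 3]}.
Proof. by etransitivity; [exact: raddfD | congr (_ + _); exact: raddfMn]. Qed.

Lemma wliftDMn f g k : wlift (f + g *+ k) = wlift f + wlift g *+ k :> {mpoly K[3 + 3]}.
Proof. by etransitivity; [exact: raddfD | congr (_ + _); exact: raddfMn]. Qed.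

Lemma mixed_formE : mixed_form =
  mixed (zvar R 0) (zvar R 1) (zvar R 2) (wvar R 0) (wvar R 1) (wvar R 2).
Proof.
pose q k := zlift (mixed_fam k) * wlift (mixed_fam k).
have E : mixed_form = \sum_(a < 4) (-1) ^+ odd a * q a.
  by apply: eq_bigr => a _; rewrite scaler_sign mulr_sign.
apply: etrans E _.
apply: etrans (sum_signs13 q) _.
apply: etrans (mixed_sum_aux _ _ _ _ _ _ s3_lift).
congr (_ + (- _ + (_ + - _))); rewrite /q /=.
- congr (_ * _).
    by apply: etrans (zliftDMn _ _ _) _; congr (_ + _ *+ _); exact: zlift_mon.
  by apply: etrans (wliftDMn _ _ _) _; congr (_ + _ *+ _); exact: wlift_mon.
- congr (_ * _).
    apply: etrans (raddfD _ _ _) _; congr (_ + _); last exact: zlift_mon.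
    by apply: etrans (raddfMn _ _ _) _; congr (_ *+ _); exact: zlift_mon.
  apply: etrans (raddfD _ _ _) _; congr (_ + _); last exact: wlift_mon.
  by apply: etrans (raddfMn _ _ _) _; congr (_ *+ _); exact: wlift_mon.
- congr (_ * _).
    by apply: etrans (raddfMn _ _ _) _; congr (_ *+ _); exact: zlift_mon.
  by apply: etrans (raddfMn _ _ _) _; congr (_ *+ _); exact: wlift_mon.
congr (_ * _).
  apply: etrans (zliftZ _ _) _; congr (_ * _).
  by apply: etrans (raddfB _ _ _) _; congr (_ - _); exact: zlift_mon.
apply: etrans (wliftZ _ _) _; congr (_ * _).
by apply: etrans (raddfB _ _ _) _; congr (_ - _); exact: wlift_mon.
Qed.

Definition mixed_cofactor (A : comNzRingType) (x y z x' y' z' : A) :=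
  let a := (x + z) * (x' - z') in let b := (x - z) * (x' + z') in let c := 2 * (y * y') in
  a ^+ 2 + b ^+ 2 + c ^+ 2 - a * b - b * c - c * a.

Lemma mixed_member : J 2 2 mixed_form.
Proof.
have Hp : #|[pred a | ~~ mixed_sg a]| = 2%N.
  by rewrite -sum1_card big_mkcond !big_ord_recl big_ord0 !inE /mixed_sg.
have Hm : #|[pred a | mixed_sg a]| = 2%N.
  by rewrite -sum1_card big_mkcond !big_ord_recl big_ord0 !inE /mixed_sg.
have := @herm_sum_member _ _ _ _ 3 (mixed_cofactor (zvar R 0) (zvar R 1) (zvar R 2)
  (wvar R 0) (wvar R 1) (wvar R 2)) mixed_free mixed_homog mixed_formE.
by rewrite Hp Hm.
Qed.

(** The pure power is taken at [e_1], where the form is [4 y^3]; at [e_0] it is [x^3 + 3 x z^2],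
    which is not a pure power. *)
Lemma mixed_degree : proj_degree mixed_form = 3.
Proof.
have ev z w : mixed_form.@[zw z w] = mixed (z 0) (z 1) (z 2) (w 0) (w 1) (w 2).
  rewrite mixed_formE; etransitivity; first exact: (rmorph_mixed (meval (zw z w))).
  have ez i : (zvar R i).@[zw z w] = z i by rewrite mevalXU /zw (unsplitK (inl i)).
  have ew i : (wvar R i).@[zw z w] = w i by rewrite mevalXU /zw (unsplitK (inr i)).
  by congr (mixed _ _ _ _ _ _); [exact: ez|exact: ez|exact: ez|exact: ew|exact: ew|exact: ew].
apply: (@herm_sum_proj_degree _ _ _ _ _ 1 0 4).
- exact: mixed_homog.
- by [].
- by rewrite pnatr_eq0.
- by move=> z; rewrite [LHS]ev !unit_ptE /= mixed_e1.
by rewrite [X in X != 0]ev !unit_ptE /= mixed_e0 oner_neq0.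
Qed.

End Cubics.

Local Open Scope classical_set_scope.

(** * Suprema of projective degrees *)

Section Supremum.
Variables (R : realType) (n : nat) (S : set {mpoly R[i][n + n]}).

Lemma proj_degree_sup_ge p : S p -> ((proj_degree p)%:R%:E <= proj_degree_sup S)%E.
Proof. by move=> Sp; apply: ereal_sup_ubound; exists p. Qed.

Lemma proj_degree_sup_le d : (forall p, S p -> (proj_degree p <= d)%N) ->
  (proj_degree_sup S <= d%:R%:E)%E.
Proof. by move=> Sd; apply: ge_ereal_sup => _ [p Sp <-]; rewrite lee_fin ler_nat Sd. Qed.

Lemma proj_degree_sup_fin d : (forall p, S p -> (proj_degree p <= d)%N) ->
  (proj_degree_sup S < +oo)%E.
Proof. by move=> Sd; apply: le_lt_trans (proj_degree_sup_le Sd) (ltry _). Qed.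

Lemma proj_degree_sup_max p : S p -> (forall q, S q -> (proj_degree q <= proj_degree p)%N) ->
  proj_degree_sup S = (proj_degree p)%:R%:E.
Proof.
by move=> Sp Smax; apply/eqP; rewrite eq_le proj_degree_sup_le // proj_degree_sup_ge.
Qed.

Lemma proj_degree_sup_infty : (forall d, exists2 p, S p & (d <= proj_degree p)%N) ->
  proj_degree_sup S = +oo%E.
Proof.
move=> Sd; apply/eqyP => x x0; have [p Sp dp] := Sd (Num.bound x).
apply: le_trans (proj_degree_sup_ge Sp); rewrite lee_fin.
by apply/ltW/(lt_le_trans (archi_boundP (ltW x0))); rewrite ler_nat.
Qed.

End Supremum.

(** * The signature pairs of the theorem *)

Section Members.
Variable R : realType.
Local Notation J A B := (Hset R 2 A B `&` Iset (sphere_form R)).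

Lemma card_signs N (sg : 'I_N -> bool) : (#|[pred a | ~~ sg a]| + #|[pred a | sg a]|)%N = N.
Proof. by rewrite addnC -[RHS]card_ord -(cardC [pred a | sg a]). Qed.

Lemma member_bound A B p : (A + B <= 4)%N \/ A = 1%N \/ B = 1%N -> (0 < A + B)%N ->
  J A B p -> (proj_degree p <= 'C((A + B).-1, 2))%N.
Proof.
move=> AB AB0 [/Hset_herm_sum[N [sg [F [Ff -> EA EB [m Fh]]]]] pI].
have NE := card_signs sg; rewrite EA EB in NE.
rewrite NE in AB AB0 *; apply: (member_proj_degree Ff Fh pI AB0).
case: AB => [|AB]; first by left.
(* A sign [s] carried by exactly one index is what the isotropy argument asks for. *)
right; have [s] : exists s, #|[pred a | sg a == s]| = 1%N.
  case: AB => E1; [exists false; rewrite -E1 -EA | exists true; rewrite -E1 -EB].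
    by apply: eq_card => a; rewrite !inE eqbF_neg.
  by apply: eq_card => a; rewrite !inE eqb_id.
move/mem_card1 => [j0 Ej]; exists j0 => a aj.
have := Ej a; have := Ej j0; rewrite !inE eqxx (negPf aj) => /eqP -> .
by case: (sg a); case: s Ej.
Qed.

Lemma members00 : J 0 0 = [set 0].
Proof.
apply/seteqP; split => [p [/Hset_herm_sum[N [sg [F [Ff -> EA EB _]]]] _]|_ ->].
  have := card_signs sg; rewrite EA EB => N0; rewrite -N0 in sg F Ff EA EB *.
  by rewrite /herm_sum big_ord0.
have E : 0 = herm_sum (fun _ : 'I_0 => false) (fun _ => 0 : {mpoly R[i][3]}).
  by rewrite /herm_sum big_ord0.
have := @herm_sum_member R 0 (fun=> false) (fun=> 0) 0 0.
rewrite -E !eq_card0 => [H|a|a]; try by case: a.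
apply: H.
- by move=> c _ [].
- by move=> [].
by rewrite mulr0.
Qed.

Lemma members_empty A B : (A, B) = (1, 1)%N \/ ((A = 0 \/ B = 0) /\ (A + B) <> 0)%N ->
  J A B = set0.
Proof.
move=> AB; apply/seteqP; split => // p [/Hset_herm_sum[N [sg [F [Ff -> EA EB [m Fh]]]]] pI].
have NE := card_signs sg; rewrite EA EB in NE.
case: AB => [[A1 B1]|[AB0 ABn]].
  by apply: (member_rank2 Ff Fh pI); rewrite -NE A1 B1.
have N0 : (0 < N)%N by lia.
case: AB0 => E0.
  apply: (@member_definite _ _ _ _ _ Ff Fh pI true N0) => a.
  have /card0_eq/(_ a) := etrans EA E0; rewrite !inE.
  by case: (sg a).
apply: (@member_definite _ _ _ _ _ Ff Fh pI false N0) => a.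
by have /card0_eq/(_ a) := etrans EB E0; rewrite !inE.
Qed.

(** For [k = 0] the block is 1, and the member is the sphere form up to sign. *)
Lemma single_block0_degree b : proj_degree (single_block R b 0) = 1%N.
Proof.
have ev z w : (single_block R b 0).@[zw z w] = (-1) ^+ b * (z 0 * w 0 + z 1 * w 1 - z 2 * w 2).
  rewrite single_blockE; etransitivity; first exact: mevalM.
  congr (_ * _); first exact: (rmorph_sign (meval (zw z w))).
  etransitivity; first exact: mevalM.
  rewrite meval_sphere_form -[RHS]mulr1; congr (_ * _).
  etransitivity; first exact: (rmorph_block (meval (zw z w))).
  by rewrite /block big_ord_recl big_ord0 !expr0 mulr1 addr0.
apply: (@herm_sum_proj_degree _ _ _ _ _ 0 1 ((-1) ^+ b)).
- exact/mfam_homog/block0_deg.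
- by [].
- by rewrite signr_eq0.
- by move=> z; rewrite [LHS]ev !unit_ptE /= !mulr0 mulr1 addr0 subr0.
by rewrite [X in X != 0]ev !unit_ptE /= !mulr0 mulr1 add0r subr0 mulr1 signr_eq0.
Qed.

Lemma members21 A B : (A, B) = (2, 1)%N \/ (A, B) = (1, 2)%N ->
  exists2 p, J A B p & proj_degree p = 1%N.
Proof.
case=> -[-> ->].
  by exists (single_block R false 0); [apply: (single_block_member R false 0)
    | apply: single_block0_degree].
by exists (single_block R true 0); [apply: (single_block_member R true 0)
  | apply: single_block0_degree].
Qed.

Lemma members4 A B : (A, B) = (2, 2)%N \/ (A, B) = (3, 1)%N \/ (A, B) = (1, 3)%N ->
  exists2 p, J A B p & proj_degree p = 3%N.
Proof.
case=> [[-> ->]|[[-> ->]|[-> ->]]].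
- by exists (mixed_form R); [apply: mixed_member | apply: mixed_degree].
- by exists (faran_form R false); [apply: (faran_member R false) | apply: faran_degree].
by exists (faran_form R true); [apply: (faran_member R true) | apply: faran_degree].
Qed.

Lemma members_unbounded A B d : (2 <= A)%N -> (2 <= B)%N -> (6 <= A + B)%N ->
  exists2 p, J A B p & (d <= proj_degree p)%N.
Proof.
move=> A2 B2 AB.
(* A block has signature [(k + 2, 1)] or the reverse. Two blocks of equal sign give the pairs with
   an entry 2, and two of opposite signs those with both entries at least 3. *)
have [b [b' [k [l [-> ->]]]]] : exists b b' k l,
    A = ((if b then 1 else k.+2) + (if b' then 1 else l.+2))%N /\
    B = ((if b then k.+2 else 1) + (if b' then l.+2 else 1))%N.
  have [EB|B3] := eqVneq B 2%N; first by exists false, false, (A - 4)%N, 0%N; lia.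
  have [EA|A3] := eqVneq A 2%N; first by exists true, true, (B - 4)%N, 0%N; lia.
  by exists false, true, (A - 3)%N, (B - 3)%N; lia.
have km : (k + 2 <= k + l + 2 + d)%N by lia.
have lm : (l + 2 <= k + l + 2 + d)%N by lia.
(* The exponent [m] changes the degree but not the signature. *)
exists (double_block R b b' (k + l + 2 + d) k l); first exact: double_block_member.
by rewrite double_block_degree //; lia.
Qed.

Lemma members_rank1 A B : (A = 1 \/ B = 1)%N -> (1 < A * B)%N -> J A B !=set0.
Proof.
case=> -> AB.
  by exists (single_block R true (B - 2)); have := single_block_member R true (B - 2);
    have -> : (B - 2).+2 = B by lia.
by exists (single_block R false (A - 2)); have := single_block_member R false (A - 2);
  have -> : (A - 2).+2 = A by lia.
Qed.

End Members.

Theorem theorem7p1 (R : realType) (A B : nat) :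
  let J := Hset R 2 A B `&` Iset (sphere_form R) in
  ((A, B) = (0, 0)%N -> J = [set 0]) /\
  ((A, B) = (1, 1)%N \/ ((A = 0%N \/ B = 0%N) /\ (A + B)%N <> 0%N) ->
     J = set0) /\
  ((A, B) = (2, 1)%N \/ (A, B) = (1, 2)%N ->
     [/\ J !=set0, proj_degree_sup J = 1%:E & (proj_degree_sup J < +oo)%E]) /\
  ((A, B) = (2, 2)%N \/ (A, B) = (3, 1)%N \/ (A, B) = (1, 3)%N ->
     [/\ J !=set0, proj_degree_sup J = 3%:E & (proj_degree_sup J < +oo)%E]) /\
  ((2 <= A)%N /\ (2 <= B)%N /\ (6 <= A + B)%N ->
     J !=set0 /\ proj_degree_sup J = +oo%E) /\
  ((A = 1%N \/ B = 1%N) /\ (1 < A * B)%N ->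
     J !=set0 /\ (proj_degree_sup J < +oo)%E).
Proof.
(* For [A + B] equal to 3 and 4 the general bound is ['C(2, 2) = 1] and ['C(3, 2) = 3], and both
   values are attained. *)
move=> J; have sup d : ((A + B <= 4)%N \/ A = 1%N \/ B = 1%N) /\ (0 < A + B)%N ->
    'C((A + B).-1, 2) = d -> (exists2 p, J p & proj_degree p = d) ->
    [/\ J !=set0, proj_degree_sup J = d%:R%:E & (proj_degree_sup J < +oo)%E].
  move=> [AB AB0] Ed [p Jp pd].
  have bound q : J q -> (proj_degree q <= d)%N by rewrite -Ed; apply: member_bound.
  split; [by exists p | | exact: proj_degree_sup_fin bound].
  by rewrite -pd; apply: proj_degree_sup_max => // q /bound; rewrite pd.
split; first by move=> [A0 B0]; rewrite /J A0 B0; apply: members00.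
split; first exact: members_empty.
split.
  move=> AB; apply: (sup 1%N); last exact: members21.
    by case: AB => -[-> ->]; split=> //; left.
  by case: AB => -[-> ->].
split.
  move=> AB; apply: (sup 3%N); last exact: members4.
    by case: AB => [|[]] -[-> ->]; split=> //; left.
  by case: AB => [|[]] -[-> ->].
split.
  move=> [A2 [B2 AB]]; split; last by apply: proj_degree_sup_infty => d; apply: members_unbounded.
  by have [p] := members_unbounded R 0 A2 B2 AB; exists p.
move=> [AB AB1]; split; first exact: members_rank1.
apply: (@proj_degree_sup_fin _ _ _ 'C((A + B).-1, 2)) => p.
by apply: member_bound; [right | lia].
Qed.
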